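(* Consider a first-order mean field game $G=(\mathbb R^d,m_0,C^0([0,T],\mathbb R^d),(S_{i,M})_{i\in\mathbb R^d},J)$ satisfying conditions $( * )$ and (i)–(v) of the context, with monotone cost $J$. Suppose that the maps $m\mapsto f(\cdot,m)$ and $m\mapsto g(\cdot,m)$ are Lipschitz from $\mathcal P(\mathbb R^d)$ (with $d_1$) to $C^1(\mathbb R^d)$. Let $\Psi_1\in\mathcal A$, $\bar\eta_1=\eta_1=\Psi_1\sharp m_0$, and let the fictitious play be defined for $n=1,2,\dots$ by $$\Psi_{n+1}(i)=\arg\min_{\gamma\in H^1,\ \gamma(0)=i}\int_0^T\big(L(\gamma_t,\dot\gamma_t)+f(\gamma_t,e_t\sharp\bar\eta_n)\big)dt+g(\gamma_T,e_T\sharp\bar\eta_n)\quad\text{for }m_0\text{-a.e. }i\in\mathbb R^d,$$ $$\eta_{n+1}=\Psi_{n+1}\sharp m_0,\qquad \bar\eta_{n+1}=\frac1{n+1}\sum_{j=1}^{n+1}\eta_j.$$ Then $d_1(\eta_n,\tilde\eta)\to0$ and $d_1(\bar\eta_n,\tilde\eta)\to0$, where $\tilde\eta\in\mathcal P_G(V)$ is the unique Nash equilibrium distribution.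
   Context: $\mathcal P(X)$ denotes the Borel probability measures on $X$, $\sharp$ denotes push-forward. $T>0$; $V=C^0([0,T],\mathbb R^d)$ with the supremum norm; $e_t:V\to\mathbb R^d$, $e_t(\gamma)=\gamma(t)$; $m_0\in\mathcal P(\mathbb R^d)$ is non-atomic. For $x\in\mathbb R^d$, $M>0$, $S_{x,M}=\{\gamma\in H^1([0,T],\mathbb R^d):\gamma(0)=x,\ \|\dot\gamma\|_{L^2}\le\sqrt T M\}$. Given $L:\mathbb R^d\times\mathbb R^d\to\mathbb R$ and $f,g:\mathbb R^d\times\mathcal P(\mathbb R^d)\to\mathbb R$, the cost $J:V\times\mathcal P(V)\to\mathbb R\cup\{+\infty\}$ is $$J(\gamma,\eta)=\int_0^T\big(L(\gamma_t,\dot\gamma_t)+f(\gamma_t,e_t\sharp\eta)\big)dt+g(\gamma_T,e_T\sharp\eta)$$ if $\gamma\in H^1([0,T],\mathbb R^d)$, and $J(\gamma,\eta)=+\infty$ otherwise. The first-order mean field game is the game with player set $I=\mathbb R^d$, player distribution $\lambda=m_0$, action sets $A_i=S_{i,M}$ and cost $J$. Admissible profiles: $\mathcal A=\{\Psi:\mathbb R^d\to V\text{ measurable}:\Psi(i)\in S_{i,M}\text{ for }m_0\text{-a.e. }i\}$ (identified $m_0$-a.e.); $\mathcal P_G(V)=\{\Psi\sharp m_0:\Psi\in\mathcal A\}$. $d_1(\eta_1,\eta_2)=\sup\{\int f\,d(\eta_1-\eta_2): f\text{ 1-Lipschitz}\}$, and $\overline{\mathrm{cov}(\mathcal P_G(V))}$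 is the $d_1$-closure of the convex hull of $\mathcal P_G(V)$. A Nash equilibrium is $\tilde\Psi\in\mathcal A$ with $\tilde\Psi(i)\in\arg\min_{\gamma\in S_{i,M}}J(\gamma,\tilde\Psi\sharp m_0)$ for $m_0$-a.e. $i$; $\tilde\eta=\tilde\Psi\sharp m_0$ is the equilibrium distribution. $J$ is monotone if for all $\eta,\eta'\in\overline{\mathrm{cov}(\mathcal P_G(V))}$: $\int_V|J(\gamma,\eta)|\,d\eta'(\gamma)<\infty$ and $\int_V(J(\gamma,\eta)-J(\gamma,\eta'))\,d(\eta-\eta')(\gamma)\ge0$. Lipschitz from $\mathcal P(\mathbb R^d)$ to $C^1(\mathbb R^d)$ means: there is $C>0$ with $\|f(\cdot,m)-f(\cdot,m')\|_{C^1}\le C\,d_1(m,m')$ for all $m,m'$ (likewise for $g$), where $\|\phi\|_{C^1}=\sup|\phi|+\sup\|\nabla\phi\|$. Conditions $( * )$: ( *.i) $m_0$ has compact support; ( *.ii) for every $x$ the function $L(x,\cdot):\mathbb R^d\to\mathbb R$ is strongly convex and $C^2$, and there is a non-decreasing coercive map $\theta:\mathbb R_+\to\mathbb R_+$ such that: for some $c_0,C>0$, $\theta(\|v\|)-c_0\le L(x,v)\le C(1+\|v\|^2)$ for all $x,v$; for every $r>0$ there is $C(r)$ with $\max(\|L_x(x,v)\|,\|L_v(x,v)\|)\le C(r)\theta(\|v\|)$ for all $\|x\|\le r$, $v\in\mathbb R^d$; and for every $D>0$ there is $K_D>0$ with $\theta(q+m)\le K_D(1+\theta(q))$ for all $q\in\mathbb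 R_+$, $m\in[0,D]$; ( *.iii) $f,g$ are continuous, for every $m\in\mathcal P(\mathbb R^d)$ the maps $f(\cdot,m),g(\cdot,m):\mathbb R^d\to\mathbb R$ are $C^1$, and there are $C,b>0$ with $\max(\|f_x(x,m)\|,\|g_x(x,m)\|)\le C(\|x\|^b+1)$ for all $(x,m)$. Choice of $M$: with $R=\sup_{x\in\mathrm{supp}(m_0)}\|x\|$, $M=M(R)>0$ is a constant such that for every $\eta\in\mathcal P(V)$ and every $x$ with $\|x\|\le R$, every solution $\gamma$ of $\frac{d}{dt}L_v(\gamma_t,\dot\gamma_t)=L_x(\gamma_t,\dot\gamma_t)+f_x(\gamma_t,e_t\sharp\eta)$ for a.e. $t$, $\gamma(0)=x$, $L_v(\gamma_T,\dot\gamma_T)=-g_x(\gamma_T,e_T\sharp\eta)$, satisfies $\|\gamma\|_\infty,\|\dot\gamma\|_\infty\le M$. (Minimizers of $J(\cdot,\eta)$ among absolutely continuous paths with given initial point solve this system.) Conditions (i)–(v) (with $A_i=S_{i,M}$): (i) the correspondence $i\mapsto A_i$ is compact valued and continuous, i.e. its graph is closed in $\mathbb R^d\times V$ and $\{i:A_i\cap U\ne\emptyset\}$ is open for every open $U\subseteq V$; (ii) $J$ is lower semi-continuous on $V\times\overline{\mathrm{cov}(\mathcal P_G(V))}$; (iii) $(i,\eta)\mapsto\min_{\gamma\in A_i}J(\gamma,\eta)$ is continuous on $\mathbb R^d\times\mathcal P_G(V)$; (iv) $\overline{\mathrm{cov}(\mathcal P_G(V))}$ is compact; (v) for every $\eta\in\overline{\mathrm{cov}(\mathcal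 P_G(V))}$, for $m_0$-a.e. $i$ there is exactly one minimizer of $J(\cdot,\eta)$ in $A_i$. *)

(* Defs.v *)
From HB Require Import structures.
From mathcomp Require Import all_boot all_order all_algebra.
From mathcomp Require Import all_classical all_reals all_analysis.
From mathcomp Require Import giry.
From mathcomp Require Import ring lra.

Set Implicit Arguments.
Unset Strict Implicit.
Unset Printing Implicit Defensive.

Import Order.TTheory GRing.Theory Num.Theory.
Import numFieldNormedType.Exports.

Local Open Scope classical_set_scope.
Local Open Scope ring_scope.

(* The library norm of 'rV[R]_d is the max norm: it gives the right topology,
   but all numerical bounds below use the Euclidean norm. *)
Section euclidean_norm.
Context {R : realType} {d : nat}.
Implicit Types x y : 'rV[R]_d.

Definition dot x y : R := \sum_i x 0 i * y 0 i.

Definition enorm x : R := Num.sqrt (\sum_i x 0 i ^+ 2).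

Definition eucl_dist x y : R := enorm (x - y).

Lemma sqr_sum_ge0 x : 0 <= \sum_i x 0 i ^+ 2.
Proof. by apply: sumr_ge0 => i _; exact: sqr_ge0. Qed.

Lemma enorm_ge0 x : 0 <= enorm x. Proof. exact: sqrtr_ge0. Qed.

Lemma enorm_sqr x : enorm x ^+ 2 = \sum_i x 0 i ^+ 2.
Proof. by rewrite sqr_sqrtr// sqr_sum_ge0. Qed.

Lemma enorm0 : enorm 0 = 0.
Proof. by rewrite /enorm big1 ?sqrtr0// => i _; rewrite mxE expr0n. Qed.

Lemma enormN x : enorm (- x) = enorm x.
Proof. by congr Num.sqrt; apply: eq_bigr => i _; rewrite mxE sqrrN. Qed.

Lemma coord_le_enorm x i : `|x 0 i| <= enorm x.
Proof.
rewrite -ler_sqr ?nnegrE ?enorm_ge0// enorm_sqr real_normK ?num_real//.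
rewrite (bigD1 i)//= lerDl; apply: sumr_ge0 => j _; exact: sqr_ge0.
Qed.

Lemma enorm_eq0 x : enorm x = 0 -> x = 0.
Proof.
move=> x0; apply/rowP => i; rewrite mxE; apply/normr0_eq0/eqP.
by rewrite eq_le normr_ge0 andbT -x0 coord_le_enorm.
Qed.

Lemma dot_le x y : dot x y <= enorm x * enorm y.
Proof.
have [/enorm_eq0 ->|x0] := eqVneq (enorm x) 0.
  by rewrite enorm0 mul0r /dot big1// => i _; rewrite mxE mul0r.
have [/enorm_eq0 ->|y0] := eqVneq (enorm y) 0.
  by rewrite enorm0 mulr0 /dot big1// => i _; rewrite mxE mulr0.
set a := enorm x; set b := enorm y.
have a0 : 0 < a by rewrite lt_def x0 enorm_ge0.
have b0 : 0 < b by rewrite lt_def y0 enorm_ge0.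
have : 0 <= \sum_i (b * x 0 i - a * y 0 i) ^+ 2.
  by apply: sumr_ge0 => i _; exact: sqr_ge0.
have -> : \sum_i (b * x 0 i - a * y 0 i) ^+ 2 =
    b ^+ 2 * (\sum_i x 0 i ^+ 2) + - (2 * a * b) * dot x y
    + a ^+ 2 * (\sum_i y 0 i ^+ 2).
  rewrite !mulr_sumr -!big_split/=.
  by apply: eq_bigr => i _; ring.
rewrite -!enorm_sqr -/a -/b.
move=> h; have ab0 : 0 < a * b by exact: mulr_gt0.
rewrite -(ler_pM2l ab0); nra.
Qed.

Lemma enormD x y : enorm (x + y) <= enorm x + enorm y.
Proof.
rewrite -ler_sqr ?nnegrE ?addr_ge0 ?enorm_ge0// enorm_sqr.
have -> : \sum_i (x + y) 0 i ^+ 2 =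
    \sum_i x 0 i ^+ 2 + 2 * dot x y + \sum_i y 0 i ^+ 2.
  rewrite mulr_sumr -!big_split/=.
  by apply: eq_bigr => i _; rewrite mxE; ring.
rewrite -!enorm_sqr; have := dot_le x y; nra.
Qed.

End euclidean_norm.

(* C^0([0,T], R^d): a path is a continuous function on the whole line frozen
   outside [0, T], i.e. determined by its restriction to [0, T], so that
   Leibniz equality of paths is equality on [0, T]. *)
Section paths.
Context {R : realType}.

Definition clamp (T t : R) : R := Num.max 0 (Num.min t T).

Record cpath (T : R) (d : nat) := CPath {
  cpath_fun :> R -> 'rV[R]_d ;
  cpath_cts : continuous cpath_fun ;
  cpath_frozen : forall t, cpath_fun t = cpath_fun (clamp T t) }.

Lemma cpathP (T : R) d (x y : cpath T d) : x =1 y -> x = y.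
Proof.
case: x y => [x xc xf] [y yc yf] /= /funext xy; subst y.
by rewrite (Prop_irrelevance xc yc) (Prop_irrelevance xf yf).
Qed.

Lemma cst_cpath_frozen (T : R) d (a : 'rV[R]_d) t :
  cst a t = cst a (clamp T t).
Proof. by []. Qed.

Definition cst_cpath (T : R) d (a : 'rV[R]_d) : cpath T d :=
  CPath (@cst_continuous _ _ a) (@cst_cpath_frozen T d a).

HB.instance Definition _ T d := gen_eqMixin (cpath T d).
HB.instance Definition _ T d := gen_choiceMixin (cpath T d).
HB.instance Definition _ T d := isPointed.Build (cpath T d) (cst_cpath T 0).

(* As paths are frozen outside [0, T], this is the supremum over [0, T]. *)
Definition supdist T d (x y : cpath T d) : R :=
  sup (range (fun t => eucl_dist (x t) (y t))).

Lemma supdist_has_sup T d (x y : cpath T d) :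
  has_sup (range (fun t => eucl_dist (x t) (y t))).
Proof.
split; first by exists (eucl_dist (x 0) (y 0)); exists 0.
pose m := Num.max 0 T.
have xB (z : cpath T d) : exists B, forall t, enorm (z t) <= B.
  have /compact_bounded[B [_ /(_ (B + 1))]] :
      compact ((z : R -> 'rV[R]_d) @` `[0, m]).
    apply: continuous_compact; last exact: segment_compact.
    by apply: continuous_subspaceT; exact: cpath_cts.
  rewrite ltrDl ltr01 => /(_ isT) zB.
  exists (Num.sqrt (\sum_(i < d) (B + 1) ^+ 2)) => t.
  rewrite cpath_frozen /enorm; apply: ler_wsqrtr; apply: ler_sum => i _.
  have {}zB : `|z (clamp T t)| <= B + 1.
    apply: zB; exists (clamp T t) => //=; rewrite in_itv/= /clamp /m.
    rewrite !(le_max, ge_max, ge_min, lexx) ?orbT /= andbT -orbA.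
    by case: (leP T 0) => [_|/ltW ->]; rewrite ?orbT.
  rewrite -[X in X <= _]real_normK ?num_real// ler_sqr ?nnegrE//; last first.
    by apply: le_trans zB.
  apply: le_trans zB; rewrite [leRHS]mx_normE -[leLHS]nngE num_le.
  exact: (le_bigmax _ (fun j => `|z (clamp T t) j.1 j.2|%:nng) (0, i)).
have [[A hA] [B hB]] := (xB x, xB y).
exists (A + B) => _ [t _ <-]; rewrite /eucl_dist.
by rewrite (le_trans (enormD _ _))// enormN lerD.
Qed.

Lemma supdist_ub T d (x y : cpath T d) t : eucl_dist (x t) (y t) <= supdist x y.
Proof.
apply: ub_le_sup; last by exists t.
by have [] := supdist_has_sup x y.
Qed.

Lemma supdist_le T d (x y : cpath T d) c :
  (forall t, eucl_dist (x t) (y t) <= c) -> supdist x y <= c.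
Proof.
move=> h; apply: ge_sup; first by have [] := supdist_has_sup x y.
by move=> _ [t _ <-].
Qed.

Lemma supdist_ge0 T d (x y : cpath T d) : 0 <= supdist x y.
Proof. by apply: le_trans (supdist_ub x y 0); exact: enorm_ge0. Qed.

Lemma supdistxx T d (x : cpath T d) : supdist x x = 0.
Proof.
apply/eqP; rewrite eq_le supdist_ge0 andbT; apply: supdist_le => t.
by rewrite /eucl_dist subrr enorm0.
Qed.

Lemma supdist_positivity T d (x y : cpath T d) : supdist x y = 0 -> x = y.
Proof.
move=> xy0; apply: cpathP => t; apply/eqP; rewrite -subr_eq0; apply/eqP.
apply: enorm_eq0; apply/eqP; rewrite eq_le enorm_ge0 andbT -xy0.
exact: supdist_ub.
Qed.

Lemma supdist_sym T d (x y : cpath T d) : supdist x y = supdist y x.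
Proof. by congr sup; apply: eq_imagel => t _; rewrite /eucl_dist -opprB enormN. Qed.

Lemma supdist_triangle T d (y x z : cpath T d) :
  supdist x z <= supdist x y + supdist y z.
Proof.
apply: supdist_le => t.
rewrite (le_trans _ (lerD (supdist_ub _ _ t) (supdist_ub _ _ t)))//.
by rewrite /eucl_dist -(subrKA (y t)) enormD.
Qed.

HB.instance Definition _ T d := @isMetric.Build R (cpath T d)
  (@supdist T d) (@supdistxx T d) (@supdist_positivity T d)
  (@supdist_sym T d) (@supdist_triangle T d).

End paths.
Arguments cpath {R} T d.

Notation borel X := (g_sigma_algebraType (open : set (set X))).

Section kantorovich.
Context {R : realType} {X : ptopologicalType}.

(* [Prob dist] is P(X); [dist] only serves to select the Monge-Kantorovich
   distance, hence the topology, carried by P(X). *)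
Definition Prob (dist : X -> X -> R) : Type := probability (borel X) R.

Definition lipschitz1 (dist : X -> X -> R) : set (X -> R) :=
  [set h | forall x y, `|h x - h y| <= dist x y].

(* Extended-valued, as no first moment is assumed; an undefined difference
   takes the value +oo - +oo = -oo, which does not affect the supremum. *)
Definition d1 (dist : X -> X -> R) (mu nu : Prob dist) : \bar R :=
  ereal_sup [set (\int[mu]_x (h x)%:E - \int[nu]_x (h x)%:E)%E
            | h in lipschitz1 dist].

Section theory.
Variable dist : X -> X -> R.
Implicit Types (mu nu xi : Prob dist) (h : X -> R).
Local Open Scope ereal_scope.

Lemma d1_ub mu nu h : lipschitz1 dist h ->
  \int[mu]_x (h x)%:E - \int[nu]_x (h x)%:E <= d1 mu nu.
Proof. by move=> lh; apply: ereal_sup_ubound; exists h. Qed.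

Lemma d1xx_le0 mu : d1 mu mu <= 0.
Proof.
apply: ge_ereal_sup => _ [h _ <-].
by case: (\int[mu]_x (h x)%:E) => [r| |]//=; rewrite ?leNye// lee_fin subrr.
Qed.

Lemma lipschitz1N h : lipschitz1 dist h -> lipschitz1 dist (fun x => (- h x)%R).
Proof. by move=> lh x y; rewrite -opprD normrN; exact: lh. Qed.

Lemma lipschitz10 h : lipschitz1 dist h -> lipschitz1 dist (fun=> 0%R).
Proof. by move=> lh x y; rewrite subrr normr0 (le_trans _ (lh x y)). Qed.

Lemma lipschitz1_neg h : lipschitz1 dist h ->
  lipschitz1 dist (fun x => Num.max (- h x) 0)%R.
Proof.
move=> lh x y; apply: le_trans (lh x y).
case: (leP (- h x) 0)%R => hx; case: (leP (- h y) 0)%R => hy.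
- by rewrite subrr normr0.
- rewrite sub0r opprK ltr0_norm; last lra.
  by apply: le_trans (ler_norm _); lra.
- by rewrite subr0 gtr0_norm// distrC; apply: le_trans (ler_norm _); lra.
- by rewrite -opprD normrN.
Qed.

Lemma d1_ge0 mu nu h : lipschitz1 dist h -> 0 <= d1 mu nu.
Proof.
move=> /lipschitz10 /(@d1_ub mu nu); apply: le_trans.
by rewrite !integral0 sube0.
Qed.

Lemma d1_sym_le mu nu : d1 mu nu <= d1 nu mu.
Proof.
apply: ge_ereal_sup => _ [h lh <-].
have := d1_ub nu mu (lipschitz1N lh).
have := d1_ub nu mu (lipschitz1_neg lh).
have d0 := d1_ge0 nu mu lh.
have intN (m : Prob dist) : \int[m]_x (- h x)%:E =
    \int[m]_x ((EFin \o h)^\- x) - \int[m]_x ((EFin \o h)^\+ x).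
  rewrite integralE; congr (_ - _); apply: eq_integral => x _ /=.
    by rewrite funeposE funenegE.
  by rewrite funeposE funenegE /= opprK.
have intneg (m : Prob dist) : \int[m]_x (Num.max (- h x) 0)%:E =
    \int[m]_x ((EFin \o h)^\- x).
  by apply: eq_integral => x _; rewrite funenegE /= EFin_max.
have int (m : Prob dist) : \int[m]_x (h x)%:E =
    \int[m]_x ((EFin \o h)^\+ x) - \int[m]_x ((EFin \o h)^\- x).
  by rewrite integralE.
rewrite !intN !intneg !int.
have pos (m : Prob dist) : 0 <= \int[m]_x ((EFin \o h)^\+ x).
  by apply: integral_ge0 => x _; exact: funepos_ge0.
have neg (m : Prob dist) : 0 <= \int[m]_x ((EFin \o h)^\- x).
  by apply: integral_ge0 => x _; exact: funeneg_ge0.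
move: (pos mu) (pos nu) (neg mu) (neg nu).
move: (\int[mu]_x _) (\int[nu]_x _) (\int[mu]_x _) (\int[nu]_x _) d0.
move: (d1 nu mu) => D.
case: D => [D| |] [a| |] [b| |] [c| |] [e| |] //=;
  rewrite ?lee_fin ?leey ?leNye //; lra.
Qed.

Lemma d1_sym mu nu : d1 mu nu = d1 nu mu.
Proof. by apply/eqP; rewrite eq_le !d1_sym_le. Qed.

Lemma d1_triangle nu mu xi : d1 mu xi <= d1 mu nu + d1 nu xi.
Proof.
apply: ge_ereal_sup => _ [h lh <-].
have := d1_ub mu nu lh; have := d1_ub nu xi lh.
move: (d1_ge0 mu nu lh) (d1_ge0 nu xi lh).
move: (d1 mu nu) (d1 nu xi) => [D| |] [D'| |] //;
  move: (\int[mu]_x _) (\int[nu]_x _) (\int[xi]_x _) => [a| |] [b| |] [c| |] //=;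
  rewrite ?lee_fin ?leey ?leNye //; lra.
Qed.

HB.instance Definition _ := gen_eqMixin (Prob dist).
HB.instance Definition _ := gen_choiceMixin (Prob dist).

Definition d1_ball mu (e : R) : set (Prob dist) := [set nu | d1 mu nu < e%:E].

Let ent : set_system (Prob dist * Prob dist) := entourage_ d1_ball.
Let nbhs_d1 mu : set_system (Prob dist) := nbhs_ ent mu.
Let nbhs_d1E : nbhs_d1 = nbhs_ ent. Proof. by []. Qed.

HB.instance Definition _ := hasNbhs.Build (Prob dist) nbhs_d1.

Lemma d1_ball_center mu (e : R) : (0 < e)%R -> d1_ball mu e mu.
Proof. by move=> e0; rewrite /d1_ball/= (le_lt_trans (d1xx_le0 _)). Qed.

Lemma d1_ball_sym mu nu (e : R) : d1_ball mu e nu -> d1_ball nu e mu.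
Proof. by rewrite /d1_ball/= d1_sym. Qed.

Lemma d1_ball_triangle mu nu xi (e1 e2 : R) :
  d1_ball mu e1 nu -> d1_ball nu e2 xi -> d1_ball mu (e1 + e2) xi.
Proof.
rewrite /d1_ball/= => h1 h2; apply: le_lt_trans (d1_triangle nu _ _) _.
by rewrite EFinD lteD.
Qed.

Let entE : ent = entourage_ d1_ball. Proof. by []. Qed.

HB.instance Definition _ := @Nbhs_isPseudoMetric.Build R (Prob dist)
  ent nbhs_d1E d1_ball d1_ball_center d1_ball_sym d1_ball_triangle entE.

End theory.
End kantorovich.

Section game.
Context {R : realType} {d : nat} {T : R}.

Local Notation mu := (@lebesgue_measure R).
Local Notation E := 'rV[R]_d.
Local Notation V := (@cpath R T d).
Local Notation PE := (Prob (@eucl_dist R d)).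
Local Notation PV := (Prob (@supdist R T d)).

Definition support (m : PE) : set E :=
  [set x | forall U, open U -> U x -> (0 < m U)%E].

Definition non_atomic (m : PE) : Prop :=
  forall A : set (borel E), measurable A -> (0 < m A)%E ->
  exists B : set (borel E), [/\ measurable B, B `<=` A & (0 < m B < m A)%E].

Definition eval_at (t : R) (x : borel V) : borel E := (x : V) t.

Lemma continuous_eval_at t : continuous (eval_at t : V -> E).
Proof.
move=> x; apply/(@cvgrPdist_lt _ _ _ (nbhs (x : V)) (nbhs_filter _)) => e e0.
apply: (@filterS _ (nbhs (x : V)) (nbhs_filter _) _ _ _
  (nbhsx_ballx (x : V) _ e0)) => y.
rewrite ballEmdist/= => xy.
apply: le_lt_trans xy; apply: le_trans (supdist_ub x y t).
rewrite /Num.norm/= mx_normE -[leRHS](ger0_norm (enorm_ge0 _)) -[leRHS]nngE num_le.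
apply/bigmax_leP; split => [|[i j] _]; first by rewrite -num_le/=.
rewrite -num_le/= (ger0_norm (enorm_ge0 _)) (ord1 i); exact: coord_le_enorm.
Qed.

Lemma measurable_eval_at t : measurable_fun setT (eval_at t).
Proof.
refine (@measurability _ _ (borel V) (borel E) setT (eval_at t) open _ _) => //.
move=> _ [U oU <-]; rewrite setTI; apply: sub_sigma_algebra.
by apply: open_comp => // x _; exact: continuous_eval_at.
Qed.

HB.instance Definition _ t := isMeasurableFun.Build _ _ _ _ (eval_at t)
  (measurable_eval_at t).

(* e_t # eta *)
Definition law_at (t : R) (eta : PV) : PE := distribution eta (eval_at t).

Definition grad (phi : E -> R) (x : E) : E :=
  \row_i 'D_(delta_mx 0 i) phi x.

Definition C1 (phi : E -> R) : Prop :=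
  (forall x, differentiable phi x) /\ continuous (grad phi).

Definition C2 (phi : E -> R) : Prop :=
  C1 phi /\ forall i, C1 (fun x => grad phi x 0 i).

Definition strongly_convex (phi : E -> R) : Prop :=
  exists2 a : R, 0 < a & forall (v w : E) (s : R), 0 <= s <= 1 ->
    phi (s *: v + (1 - s) *: w) <=
    s * phi v + (1 - s) * phi w - a / 2 * s * (1 - s) * enorm (v - w) ^+ 2.

Definition C1norm (phi : E -> R) : \bar R :=
  (ereal_sup (range (fun x => `|phi x|%:E)) +
   ereal_sup (range (fun x => (enorm (grad phi x))%:E)))%E.

(* "m |-> f(., m) is Lipschitz from (P(R^d), d_1) to C^1(R^d)" *)
Definition lipschitz_C1 (f : E -> PE -> R) : Prop :=
  exists2 C : R, 0 < C & forall m m' : PE,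
    (C1norm (fun x => f x m - f x m')%R <= C%:E * d1 m m')%E.

(* p is absolutely continuous on [0, T] with derivative q a.e. *)
Definition ac_derivative (p q : R -> E) : Prop := forall i,
  mu.-integrable `[0, T] (fun s => (q s 0 i)%:E) /\
  (forall t, 0 <= t <= T -> p t 0 i = p 0 0 i + \int[mu]_(s in `[0, t]) q s 0 i).

Definition L2norm (q : R -> E) : \bar R :=
  ((\int[mu]_(t in `[0%R, T]) (enorm (q t) ^+ 2)%:E) `^ 2^-1)%E.

(* H^1([0,T], R^d), as absolutely continuous paths with derivative in L^2. *)
Definition sobolev : set V :=
  [set x | exists2 q, ac_derivative x q & (L2norm q < +oo)%E].

(* Some representative of the a.e. class of the derivative of x. *)
Definition velocity (x : V) : R -> E := xget (fun=> 0) (ac_derivative x).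

Definition actions (M : R) (i : E) : set V :=
  [set x | [/\ sobolev x, x 0 = i & (L2norm (velocity x) <= (Num.sqrt T * M)%:E)%E]].

Definition argmin (A : set V) (F : V -> \bar R) : set V :=
  [set x | A x /\ forall y, A y -> (F x <= F y)%E].

Section data.
Variables (L : E -> E -> R) (f g : E -> PE -> R) (m0 : PE) (M : R).
Implicit Types eta : PV.

Definition J (x : V) eta : \bar R :=
  if `[< sobolev x >] then
    (\int[mu]_(t in `[0%R, T])
       (L (x t) (velocity x t) + f (x t) (law_at t eta))%:E
     + (g (x T) (law_at T eta))%:E)%E
  else +oo%E.

Local Notation profile := {mfun borel E >-> borel V}.

Definition law (Psi : profile) : PV := distribution m0 Psi.

Definition admissible (Psi : profile) : Prop :=
  {ae m0, forall i, actions M i (Psi i)}.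

(* [measure] values on non-measurable sets are junk, so that measures are
   compared with [measure_eq]. *)
Definition PG : set PV :=
  [set eta | exists2 Psi, admissible Psi & measure_eq eta (law Psi)].

Definition convex_hull (K : set PV) : set PV :=
  [set eta | exists (n : nat) (w : 'I_n -> R) (nu : 'I_n -> PV),
    [/\ forall k, 0 <= w k, \sum_k w k = 1, forall k, K (nu k) &
        forall A : set (borel V), measurable A ->
          eta A = (\sum_k (w k)%:E * nu k A)%E]].

Definition covPG : set PV := closure (convex_hull PG).

Definition nash (Psi : profile) : Prop :=
  admissible Psi /\
  {ae m0, forall i, argmin (actions M i) (J^~ (law Psi)) (Psi i)}.

Definition nash_distribution eta : Prop :=
  exists2 Psi, nash Psi & measure_eq eta (law Psi).

Definition monotone_cost : Prop := forall eta eta', covPG eta -> covPG eta' ->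
  (\int[eta']_x `|J x eta| < +oo)%E /\
  (0 <= \int[eta]_x (J x eta - J x eta') - \int[eta']_x (J x eta - J x eta'))%E.

Definition star_i : Prop := compact (support m0).

(* Differentiability in x is implicit in the growth condition on L_x;
   coercive means that theta tends to +oo. *)
Definition star_ii : Prop :=
  [/\ forall x : E, strongly_convex (L x) /\ C2 (L x),
      forall x v : E, differentiable (L^~ v) x &
      exists theta : R -> R,
        [/\ forall q, 0 <= q -> 0 <= theta q,
            forall q q', 0 <= q -> q <= q' -> theta q <= theta q',
            theta q @[q --> +oo%R] --> +oo%R &
        [/\ exists c0 C : R, [/\ 0 < c0, 0 < C & forall x v : E,
              theta (enorm v) - c0 <= L x v <= C * (1 + enorm v ^+ 2)],
            forall r : R, 0 < r -> exists C : R, forall x v : E, enorm x <= r ->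
              Num.max (enorm (grad (L^~ v) x)) (enorm (grad (L x) v))
                <= C * theta (enorm v) &
            forall D : R, 0 < D -> exists2 K : R, 0 < K &
              forall q m : R, 0 <= q -> 0 <= m <= D ->
                theta (q + m) <= K * (1 + theta q)]]].

Definition star_iii : Prop :=
  [/\ continuous (fun p : E * PE => f p.1 p.2),
      continuous (fun p : E * PE => g p.1 p.2),
      forall m : PE, C1 (f^~ m) /\ C1 (g^~ m) &
      exists C b : R, [/\ 0 < C, 0 < b & forall x m,
        Num.max (enorm (grad (f^~ m) x)) (enorm (grad (g^~ m) x))
          <= C * (enorm x `^ b + 1)]].

(* v is the representative of the derivative of x for which t |-> L_v(x_t, v_t)
   is absolutely continuous on the whole of [0, T], so that the terminal
   condition makes sense. *)
Definition euler_lagrange eta (x : V) (v : R -> E) : Prop :=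
  [/\ ac_derivative x v,
      ac_derivative (fun t => grad (L (x t)) (v t))
        (fun t => grad (L^~ (v t)) (x t) + grad (f^~ (law_at t eta)) (x t)) &
      grad (L (x T)) (v T) = - grad (g^~ (law_at T eta)) (x T)].

(* M is an a priori bound, for all eta, on the solutions of the Euler-Lagrange
   system issued from the ball of radius sup { |x| : x in supp m_0 }. *)
Definition a_priori_bound : Prop :=
  0 < M /\
  forall eta (x : V) (v : R -> E), enorm (x 0) <= sup [set enorm i | i in support m0] ->
    euler_lagrange eta x v ->
    (forall t, 0 <= t <= T -> enorm (x t) <= M) /\
    {ae mu, forall t, 0 <= t <= T -> enorm (v t) <= M}.

Definition cond_i : Prop :=
  [/\ forall i, compact (actions M i),
      closed [set p : E * V | actions M p.1 p.2] &
      forall U : set V, open U -> open [set i | actions M i `&` U !=set0]].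

Definition cond_ii : Prop :=
  lower_semicontinuous
    (fun p : subspace [set p : V * PV | covPG p.2] => J p.1 p.2).

(* The infimum is a minimum by cond_i and cond_ii. *)
Definition cond_iii : Prop :=
  {within [set p : E * PV | PG p.2],
    continuous (fun p => ereal_inf [set J x p.2 | x in actions M p.1])}.

Definition cond_iv : Prop := compact covPG.

Definition cond_v : Prop := forall eta, covPG eta ->
  {ae m0, forall i, exists! x, argmin (actions M i) (J^~ eta) x}.

(* Psi, etabar are indexed from 1; their values at 0 play no role. *)
Definition fictitious_play (Psi : nat -> profile) (etabar : nat -> PV) : Prop :=
  [/\ admissible (Psi 1%N),
      forall n, (0 < n)%N -> {ae m0, forall i,
        argmin [set x | sobolev x /\ x 0 = i] (J^~ (etabar n)) (Psi n.+1 i)} &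
      forall n, (0 < n)%N -> forall A : set (borel V), measurable A ->
        etabar n A = ((n%:R^-1)%:E * \sum_(1 <= j < n.+1) law (Psi j) A)%E].

End data.
End game.

Arguments monotone_cost {R d} T L f g m0 M.
Arguments a_priori_bound {R d} T L f g m0 M.
Arguments cond_i {R} d T M.
Arguments cond_ii {R d} T L f g m0 M.
Arguments cond_iii {R d} T L f g m0 M.
Arguments cond_iv {R d} T m0 M.
Arguments cond_v {R d} T L f g m0 M.

(* Main.v *)
Require Import Defs.
From HB Require Import structures.
From mathcomp Require Import all_boot all_order all_algebra.
From mathcomp Require Import all_classical all_reals all_analysis.
From mathcomp Require Import measurable_realfun giry.
From mathcomp Require Import ring lra.

Set Implicit Arguments.
Unset Strict Implicit.
Unset Printing Implicit Defensive.

Import Order.TTheory GRing.Theory Num.Theory.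
Import numFieldNormedType.Exports.

Local Open Scope classical_set_scope.
Local Open Scope ring_scope.

(** The play converges because the regret of the average player vanishes.

    A player who minimizes the cost against etabar n among all H^1 paths solves the
    Euler-Lagrange system, so that the a priori bound puts the minimizer in the action set
    ([minimizer_in_actions]). Hence all profiles of the play are admissible, and all means
    etabar n lie in the compact closed convex hull of the admissible distributions. Every
    measure in this hull is carried by paths that are admissible choices for their starting
    points, and its initial marginal is m_0 ([covPG_feasible], [covPG_initial_law]).

    Let phi_n be the mean over j <= n of the total cost of Psi_j against etabar n, minus the
    total cost of the best reply Psi_(n+1); it is nonnegative. Passing to etabar (n+1) adds to
    the cost the function D = J(., etabar (n+1)) - J(., etabar n). Monotonicity of J says that D
    costs the added profile Psi_(n+1) at least as much as the mean of the former ones. Therefore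
    the increment of n phi_n is at most n + 1 times the difference of the integrals of D along
    Psi_(n+1) and Psi_(n+2) ([gap_step]). Since f and g are Lipschitz with values in C^1, D is a
    Lipschitz function of the path, with a constant O(1/n) because d_1(etabar (n+1), etabar n) =
    O(1/n) ([J_lip_path], [etabar_step]). So the increment is at most a constant times the mean
    distance of two successive best replies. This distance tends to 0: by compactness one may
    let etabar n converge, then etabar (n+1) has the same limit, and best replies depend
    continuously on the population ([argmin_stability], [successive_cvg0]). By Cesaro's theorem
    phi_n tends to 0 ([gap_cvg0]).

    Let eta be a cluster point of the means and B the best reply to it. As J is lower
    semicontinuous, the vanishing of phi_n gives that the integral of J(., eta) against eta is
    at most the total cost of B ([cluster_cost_le]). But eta-almost every path costs at least as
    much as the best reply from its starting point. So eta-almost every path is that best reply,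
    eta is the law of B, and B is an equilibrium ([cluster_law], [cluster_nash]). Monotonicity
    allows only one equilibrium ([nash_unique]), so compactness makes the whole sequence of
    means converge to it, and the best replies follow by stability. *)

Local Notation aeS mu := (@filterS _ _ (ae_filter_ringOfSetsType mu)).
Local Notation aeS2 mu := (@filterS2 _ _ (ae_filter_ringOfSetsType mu)).
Local Notation aeI mu := (@filterI _ _ (ae_filter_ringOfSetsType mu) _ _).

(** * Euclidean calculus on R^d *)

Section euclidean.
Context {R : realType} {d : nat}.
Local Notation E := 'rV[R]_d.
Implicit Types x y h : E.

Lemma coord_le_norm x i : `|x 0 i| <= `|x|.
Proof.
rewrite [leRHS]mx_normE -[leLHS]nngE num_le.
exact: (le_bigmax _ (fun j => `|x j.1 j.2|%:nng) (0, i)).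
Qed.

Lemma enorm_le_sum x : enorm x <= \sum_i `|x 0 i|.
Proof.
have s0 : 0 <= \sum_i `|x 0 i| by apply: sumr_ge0.
rewrite -ler_sqr ?nnegrE ?enorm_ge0// enorm_sqr expr2 mulr_suml.
apply: ler_sum => i _; rewrite -real_normK ?num_real// expr2 ler_wpM2l//.
by rewrite (bigD1 i)//= lerDl; apply: sumr_ge0.
Qed.

Lemma enorm_le_norm x : enorm x <= d%:R * `|x|.
Proof.
apply: le_trans (enorm_le_sum x) _.
apply: le_trans (ler_sum _ (fun i _ => coord_le_norm x i)) _.
by rewrite sumr_const card_ord -[leLHS]mulr_natl.
Qed.

Lemma norm_le_enorm x : `|x| <= enorm x.
Proof.
rewrite /Num.norm/= mx_normE -[leRHS](ger0_norm (enorm_ge0 _)) -[leRHS]nngE num_le.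
apply/bigmax_leP; split => [|[i j] _]; first by rewrite -num_le/=.
by rewrite -num_le/= (ger0_norm (enorm_ge0 _)) (ord1 i); exact: coord_le_enorm.
Qed.

Lemma enormB x y : enorm (x - y) = enorm (y - x).
Proof. by rewrite -opprB enormN. Qed.

Lemma enormZ (a : R) x : enorm (a *: x) = `|a| * enorm x.
Proof.
rewrite /enorm -sqrtr_sqr -sqrtrM ?sqr_ge0// mulr_sumr; congr Num.sqrt.
by apply: eq_bigr => i _; rewrite mxE exprMn.
Qed.

Lemma ler_dist_enorm x y : `|enorm x - enorm y| <= enorm (x - y).
Proof.
have := enormD (x - y) y; have := enormD (y - x) x.
rewrite !subrK (enormB y x) ler_norml => h1 h2; apply/andP; split; lra.
Qed.

Lemma enorm_continuous : continuous (@enorm R d).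
Proof.
move=> x; apply/(@cvgrPdist_lt _ _ _ (nbhs x) (nbhs_filter _)) => e e0.
have D0 : 0 < d.+1%:R :> R by rewrite ltr0n.
apply: (@filterS _ (nbhs x) (nbhs_filter _) _ _ _
  (nbhsx_ballx x _ (divr_gt0 e0 D0))) => y.
rewrite -ball_normE/= ltr_pdivlMr// mulrC => xy.
apply: le_lt_trans (ler_dist_enorm _ _) _.
apply: le_lt_trans (enorm_le_norm _) _.
by apply: le_lt_trans xy; rewrite ler_wpM2r// ler_nat.
Qed.

Lemma dotC x y : dot x y = dot y x.
Proof. by apply: eq_bigr => i _; rewrite mulrC. Qed.

Lemma dotDr x y z : dot x (y + z) = dot x y + dot x z.
Proof. by rewrite /dot -big_split; apply: eq_bigr => i _; rewrite mxE mulrDr. Qed.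

Lemma dotZr a x y : dot x (a *: y) = a * dot x y.
Proof. by rewrite /dot mulr_sumr; apply: eq_bigr => i _; rewrite mxE mulrCA. Qed.

Lemma dotNr x y : dot x (- y) = - dot x y.
Proof. by rewrite -scaleN1r dotZr mulN1r. Qed.

Lemma dotBr x y z : dot x (y - z) = dot x y - dot x z.
Proof. by rewrite dotDr dotNr. Qed.

Lemma dotBl x y z : dot (x - y) z = dot x z - dot y z.
Proof. by rewrite !(dotC _ z) dotBr. Qed.

Lemma dot_delta x i : dot x (delta_mx 0 i) = x 0 i.
Proof.
rewrite /dot (bigD1 i)//= mxE !eqxx mulr1 big1 ?addr0// => j ji.
by rewrite mxE eqxx (negbTE ji) mulr0.
Qed.

Lemma dot_eq0P x y : (forall h, dot x h = dot y h) -> x = y.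
Proof. by move=> xy; apply/rowP => i; rewrite -!dot_delta xy. Qed.

Lemma abs_dot_le x y : `|dot x y| <= enorm x * enorm y.
Proof.
rewrite ler_norml dot_le andbT lerNl -dotNr.
by apply: le_trans (dot_le _ _) _; rewrite enormN.
Qed.

Lemma enorm_delta (i : 'I_d) : enorm (delta_mx 0 i : E) = 1.
Proof.
rewrite /enorm (bigD1 i)//= mxE !eqxx expr1n big1 ?addr0 ?sqrtr1// => j ji.
by rewrite mxE eqxx (negbTE ji) expr0n.
Qed.

Lemma diff_grad (phi : E -> R) x h : differentiable phi x ->
  'd phi x h = dot (grad phi x) h.
Proof.
move=> dphi; rewrite [in LHS](row_sum_delta h) linear_sum/= /dot.
apply: eq_bigr => i _; rewrite linearZ/= mxE deriveE// mulrC.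
by congr (_ * _).
Qed.

Lemma derive_grad (phi : E -> R) x h : differentiable phi x ->
  'D_h phi x = dot (grad phi x) h.
Proof. by move=> dphi; rewrite deriveE// diff_grad. Qed.

(** The step 1/(k+1) is the one used in all difference quotients below: sequences, unlike
    general filters, are what dominated convergence accepts. *)
Lemma inv_natS_dnbhs0 : (k.+1%:R^-1 : R) @[k --> \oo] --> (0 : R)^'.
Proof.
move=> A /= [e e0 eA]; 
change (\forall k \near \oo, A (k.+1%:R^-1)).
near=> k; apply: eA => /=; last first.
  by apply: lt0r_neq0; rewrite invr_gt0 ltr0n.
by near: k; have /cvgrPdist_lt/(_ _ e0) := @cvg_harmonic R.
Unshelve. all: by end_near. Qed.

Lemma cvg_diff_quot (phi : E -> R) x h : differentiable phi x ->
  k.+1%:R * (phi (x + k.+1%:R^-1 *: h) - phi x) @[k --> \oo] -->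
  dot (grad phi x) h.
Proof.
move=> dphi; rewrite -derive_grad//.
have dd := @diff_derivable _ _ _ _ _ h dphi.
have := cvg_comp _ _ inv_natS_dnbhs0 dd; rewrite -/(derive phi x h).
apply: cvg_trans; apply: near_eq_cvg; near=> k.
by rewrite /= invrK [_ *: h + x]addrC.
Unshelve. all: by end_near.
Qed.

Lemma is_derive_line (phi : E -> R) x h (s : R) :
  differentiable phi (x + s *: h) ->
  is_derive s 1 (fun r : R => phi (x + r *: h)) (dot (grad phi (x + s *: h)) h).
Proof.
move=> dphi.
have E0 : (fun r : R => r^-1 *: (phi (x + (r *: 1 + s) *: h) - phi (x + s *: h))) =
    (fun r : R => r^-1 *: (phi (r *: h + (x + s *: h)) - phi (x + s *: h))).
  apply/funext => r; congr (_ *: (phi _ - _)).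
  by rewrite scalerDl [_ *: 1]mulr1 addrCA.
have dd := @diff_derivable _ _ _ _ _ h dphi.
apply: DeriveDef.
  by move: dd; rewrite /derivable/= E0.
by rewrite -derive_grad// /derive/= E0.
Qed.

(** The mean value theorem along the segment from x to y. *)
Lemma grad_lipschitz (phi : E -> R) x y (C : R) :
  (forall s, 0 <= s <= 1 -> differentiable phi (x + s *: (y - x)) /\
     enorm (grad phi (x + s *: (y - x))) <= C) ->
  `|phi y - phi x| <= C * enorm (y - x).
Proof.
move=> hphi.
have d01 (s : R) : s \in `]0, 1[%R ->
    is_derive s 1 (fun r : R => phi (x + r *: (y - x))) (dot (grad phi (x + s *: (y - x))) (y - x)).
  rewrite in_itv/= => /andP[s0 s1]; apply: is_derive_line.
  by apply: (hphi s _).1; rewrite !ltW.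
have [] := @MVT_segment R (fun r : R => phi (x + r *: (y - x))) _ 0 1 ler01 d01.
  apply: (@derivable_within_continuous _ _ _ `[0, 1]) => s; rewrite in_itv/= => s01.
  by have /is_derive_line/(@ex_derive _ _ _ _ _ _ _) := (hphi s s01).1.
move=> s; rewrite in_itv/= => s01; rewrite scale1r scale0r addr0 subrKC subr0 mulr1 => ->.
apply: le_trans (abs_dot_le _ _) _; rewrite ler_wpM2r ?enorm_ge0//.
by have [] := hphi s s01.
Qed.
End euclidean.

(** * Borel measurability *)

Section measurability.
Context {R : realType} {d : nat}.
Local Notation E := 'rV[R]_d.

Lemma lsc_borel_measurable (X : ptopologicalType) (F : X -> \bar R) :
  lower_semicontinuous F -> measurable_fun setT (F : borel X -> _).
Proof.
move=> scif; apply: (measurability _ (ErealGenOInfty.measurableE R)).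
move=> /= _ [_ [a ->]] <-; rewrite setTI; apply: sub_sigma_algebra.
by rewrite preimage_itvoy; move/lower_semicontinuousP : scif; exact.
Qed.

Lemma continuous_borel_measurable (X : ptopologicalType) (F : X -> R) :
  continuous F -> measurable_fun setT (F : borel X -> _).
Proof.
move=> cF; apply: (measurability _ (RGenOpens.measurableE R)).
move=> _ [_ [a [b ->]] <-]; rewrite setTI; apply: sub_sigma_algebra.
by apply: open_comp; [move=> x _; exact: cF|exact: interval_open].
Qed.

(** A countable base of R^d. It serves to decompose the open sets of the product R^d x R^d, and to
    cover the complement of a support. *)
Definition rat_ball (j : nat * 'rV[int]_d) : set E :=
  ball ((\row_i ((j.2 0 i)%:~R / j.1.+1%:R)) : E) (j.1.+1%:R^-1 : R).

Lemma rat_ball_base (x : E) (W : set E) : nbhs x W ->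
  exists j, rat_ball j x /\ rat_ball j `<=` W.
Proof.
move=> /nbhs_ballP[e /= e0 eW].
have [n ne] : exists n, n.+1%:R^-1 < e / 2 :> R.
  have e2 : 0 < e / 2 by rewrite divr_gt0.
  have /cvgrPdist_lt/(_ _ e2)[n _ /(_ n (leqnn n))] := @cvg_harmonic R.
  by rewrite sub0r normrN gtr0_norm ?invr_gt0// => ne; exists n.
pose fl (w : E) : 'rV[int]_d := \row_i Num.floor (n.+1%:R * w 0 i).
have xB : rat_ball (n, fl x) x.
  split => [|i j]; rewrite ?invr_gt0// (ord1 i).
  have n0 : 0 < n.+1%:R :> R by rewrite ltr0n.
  rewrite -ball_normE/= !mxE distrC ger0_norm; last first.
    by rewrite subr_ge0 ler_pdivrMr// mulrC floor_le.
  have h := floorD1_gt (n.+1%:R * x 0 j); rewrite intrD1 in h.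
  by rewrite ltrBlDr -[X in X + _]mul1r -mulrDl ltr_pdivlMr// mulrC addrC.
exists (n, fl x); split => // y By; apply: eW.
apply: (@le_ball _ _ _ (n.+1%:R^-1 + n.+1%:R^-1)).
  by rewrite [leRHS]splitr lerD// ltW.
by apply: ball_triangle By; exact: ball_sym.
Qed.

Lemma measurable_preimage_rat_ball dT (S : measurableType dT) (D : set S) (u : S -> E) j :
  measurable D -> (forall i, measurable_fun D (fun s => u s 0 i)) ->
  measurable (D `&` u @^-1` rat_ball j).
Proof.
move=> mD mu; pose c : E := \row_i ((j.2 0 i)%:~R / j.1.+1%:R).
rewrite (_ : _ `&` _ = D `&` \bigcap_(i in [set: 'I_d])
    (D `&` (fun s => u s 0 i) @^-1` ball (c 0 i) (j.1.+1%:R^-1 : R))).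
  apply: measurableI => //; apply: fin_bigcap_measurable => // i _.
  by apply: mu => //; exact: measurable_ball.
apply/seteqP; split => s [Ds h]; split => //.
  by move=> i _; split => //; have [_ hs] := h; exact: hs.
by split => [|k i]; rewrite ?invr_gt0// (ord1 k); have [] := h i I.
Qed.

(** An open set of R^d x R^d is a countable union of products of rational balls. *)
Lemma measurable_preimage_pair dT (S : measurableType dT) (D : set S) (u v : S -> E) :
  measurable D ->
  (forall i, measurable_fun D (fun s => u s 0 i)) ->
  (forall i, measurable_fun D (fun s => v s 0 i)) ->
  forall W : set (E * E), open W -> measurable (D `&` [set s | W (u s, v s)]).
Proof.
move=> mD mu mv W oW.
pose idx := (nat * 'rV[int]_d)%type.
pose A (j : idx * idx) :=
  if `[< forall x y, rat_ball j.1 x -> rat_ball j.2 y -> W (x, y) >] then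
    (D `&` u @^-1` rat_ball j.1) `&` (D `&` v @^-1` rat_ball j.2) else set0.
rewrite (_ : _ `&` _ = \bigcup_j A j).
  apply: countable_bigcupT_measurable => [|j]; first exact: countableP.
  rewrite /A; case: asboolP => // _.
  by apply: measurableI; exact: measurable_preimage_rat_ball.
apply/seteqP; split => [s [Ds Ws]|s [j _]]; last first.
  by rewrite /A; case: asboolP => //= jW [[Ds us] [_ vs]]; split => //; exact: jW.
have [[P Q] /= [nP nQ] PQ] : nbhs (u s, v s) W by exact: open_nbhs_nbhs.
have [j [ju jP]] := rat_ball_base nP; have [k [kv kQ]] := rat_ball_base nQ.
exists (j, k) => //; rewrite /A; case: asboolP => //= h; exfalso; apply: h => x y /jP Px /kQ Qy.
exact: (PQ (x, y)).
Qed.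

Lemma measurable_comp_pair dT (S : measurableType dT) (D : set S)
    (F : E * E -> R) (u v : S -> E) : measurable D -> continuous F ->
  (forall i, measurable_fun D (fun s => u s 0 i)) ->
  (forall i, measurable_fun D (fun s => v s 0 i)) ->
  measurable_fun D (fun s => F (u s, v s)).
Proof.
move=> mD cF mu mv; apply: (measurability _ (RGenOpens.measurableE R)).
move=> _ [_ [a [b ->]] <-].
apply: (measurable_preimage_pair mD mu mv (W := F @^-1` `]a, b[%classic)).
by apply: open_comp; [move=> x _; exact: cF|exact: interval_open].
Qed.

End measurability.

(** * Integrals on [0, T] and H^1 paths *)

Lemma integrable_cst_itv (R : realType) (a b c : R) :
  (@lebesgue_measure R).-integrable `[a, b] (EFin \o (fun=> c)).
Proof.
apply: continuous_compact_integrable; first exact: segment_compact.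
by apply: continuous_subspaceT => ?; exact: cvg_cst.
Qed.

Section integrals.
Context {R : realType} (T : R) (hT : 0 < T).
Local Notation mu := (@lebesgue_measure R).
Local Notation I := (`[0, T]%classic : set R).

Lemma integrable_sub_itv (a : R -> R) (s t : R) : 0 <= s -> t <= T ->
  mu.-integrable I (EFin \o a) -> mu.-integrable `[s, t] (EFin \o a).
Proof.
move=> s0 tT; apply: integrableS => //; apply: subset_itv; rewrite bnd_simp//.
Qed.

Lemma Rintegral_itv_add (a : R -> R) (s t : R) : 0 <= s -> s <= t -> t <= T ->
  mu.-integrable I (EFin \o a) ->
  \int[mu]_(r in `[0, t]) a r - \int[mu]_(r in `[0, s]) a r =
  \int[mu]_(r in `[s, t]) a r.
Proof.
move=> s0 st tT ia.
rewrite Rintegral_itvB ?bnd_simp//; last exact: integrable_sub_itv.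
rewrite Rintegral_itv_obnd_cbnd//.
apply: (@integrableS _ _ _ mu I) => //.
by apply: subset_itv; rewrite bnd_simp.
Qed.

(** Lebesgue differentiation along the steps 1/(k+1). The minimum with T keeps the interval inside
    [0, T], where [a] is known; it is eventually inactive at each t < T. *)
Lemma right_lebesgue_pt (a : R -> R) : mu.-integrable I (EFin \o a) ->
  {ae mu, forall t, 0 <= t < T ->
    k.+1%:R * \int[mu]_(r in `[t, Num.min T (t + k.+1%:R^-1)]) a r
      @[k --> \oo] --> a t}.
Proof.
move=> ia.
have iaI : mu.-integrable setT (EFin \o (a \_ I)).
  by rewrite -restrict_EFin; apply/(integrable_mkcond _ _).1.
have ia0 y : mu.-integrable `]-oo, y] (EFin \o (a \_ I)).
  by apply: integrableS iaI.
have /= := FTC1Ny ia0 (integrable_locally_restrict (measurable_itv _) ia).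
apply: (@filterS _ (almost_everywhere mu)).
move=> t /= [dF F't] /andP[t0 tT].
set F := fun x : R => _ in dF F't.
have Fat : a t = 'D_1 F t.
  by rewrite -derive1E F't patchE mem_set//= in_itv/= t0 ltW.
rewrite Fat; have := cvg_comp _ _ (@inv_natS_dnbhs0 R) dF.
rewrite -/(derive F t 1); apply: cvg_trans; apply: near_eq_cvg; near=> k.
have k0 : 0 < k.+1%:R^-1 :> R by rewrite invr_gt0.
have kT : t + k.+1%:R^-1 <= T.
  rewrite -lerBrDl; apply: ltW; near: k.
  have tT' : 0 < T - t by rewrite subr_gt0.
  have /cvgrPdist_lt/(_ _ tT') := @cvg_harmonic R.
  apply: filterS => k; by rewrite sub0r normrN gtr0_norm ?invr_gt0.
rewrite /= invrK (min_idPr kT) [_ *: 1]mulr1 [_ + t]addrC.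
congr (_ * _); rewrite /F/= Rintegral_itvB ?bnd_simp ?lerDl ?ltW//.
rewrite Rintegral_itv_obnd_cbnd; last exact: (integrableS _ _ _ iaI).
apply: eq_Rintegral => r; rewrite inE/= in_itv/= patchE => /andP[tr rt].
by rewrite mem_set//= in_itv/= (le_trans t0 tr) (le_trans rt).
Unshelve. all: by end_near. Qed.

(** All right difference quotients of the primitive vanish. *)
Lemma Rintegral_eq0_ae (a : R -> R) : mu.-integrable I (EFin \o a) ->
  (forall t, 0 <= t <= T -> \int[mu]_(r in `[0, t]) a r = 0) ->
  {ae mu, forall t, I t -> a t = 0}.
Proof.
move=> ia a0; have := right_lebesgue_pt ia.
have : {ae mu, forall t, t != T}.
  exists [set T]; split => //; first exact: lebesgue_measure_set1.
  by move=> t/= /negP; rewrite negbK => /eqP.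
apply: (aeS2 mu) => t tT /[swap]; rewrite /= in_itv/= => /andP[t0 tT'].
rewrite t0 lt_neqAle tT tT' => /(_ isT)/cvg_lim <- //.
rewrite (_ : (fun k => _) = (fun=> 0)) ?lim_cst//.
apply/funext => k.
have h0 : 0 <= k.+1%:R^-1 :> R by rewrite invr_ge0.
set s := Num.min _ _.
have ts : t <= s by rewrite le_min tT' lerDl.
have sT : s <= T by rewrite ge_min lexx.
by rewrite -Rintegral_itv_add// !a0 ?subr0 ?mulr0 ?t0 ?(le_trans t0 ts).
Qed.

End integrals.

Section sobolev.
Context {R : realType} {d : nat} {T : R} (hT : 0 < T).
Local Notation mu := (@lebesgue_measure R).
Local Notation E := 'rV[R]_d.
Local Notation V := (@cpath R T d).
Local Notation I := (`[0, T]%classic : set R).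
Local Notation L2 := (@L2norm R d T).
Local Notation acd := (@ac_derivative R d T).
Implicit Types (x y : V) (p q : R -> E).

Lemma ac_derivative_sub p q (s t : R) i : acd p q ->
  0 <= s -> s <= t -> t <= T ->
  p t 0 i - p s 0 i = \int[mu]_(r in `[s, t]) q r 0 i.
Proof.
move=> /(_ i)[iq pq] s0 st tT.
rewrite -(Rintegral_itv_add s0 st tT iq) (pq t) ?(pq s) ?s0 ?(le_trans s0)//=.
  by rewrite opprD addrACA subrr add0r.
exact: le_trans tT.
Qed.

(** The difference of two derivatives has zero primitive, coordinate by coordinate. *)
Lemma ac_derivative_unique p q q' :
  acd p q -> acd p q' ->
  {ae mu, forall t, I t -> q t = q' t}.
Proof.
move=> pq pq'.
have h i : {ae mu, forall t, I t -> (q t - q' t) 0 i = 0}.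
  have [iq ?] := pq i; have [iq' ?] := pq' i.
  apply: Rintegral_eq0_ae => //.
    rewrite (_ : _ \o _ = (fun s => (q s 0 i)%:E) \- (fun s => (q' s 0 i)%:E))%E.
      exact: integrableB.
    by apply/funext => s; rewrite /= !mxE EFinB.
  move=> t /andP[t0 tT].
  under eq_Rintegral do rewrite !mxE.
  rewrite RintegralB//; last 2 first.
    exact: (integrable_sub_itv (lexx 0) tT iq).
    exact: (integrable_sub_itv (lexx 0) tT iq').
  by rewrite -(ac_derivative_sub i pq) -?(ac_derivative_sub i pq') ?subrr.
have : {ae mu, forall t, forall i, I t -> (q t - q' t) 0 i = 0}.
  exact: (@filter_forall _ _ (fun i t => I t -> (q t - q' t) 0 i = 0) _
    (ae_filter_ringOfSetsType mu) h).
apply: (aeS mu) => t ht It; apply/rowP => i; apply/eqP.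
by have := ht i It; rewrite !mxE => /eqP; rewrite subr_eq0.
Qed.

Lemma velocityP x : sobolev x -> acd x (velocity x).
Proof. by move=> [q xq _]; exact: (xgetI (P := acd x) (fun=> 0) xq). Qed.

Lemma velocity_ae x q : acd x q -> {ae mu, forall t, I t -> velocity x t = q t}.
Proof.
move=> xq; apply: (@ac_derivative_unique x) => //.
exact: (xgetI (P := acd x) (fun=> 0) xq).
Qed.

(** Measurability coordinate by coordinate is what [ac_derivative] provides. *)
Definition coord_measurable q := forall i, measurable_fun I (fun s => q s 0 i).

Lemma ac_coord_measurable p q : acd p q -> coord_measurable q.
Proof. by move=> pq i; have [/measurable_int/measurable_EFinP] := pq i. Qed.

Lemma Rintegral_ae (a b : R -> R) (D : set R) : measurable D -> D `<=` I ->
  mu.-integrable I (EFin \o a) -> measurable_fun I b ->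
  {ae mu, forall t, I t -> a t = b t} ->
  mu.-integrable D (EFin \o b) /\
  \int[mu]_(t in D) a t = \int[mu]_(t in D) b t.
Proof.
move=> mD DI ia mb ab.
have ib : mu.-integrable I (EFin \o b).
  have /integrableP[ma fa] := ia.
  apply/integrableP; split; first exact/measurable_EFinP.
  have <- : (\int[mu]_(t in I) `|(EFin \o a) t| = \int[mu]_(t in I) `|(EFin \o b) t|)%E.
    apply: ae_eq_integral => //.
    - by apply: measurableT_comp.
    - by apply: measurableT_comp => //; exact/measurable_EFinP.
    - by apply: (aeS mu) ab => t h It /=; rewrite h.
  exact: fa.
have iaD : mu.-integrable D (EFin \o a) by apply: integrableS ia.
have ibD : mu.-integrable D (EFin \o b) by apply: integrableS ib.
split => //; rewrite /Rintegral; congr fine; apply: ae_eq_integral => //.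
- by have /measurable_int := iaD.
- by have /measurable_int := ibD.
- by apply: (aeS mu) ab => t h Dt /=; rewrite h//; exact: DI.
Qed.

Lemma ac_derivative_ae p q q' : acd p q -> coord_measurable q' ->
  {ae mu, forall t, I t -> q t = q' t} -> acd p q'.
Proof.
move=> pq mq' qq' i; have [iq pqi] := pq i.
have qq'i : {ae mu, forall t, I t -> q t 0 i = q' t 0 i}.
  by apply: (aeS mu) qq' => t h It; rewrite h.
split; first by have [] := Rintegral_ae (measurable_itv _) (@subset_refl _ I) iq (mq' i) qq'i.
move=> t tT; rewrite pqi//; congr (_ + _); have /andP[t0 tT'] := tT.
have tI : `[0, t]%classic `<=` I by apply: subset_itv; rewrite bnd_simp.
by have [] := Rintegral_ae (measurable_itv _) tI iq (mq' i) qq'i.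
Qed.

Lemma path_coord_continuous x i : continuous (fun t => x t 0 i).
Proof.
move=> t; apply: (@continuous_comp _ _ _ (x : R -> E) (fun z => z 0 i)).
  exact: cpath_cts.
exact: coord_continuous.
Qed.

Lemma path_coord_measurable x : coord_measurable x.
Proof.
by move=> i; apply: measurable_funTS; apply: continuous_measurable_fun;
  exact: path_coord_continuous.
Qed.

Lemma measurable_comp_path (F : E * E -> R) (u v : R -> E) : continuous F ->
  coord_measurable u -> coord_measurable v -> measurable_fun I (fun t => F (u t, v t)).
Proof.
exact: (measurable_comp_pair (measurable_itv `[0, T])).
Qed.

Lemma measurable_enorm2 q : coord_measurable q -> measurable_fun I (fun t => enorm (q t) ^+ 2).
Proof.
move=> mq.
rewrite (_ : (fun _ => _) = (fun t => \sum_i q t 0 i ^+ 2)); last first.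
  by apply/funext => t; exact: enorm_sqr.
by apply: measurable_sum => i; apply: measurable_funX; exact: mq.
Qed.

Lemma L2norm_le q (c : R) : 0 <= c ->
  (L2 q <= c%:E)%E <->
  (\int[mu]_(t in I) (enorm (q t) ^+ 2)%:E <= (c ^+ 2)%:E)%E.
Proof.
move=> c0; rewrite /L2norm.
have : (0 <= \int[mu]_(t in I) (enorm (q t) ^+ 2)%:E)%E.
  by apply: integral_ge0 => t _; rewrite lee_fin sqr_ge0.
case: (\int[mu]_(t in I) _)%E => [r| |]//.
  rewrite lee_fin => r0; rewrite poweR_EFin !lee_fin powR12_sqrt//.
  by rewrite -[in X in _ <-> X](sqr_sqrtr r0) ler_sqr ?nnegrE ?sqrtr_ge0.
by rewrite poweRyr ?invr_gt0.
Qed.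

Lemma L2norm_lty q :
  (L2 q < +oo)%E <-> (\int[mu]_(t in I) (enorm (q t) ^+ 2)%:E < +oo)%E.
Proof.
rewrite /L2norm.
have : (0 <= \int[mu]_(t in I) (enorm (q t) ^+ 2)%:E)%E.
  by apply: integral_ge0 => t _; rewrite lee_fin sqr_ge0.
case: (\int[mu]_(t in I) _)%E => [r| |]//.
  by rewrite poweR_EFin !ltry.
by rewrite poweRyr ?invr_gt0.
Qed.

Lemma eq_integral_ae (F G : R -> \bar R) : measurable_fun I F -> measurable_fun I G ->
  {ae mu, forall t, I t -> F t = G t} ->
  (\int[mu]_(t in I) F t = \int[mu]_(t in I) G t)%E.
Proof. by move=> mF mG FG; apply: ae_eq_integral. Qed.

(** Membership in H^1 can be tested on any derivative, since all of them agree almost everywhere. *)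
Lemma sobolevP x q : acd x q ->
  sobolev x <-> mu.-integrable I (EFin \o (fun t => enorm (q t) ^+ 2)).
Proof.
move=> xq; have mq := ac_coord_measurable xq.
have fin q' : coord_measurable q' -> (L2 q' < +oo)%E <->
    mu.-integrable I (EFin \o (fun t => enorm (q' t) ^+ 2)).
  move=> mq'; rewrite L2norm_lty.
  have abs : (\int[mu]_(t in I) `|(enorm (q' t) ^+ 2)%:E| =
    \int[mu]_(t in I) (enorm (q' t) ^+ 2)%:E)%E.
    by apply: eq_integral => t _; rewrite gee0_abs// lee_fin sqr_ge0.
  split => [h|/integrableP[_]]; last by rewrite abs.
  apply/integrableP; split; last by rewrite abs.
  by apply/measurable_EFinP; exact: measurable_enorm2.
split => [[q' xq' /L2norm_lty]|iq]; last by exists q => //; exact/fin.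
move=> h; apply/fin => //; apply/L2norm_lty; move: h.
rewrite (@eq_integral_ae _ (fun t => (enorm (q t) ^+ 2)%:E))//.
- by apply/measurable_EFinP; apply: measurable_enorm2; exact: ac_coord_measurable xq'.
- by apply/measurable_EFinP; exact: measurable_enorm2.
- apply: (aeS mu) (ac_derivative_unique xq' xq) => t h It.
  by rewrite h.
Qed.

Lemma integral_enorm2_ae q q' : coord_measurable q -> coord_measurable q' ->
  {ae mu, forall t, I t -> q t = q' t} ->
  (\int[mu]_(t in I) (enorm (q t) ^+ 2)%:E =
   \int[mu]_(t in I) (enorm (q' t) ^+ 2)%:E)%E.
Proof.
move=> mq mq' qq'; apply: eq_integral_ae.
- by apply/measurable_EFinP; exact: measurable_enorm2.
- by apply/measurable_EFinP; exact: measurable_enorm2.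
- by apply: (aeS mu) qq' => t h It; rewrite h.
Qed.

(** Removes the choice of the velocity and the square roots from the energy bound. *)
Lemma actionsP (M : R) i x q : 0 < M -> acd x q ->
  actions M i x <-> x 0 = i /\
  (\int[mu]_(t in I) (enorm (q t) ^+ 2)%:E <= (T * M ^+ 2)%:E)%E.
Proof.
move=> M0 xq; have mq := ac_coord_measurable xq.
have xv : acd x (velocity x) := xgetI (P := acd x) (fun=> 0) xq.
have qv : (\int[mu]_(t in I) (enorm (velocity x t) ^+ 2)%:E =
   \int[mu]_(t in I) (enorm (q t) ^+ 2)%:E)%E.
  by apply: integral_enorm2_ae => //; [exact: ac_coord_measurable xv|exact: velocity_ae].
have TM : T * M ^+ 2 = (Num.sqrt T * M) ^+ 2 by rewrite exprMn sqr_sqrtr// ltW.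
have TM0 : 0 <= Num.sqrt T * M by rewrite mulr_ge0 ?sqrtr_ge0// ltW.
rewrite TM; split => [[sx x0 /L2norm_le]|[x0 h]].
  by rewrite qv => /(_ TM0).
split => //; last by apply/L2norm_le => //; rewrite qv.
by exists q => //; apply/L2norm_lty; exact: le_lt_trans h (ltry _).
Qed.

End sobolev.
Arguments coord_measurable {R d} T q.

(** * The Lagrangian *)

Lemma cvg_near_lt (R : realType) (u : nat -> R) (l c : R) :
  u @ \oo --> l -> l < c -> \forall k \near \oo, u k < c.
Proof.
move=> /cvgrPdist_lt ul lc; have /ul : 0 < c - l by rewrite subr_gt0.
by apply: filterS => k; rewrite ltr_norml => /andP[h1 h2]; lra.
Qed.

Lemma cvg_harmonic_add (R : realType) (W : normedModType R) (x h : W) :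
  x + (k.+1%:R^-1 : R) *: h @[k --> \oo] --> x.
Proof.
rewrite -[X in _ --> X]addr0 -(scale0r h).
apply: cvgD; first exact: cvg_cst.
by apply: cvgZr_tmp; exact: cvg_harmonic.
Qed.

Section lagrangian.
Context {R : realType} {d : nat}.
Local Notation E := 'rV[R]_d.
Variable L : E -> E -> R.
Hypothesis Lstar : star_ii L.
Implicit Types x y v w p h : E.

Lemma near_enorm_lt x (e : R) : 0 < e -> nbhs x [set y | enorm (y - x) < e].
Proof.
move=> e0.
have D0 : 0 < d.+1%:R :> R by rewrite ltr0n.
apply: (@filterS _ (nbhs x) (nbhs_filter _) _ _ _
  (nbhsx_ballx x _ (divr_gt0 e0 D0))) => y.
rewrite -ball_normE/= ltr_pdivlMr// mulrC distrC => xy.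
apply: le_lt_trans (enorm_le_norm _) _.
by apply: le_lt_trans xy; rewrite ler_wpM2r// ler_nat.
Qed.

Lemma dot_continuous p : continuous (dot p).
Proof.
move=> w; apply/(@cvgrPdist_lt _ _ _ (nbhs w) (nbhs_filter _)) => e e0.
have p0 : 0 < enorm p + 1 by rewrite ltr_wpDl ?enorm_ge0.
apply: (@filterS _ (nbhs w) (nbhs_filter _) _ _ _
  (near_enorm_lt w (divr_gt0 e0 p0))) => y /=.
rewrite ltr_pdivlMr// enormB => wy; rewrite -dotBr.
apply: le_lt_trans (abs_dot_le _ _) _; apply: le_lt_trans wy.
by rewrite mulrC ler_wpM2l ?enorm_ge0// lerDl.
Qed.

(** The lower bound holds because theta is nonnegative. *)
Lemma lag_bound : exists c0 C : R, [/\ 0 < c0, 0 < C &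
  forall x v, - c0 <= L x v <= C * (1 + enorm v ^+ 2)].
Proof.
have [_ _ [theta [th0 _ _ [[c0 [C [c00 C0 h]]] _ _]]]] := Lstar.
exists c0, C; split => // x v; have /andP[h1 ->] := h x v; rewrite andbT.
by have := th0 _ (enorm_ge0 v); lra.
Qed.

(** The bound of L_x and L_v by theta becomes quadratic, because theta itself is at most L + c_0
    and L grows at most quadratically. *)
Lemma lag_grad_bound (r : R) : 0 < r -> exists2 C : R, 0 < C & forall x v,
  enorm x <= r ->
  enorm (grad (L^~ v) x) <= C * (1 + enorm v ^+ 2) /\
  enorm (grad (L x) v) <= C * (1 + enorm v ^+ 2).
Proof.
move=> r0.
have [_ _ [theta [th0 _ _ [[c0 [C [c00 C0 h]]] gr _]]]] := Lstar.
have [D hD] := gr _ r0.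
exists ((`|D| + 1) * (C + c0)).
  by apply: mulr_gt0; [exact: (ltr_wpDl (normr_ge0 _) ltr01)|exact: addr_gt0].
move=> x v xr.
have th v' : theta (enorm v') <= (C + c0) * (1 + enorm v' ^+ 2).
  have /andP[h1 h2] := h x v'; have := sqr_ge0 (enorm v'); nra.
have := hD x v xr; rewrite ge_max => /andP[h1 h2].
have b : D * theta (enorm v) <= (`|D| + 1) * (C + c0) * (1 + enorm v ^+ 2).
  apply: (@le_trans _ _ (`|D| * theta (enorm v))).
    by rewrite ler_wpM2r ?th0 ?enorm_ge0// ler_norm.
  rewrite -mulrA; apply: ler_pM => //; first exact/th0/enorm_ge0.
  by rewrite lerDl.
by split; [exact: le_trans h1 b|exact: le_trans h2 b].
Qed.

Lemma enorm_segment x y (r s : R) : enorm x <= r -> enorm y <= r ->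
  0 <= s <= 1 -> enorm (x + s *: (y - x)) <= r.
Proof.
move=> xr yr /andP[s0 s1].
have -> : x + s *: (y - x) = (1 - s) *: x + s *: y.
  by rewrite scalerBr scalerBl scale1r addrA addrAC.
apply: le_trans (enormD _ _) _; rewrite !enormZ !ger0_norm ?subr_ge0//; nra.
Qed.

Lemma lag_diff_x v x : differentiable (L^~ v) x.
Proof. by have [_ h _] := Lstar. Qed.

Lemma lag_diff_v x v : differentiable (L x) v.
Proof. by have [h _ _] := Lstar; have [_ [[]]] := h x. Qed.

Lemma lag_x_lip (r : R) : 0 < r -> exists2 C : R, 0 < C & forall x y v,
  enorm x <= r -> enorm y <= r ->
  `|L y v - L x v| <= C * (1 + enorm v ^+ 2) * enorm (y - x).
Proof.
move=> r0; have [C C0 hC] := lag_grad_bound r0; exists C => // x y v xr yr.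
apply: (@grad_lipschitz _ _ (L^~ v)) => s s01; split; first exact: lag_diff_x.
by have [] := hC (x + s *: (y - x)) v (enorm_segment xr yr s01).
Qed.

Lemma lag_v_lip (r D : R) : 0 < r -> exists2 C : R, 0 < C & forall x v w,
  enorm x <= r -> enorm w <= D ->
  `|L x (v + w) - L x v| <= C * (1 + enorm v ^+ 2) * enorm w.
Proof.
move=> r0; have [C C0 hC] := lag_grad_bound r0.
exists (C * (2 + 2 * D ^+ 2)).
  by rewrite mulr_gt0// ltr_wpDr// mulr_ge0// sqr_ge0.
move=> x v w xr wD; rewrite -[in leRHS](addrK v w) -(addrC v).
apply: grad_lipschitz => s /andP[s0 s1]; split; first exact: lag_diff_v.
rewrite (addrC v) addrK; set u := v + s *: w.
have [_ h] := hC x u xr; apply: le_trans h _.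
rewrite -mulrA ler_pM2l//.
have : enorm u <= enorm v + D.
  apply: le_trans (enormD _ _) _; rewrite lerD2l enormZ ger0_norm//.
  by apply: le_trans wD; rewrite ler_piMl ?enorm_ge0.
have := enorm_ge0 u; have := enorm_ge0 v; have := enorm_ge0 w.
move: (enorm u) (enorm v) (enorm w) wD => a b c cD c0 b0 a0 aD.
have aD2 : a ^+ 2 <= (b + D) ^+ 2 by rewrite ler_sqr// nnegrE; lra.
have := sqr_ge0 (b - D); have := sqr_ge0 (b * D); nra.
Qed.

(** L is locally Lipschitz in x, uniformly for bounded v, and continuous in v for fixed x. *)
Lemma lag_continuous : continuous (fun p : E * E => L p.1 p.2).
Proof.
move=> [x v]; apply/cvgrPdist_lt => e e0 /=.
have r0 : 0 < enorm x + 1 by rewrite ltr_wpDl ?enorm_ge0.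
have [C C0 hC] := lag_x_lip r0.
pose K := C * (1 + (enorm v + 1) ^+ 2).
have K0 : 0 < K.
  by rewrite mulr_gt0// ltr_wpDr// sqr_ge0.
have e2 : 0 < e / 2 by rewrite divr_gt0.
have eK : 0 < Num.min 1 (e / 2 / K) by rewrite lt_min ltr01 divr_gt0.
have := differentiable_continuous (lag_diff_v x v).
move=> /cvgrPdist_lt/(_ _ e2) nv.
exists ([set y | enorm (y - x) < Num.min 1 (e / 2 / K)],
  [set w | enorm (w - v) < 1] `&` [set w | `|L x v - L x w| < e / 2]).
  by split; [exact: near_enorm_lt|apply: filterI => //; exact: near_enorm_lt].
move=> [y w] [/= + [wv Lw]]; rewrite lt_min => /andP[y1 yx].
rewrite -(subrKA (L x w)) (le_lt_trans (ler_normD _ _))//.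
rewrite [ltRHS]splitr ltrD// distrC.
have wb : enorm w <= enorm v + 1.
  by rewrite -[X in enorm X <= _](subrKC v w); apply: le_trans (enormD _ _) _; rewrite lerD2l ltW.
have yb : enorm y <= enorm x + 1.
  by rewrite -[X in enorm X <= _](subrKC x y); apply: le_trans (enormD _ _) _; rewrite lerD2l ltW.
have xb : enorm x <= enorm x + 1 by rewrite lerDl.
apply: le_lt_trans (hC x y w xb yb) _.
apply: (@le_lt_trans _ _ (K * enorm (y - x))).
  rewrite ler_wpM2r ?enorm_ge0// ler_wpM2l ?(ltW C0)// lerD2l.
  by rewrite ler_sqr ?nnegrE ?enorm_ge0// addr_ge0 ?enorm_ge0.
by rewrite mulrC -ltr_pdivlMr.
Qed.

(** Stated as a comparison of slopes: the slope of a convex function increases. *)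
Lemma lag_convex x v w s : 0 <= s <= 1 ->
  L x (v + s *: w) - L x v <= s * (L x (v + w) - L x v).
Proof.
move=> s01; have [/(_ x)[[a a0 h] _] _ _] := Lstar.
have := h (v + w) v s s01.
have -> : s *: (v + w) + (1 - s) *: v = v + s *: w.
  by rewrite scalerDr scalerBl scale1r addrC addrA subrK.
have : 0 <= a / 2 * s * (1 - s) * enorm (v + w - v) ^+ 2.
  have /andP[s0 s1] := s01.
  apply: mulr_ge0; last exact: sqr_ge0.
  apply: mulr_ge0; last by rewrite subr_ge0.
  by apply: mulr_ge0 => //; apply: divr_ge0 => //; exact: ltW.
lra.
Qed.

Lemma lag_convex_lower x v w s : 0 <= s <= 1 ->
  - (s * (L x (v - w) - L x v)) <= L x (v + s *: w) - L x v.
Proof.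
move=> s01; have := lag_convex x v (- w) s01.
have h2 : 0 <= (2^-1 : R) <= 1 by rewrite invr_ge0 ler0n invf_le1 ?ler1n ?ltr0n.
have := lag_convex x (v - s *: w) (2 *: (s *: w)) h2.
rewrite scalerA mulVf ?pnatr_eq0// scale1r subrK.
have -> : v - s *: w + 2 *: (s *: w) = v + s *: w.
  by rewrite scaler_nat mulr2n addrA subrK.
rewrite scalerN; lra.
Qed.

(** Joint differentiability of L along a line, although L is only assumed differentiable in each
    variable. The increment in x is taken at fixed v. The increment in v is taken at the moving
    point x_k; there convexity squeezes its slope between the slopes over a fixed larger step 1/m,
    backwards and forwards, and these converge as x_k tends to x, since that step is fixed. *)
Lemma lag_quot_cvg x v h w :
  k.+1%:R * (L (x + k.+1%:R^-1 *: h) (v + k.+1%:R^-1 *: w) - L x v)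
    @[k --> \oo] --> dot (grad (L^~ v) x) h + dot (grad (L x) v) w.
Proof.
pose xk (k : nat) := x + k.+1%:R^-1 *: h.
have xkx u : L (xk k) u @[k --> \oo] --> L x u.
  apply: (@continuous_cvg _ _ _ _ _ xk (L^~ u)); last exact: cvg_harmonic_add.
  exact: differentiable_continuous (lag_diff_x u x).
have c1 := @cvg_diff_quot _ _ _ x h (lag_diff_x v x).
have c2 : k.+1%:R * (L (xk k) (v + k.+1%:R^-1 *: w) - L (xk k) v) @[k --> \oo]
    --> dot (grad (L x) v) w.
  apply/cvgrPdist_lt => e e0.
  have := @cvg_diff_quot _ _ _ _ w (lag_diff_v x v).
  move=> /cvgrPdist_lt/(_ _ e0) n1.
  have := @cvg_diff_quot _ _ _ _ (- w) (lag_diff_v x v).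
  move=> /cvgrPdist_lt/(_ _ e0) n2.
  have [m [/= m1 m2]] : exists m, [set m |
     `|dot (grad (L x) v) w - m.+1%:R * (L x (v + m.+1%:R^-1 *: w) - L x v)| < e /\
     `|dot (grad (L x) v) (- w) - m.+1%:R * (L x (v + m.+1%:R^-1 *: - w) - L x v)| < e] m.
    by apply: (@filter_ex _ \oo); apply: filterI n1 n2.
  pose b := dot (grad (L x) v) w.
  have m0 : 0 < m.+1%:R :> R by rewrite ltr0n.
  have n3 : \forall k \near \oo, m.+1%:R * (L (xk k) (v + m.+1%:R^-1 *: w) - L (xk k) v) < b + e.
    apply: (@cvg_near_lt _ _ (m.+1%:R * (L x (v + m.+1%:R^-1 *: w) - L x v))).
      by apply: cvgMl_tmp; apply: cvgB; exact: xkx.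
    by move: m1; rewrite ltr_norml -/b => /andP[h1 h2]; lra.
  have n4 : \forall k \near \oo, m.+1%:R * (L (xk k) (v - m.+1%:R^-1 *: w) - L (xk k) v) < - b + e.
    apply: (@cvg_near_lt _ _ (m.+1%:R * (L x (v - m.+1%:R^-1 *: w) - L x v))).
      by apply: cvgMl_tmp; apply: cvgB; exact: xkx.
    by move: m2; rewrite ltr_norml dotNr scalerN -/b => /andP[h1 h2]; lra.
  near=> k.
  have k0 : 0 < k.+1%:R :> R by rewrite ltr0n.
  have mk : 0 <= (m.+1%:R / k.+1%:R : R) <= 1.
    rewrite divr_ge0//= ler_pdivrMr// mul1r ler_nat ltnS; near: k.
    exact: nbhs_infty_ge.
  have E1 : k.+1%:R^-1 *: w = (m.+1%:R / k.+1%:R) *: (m.+1%:R^-1 *: w).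
    by rewrite scalerA mulrAC divff ?mul1r// gt_eqF.
  have kE (y : R) : k.+1%:R * ((m.+1%:R / k.+1%:R) * y) = m.+1%:R * y :> R.
    by rewrite mulrA [X in X * _]mulrC divfK// gt_eqF.
  have up := lag_convex (xk k) v (m.+1%:R^-1 *: w) mk.
  have lo := lag_convex_lower (xk k) v (m.+1%:R^-1 *: w) mk.
  rewrite -E1 in up lo.
  rewrite -(ler_pM2l k0) kE in up.
  rewrite -(ler_pM2l k0) mulrN kE in lo.
  have h3 : m.+1%:R * (L (xk k) (v + m.+1%:R^-1 *: w) - L (xk k) v) < b + e.
    by near: k.
  have h4 : m.+1%:R * (L (xk k) (v - m.+1%:R^-1 *: w) - L (xk k) v) < - b + e.
    by near: k.
  rewrite -/b ltr_norml; apply/andP; split; lra.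
rewrite [X in X @ _ --> _](_ : _ = (fun k : nat =>
  k.+1%:R * (L (xk k) v - L x v) +
  k.+1%:R * (L (xk k) (v + k.+1%:R^-1 *: w) - L (xk k) v))); last first.
  by apply/funext => k; rewrite -mulrDr [in RHS]addrC subrKA.
exact: cvgD c1 c2.
Unshelve. all: by end_near. Qed.

(** The difference quotient in the strong convexity inequality tends to the derivative. *)
Lemma lag_strong x : exists2 a : R, 0 < a & forall v w,
  L x v + dot (grad (L x) v) (w - v) + a / 2 * enorm (w - v) ^+ 2 <= L x w.
Proof.
have [/(_ x)[[a a0 h] _] _ _] := Lstar; exists a => // v w.
apply/ler_addgt0Pr => e e0.
have := @cvg_diff_quot _ _ _ _ (w - v) (lag_diff_v x v).
move=> /cvgrPdist_lt/(_ (e / 2)); rewrite divr_gt0// => /(_ isT) n1.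
set A := a / 2 * enorm (w - v) ^+ 2.
have A0 : 0 <= A by rewrite mulr_ge0 ?sqr_ge0// divr_ge0// ltW.
have : A * k.+1%:R^-1 @[k --> \oo] --> A * 0.
  by apply: cvgMl_tmp; exact: cvg_harmonic.
rewrite mulr0 => /(@cvg_near_lt _ _ _ (e / 2)); rewrite divr_gt0// => /(_ isT) n2.
have [k [/= k1 k2]] := @filter_ex _ \oo _ _ (filterI n1 n2).
have k0 : 0 < k.+1%:R :> R by rewrite ltr0n.
have k01 : 0 <= (k.+1%:R^-1 : R) <= 1.
  by rewrite invr_ge0 ler0n/= invf_le1// ler1n.
have := h w v _ k01.
have -> : k.+1%:R^-1 *: w + (1 - k.+1%:R^-1) *: v = v + k.+1%:R^-1 *: (w - v).
  by rewrite scalerBl scale1r scalerBr addrCA.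
rewrite -(ler_pM2l k0) => hh.
have kD : k.+1%:R * (L x (v + k.+1%:R^-1 *: (w - v)) - L x v) <=
   L x w - L x v - (A - A * k.+1%:R^-1).
  rewrite mulrBr; apply: le_trans (lerB hh (lexx _)) _.
  rewrite le_eqVlt; apply/orP; left; apply/eqP; rewrite /A.
  by field; rewrite gt_eqF.
move: k1; rewrite ltr_norml => /andP[_ k1].
move: kD k1 k2; clearbody A.
set D := (k.+1%:R * (L x (v + k.+1%:R^-1 *: (w - v)) - L x v) : R).
move: D => D kD k1 k2.
move: (A / k.+1%:R : R) kD k2 => a1 kD k2.
lra.
Qed.

Lemma lag_grad_inj x v w : grad (L x) v = grad (L x) w -> v = w.
Proof.
move=> vw; have [a a0 h] := lag_strong x.
have h1 := h v w; have h2 := h w v.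
rewrite -vw -opprB dotNr enormN in h2.
apply/eqP; rewrite -subr_eq0; apply/eqP; apply: enorm_eq0.
have := enorm_ge0 (v - w); rewrite enormB in h1 h2 *.
move: (dot _ _) (enorm _) h1 h2 => b c h1 h2 c0.
suff : a * c ^+ 2 <= 0.
  rewrite pmulr_rle0// => c2.
  by apply/eqP; rewrite -sqrf_eq0 eq_le sqr_ge0 andbT.
lra.
Qed.

(** The equation L_v(x, v) = p is the first order condition for minimizing L(x, .) - p, which is
    coercive by strong convexity. *)
Lemma lag_grad_surj x p : exists v, grad (L x) v = p.
Proof.
have [a a0 h] := lag_strong x.
pose G w := L x w - dot p w.
pose g0 := grad (L x) 0 - p.
pose rho := 2 * enorm g0 / a + 1.
have Gc : continuous G.
  move=> w; have cL := differentiable_continuous (lag_diff_v x w).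
  apply: (@continuousB _ _ _ (L x) (dot p) w cL).
  exact: dot_continuous.
have [c + cmin] : exists2 c, c \in [set w : E | enorm w <= rho] &
    forall t, t \in [set w : E | enorm w <= rho] -> G c <= G t.
  apply: EVT_min_rV.
  - exists 0; rewrite /= enorm0 addr_ge0// divr_ge0 ?(ltW a0)//.
    by rewrite mulr_ge0 ?enorm_ge0.
  - apply: bounded_closed_compact.
      exists rho; split; first exact: num_real.
      by move=> r rr w /= wr; apply: le_trans (norm_le_enorm _) _; apply: le_trans wr (ltW rr).
    rewrite (_ : [set _ | _] = (@enorm R d) @^-1` [set r | r <= rho])//.
    by apply: closed_comp; [move=> w _; exact: enorm_continuous|exact: closed_le].
  - by apply: continuous_subspaceT.
rewrite inE/= => crho; exists c.
have Gmin w : G c <= G w.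
  have [wr|wr] := leP (enorm w) rho; first by apply: cmin; rewrite inE.
  apply: (@le_trans _ _ (G 0)).
    apply: cmin; rewrite inE/= enorm0 addr_ge0// divr_ge0 ?(ltW a0)//.
    by rewrite mulr_ge0 ?enorm_ge0.
  have := h 0 w; rewrite subr0 => hw.
  have := abs_dot_le g0 w; rewrite ler_norml => /andP[+ _].
  rewrite /g0 dotBl -/g0 => lo.
  have w0 := enorm_ge0 w; have gg := enorm_ge0 g0.
  have aw : 2 * enorm g0 <= a * enorm w.
    have : 2 * enorm g0 / a <= enorm w by apply: le_trans (ltW wr); rewrite /rho lerDl.
    by rewrite ler_pdivrMr// [_ * a]mulrC.
  have aw2 : 2 * enorm g0 * enorm w <= a * enorm w * enorm w by rewrite ler_wpM2r.
  have G0 : G 0 = L x 0 by rewrite /G -(scale0r 0) dotZr mul0r subr0.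
  rewrite G0 /G; rewrite expr2 in hw; lra.
have first_order w : 0 <= dot (grad (L x) c - p) w.
  have := @cvg_diff_quot _ _ _ _ w (lag_diff_v x c).
  rewrite dotBl => cv; rewrite subr_ge0 leNgt; apply/negP => lt.
  have /filter_ex[k] := cvg_near_lt cv lt.
  have := Gmin (c + k.+1%:R^-1 *: w); rewrite /G dotDr dotZr => h1 h2.
  have k0 : 0 < k.+1%:R :> R by rewrite ltr0n.
  move: h2; apply/negP; rewrite -leNgt -ler_pdivrMl//.
  by move: (k.+1%:R^-1 : R) h1 => r h1; lra.
apply: dot_eq0P => w; have h1 := first_order w; have h2 := first_order (- w).
rewrite dotNr in h2; rewrite dotBl in h1 h2.
by apply/eqP; rewrite eq_le; apply/andP; split; lra.
Qed.

(** The Legendre inverse (x, p) |-> v is continuous: a jump of v would violate the strong convexity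
    of L(x_t0, .) after an arbitrarily small change of x and p. This provides the continuous
    representative of the velocity of a minimizer. *)
Lemma lag_inv_continuous (x v p : R -> E) : continuous x -> continuous p ->
  (forall t, grad (L (x t)) (v t) = p t) -> continuous v.
Proof.
move=> cx cp xvp t0; set v0 := v t0.
suff nb (e : R) : 0 < e -> \forall t \near t0, enorm (v t - v0) <= e.
  apply/cvgrPdist_le => e e0; apply: filterS (nb e e0) => t; apply: le_trans.
  by rewrite distrC; exact: norm_le_enorm.
move=> e0; have [a a0 h] := lag_strong (x t0).
have r0 : 0 < enorm (x t0) + 1 by rewrite ltr_wpDl ?enorm_ge0.
have [C C0 hC] := lag_x_lip r0.
pose B := enorm v0 + e.
have B0 : 0 < B by rewrite ltr_wpDl ?enorm_ge0.
(* K bounds the Lipschitz constant of L(., w) for all w in the ball of radius B *)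
pose K := C * (1 + B ^+ 2).
have K0 : 0 < K by rewrite mulr_gt0// ltr_wpDr// sqr_ge0.
pose del := a * e ^+ 2 / 16.
have del0 : 0 < del by rewrite divr_gt0// mulr_gt0// exprn_gt0.
have n1 : \forall t \near t0, enorm (x t - x t0) < Num.min 1 (del / K).
  have m0 : 0 < Num.min 1 (del / K) by rewrite lt_min ltr01 divr_gt0.
  exact: (cx t0 _ (near_enorm_lt (x t0) m0)).
have n2 : \forall t \near t0, enorm (p t - p t0) < del / B.
  exact: (cp t0 _ (near_enorm_lt (p t0) (divr_gt0 del0 B0))).
near=> t.
have : enorm (x t - x t0) < Num.min 1 (del / K) by near: t.
rewrite lt_min => /andP[x1 xK].
have pB : enorm (p t - p t0) < del / B by near: t.
rewrite leNgt; apply/negP => ev.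
set D := enorm (v t - v0) in ev *.
have D0 : 0 < D by apply: lt_trans ev.
have s01 : 0 <= e / D <= 1 by rewrite divr_ge0 ?(ltW e0) ?(ltW D0)//= ler_pdivrMr// mul1r ltW.
(* the point at distance e from v0 towards v t: convexity at time t bounds the increment of L
   from v0 to u by that of p t, strong convexity at time t0 bounds it from below with a gain of 8
   del, and passing from one time to the other costs at most 4 del *)
pose u := v0 + (e / D) *: (v t - v0).
have uv0 : enorm (u - v0) = e.
  rewrite /u addrC addKr enormZ -/D ger0_norm; last by case/andP: s01.
  by rewrite divfK// gt_eqF.
have uB : enorm u <= B.
  by rewrite -(subrKC v0 u); apply: le_trans (enormD _ _) _; rewrite uv0.
have vB : enorm v0 <= B by rewrite lerDl ltW.
have xb : enorm (x t) <= enorm (x t0) + 1.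
  rewrite -[X in enorm X <= _](subrKC (x t0) (x t)).
  by apply: le_trans (enormD _ _) _; rewrite lerD2l ltW.
have xb0 : enorm (x t0) <= enorm (x t0) + 1 by rewrite lerDl.
have Lb w : enorm w <= B -> `|L (x t) w - L (x t0) w| <= del.
  move=> wB; apply: le_trans (hC _ _ w xb0 xb) _.
  apply: (@le_trans _ _ (K * enorm (x t - x t0))).
    rewrite ler_wpM2r ?enorm_ge0// ler_wpM2l ?(ltW C0)// lerD2l.
    by rewrite ler_sqr ?nnegrE ?enorm_ge0// ltW.
  by rewrite mulrC -ler_pdivlMr// ltW.
have pb w : enorm w <= B -> `|dot (p t - p t0) w| <= del.
  move=> wB; apply: le_trans (abs_dot_le _ _) _.
  apply: (@le_trans _ _ (enorm (p t - p t0) * B)); first by rewrite ler_wpM2l ?enorm_ge0.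
  by rewrite -ler_pdivlMr// ltW.
have [a' a'0 h'] := lag_strong (x t).
have cvx := lag_convex (x t) v0 (v t - v0) s01.
rewrite subrKC -/u in cvx.
have h1 := h' (v t) v0; rewrite (xvp t) in h1.
have h2 := h v0 u; rewrite xvp uv0 in h2.
have := Lb _ uB; have := Lb _ vB; have := pb _ uB; have := pb _ vB.
rewrite !ler_norml !dotBl => /andP[p1 p2] /andP[p3 p4] /andP[l1 l2] /andP[l3 l4].
have du : dot (p t) u = dot (p t) v0 + e / D * (dot (p t) (v t) - dot (p t) v0).
  by rewrite /u dotDr dotZr dotBr.
rewrite !dotBr in h1 h2.
have q0 : 0 <= a' / 2 * enorm (v0 - v t) ^+ 2.
  by rewrite mulr_ge0 ?sqr_ge0// divr_ge0// ltW.
have h3 : e / D * (L (x t) (v t) - L (x t) v0) <= e / D * (dot (p t) (v t) - dot (p t) v0).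
  by apply: ler_wpM2l; [case/andP: s01|lra].
have {}cvx : L (x t) u - L (x t) v0 <= dot (p t) u - dot (p t) v0.
  by apply: le_trans cvx _; apply: le_trans h3 _; rewrite du addrAC subrr add0r.
have del4 : a / 2 * e ^+ 2 = 8 * del by rewrite /del; field.
rewrite del4 in h2.
clear -cvx h2 p1 p2 p3 p4 l1 l2 l3 l4 del0.
move: (L (x t) u) (L (x t) v0) (L (x t0) u) (L (x t0) v0) (dot (p t) u)
  (dot (p t) v0) (dot (p t0) u) (dot (p t0) v0)
  cvx h2 p1 p2 p3 p4 l1 l2 l3 l4 => c1 c2 c3 c4 c5 c6 c7 c8.
lra.
Unshelve. all: by end_near. Qed.

End lagrangian.

(** * The cost of an H^1 path *)

Lemma Rdominated_convergence d (S : measurableType d) (R : realType)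
    (mu : {measure set S -> \bar R}) (D : set S) (u : nat -> S -> R) (l G : S -> R) :
  measurable D -> (forall k, measurable_fun D (u k)) ->
  (forall s, D s -> u ^~ s @ \oo --> l s) ->
  mu.-integrable D (EFin \o G) -> (forall k s, D s -> `|u k s| <= G s) ->
  mu.-integrable D (EFin \o l) /\
  \int[mu]_(s in D) u k s @[k --> \oo] --> \int[mu]_(s in D) l s.
Proof.
move=> mD mu_ ul iG uG.
have ml : measurable_fun D l by exact: measurable_fun_cvg mu_ ul.
have := @dominated_convergence _ _ _ mu D mD (fun k s => (u k s)%:E)
  (fun s => (l s)%:E) (fun s => (G s)%:E).
case.
- by move=> k; apply/measurable_EFinP.
- by apply/measurable_EFinP.
- by apply: aeW => s Ds; apply: cvg_EFin; [exact: nearW|exact: ul].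
- exact: iG.
- by apply: aeW => s k Ds; rewrite lee_fin uG.
move=> il _ cv; split => //.
suff /fine_cvgP[_] : [sequence (\int[mu]_(s in D) (u k s)%:E)%E]_k @ \oo -->
  (\int[mu]_(s in D) l s)%:E by [].
rewrite /Rintegral fineK//; exact: integrable_fin_num il.
Qed.

Section real_integrable.
Context d (S : measurableType d) (R : realType) (mu : {measure set S -> \bar R}).
Variables (D : set S) (mD : measurable D).
Implicit Types a b : S -> R.

Lemma RintegrableD a b : mu.-integrable D (EFin \o a) ->
  mu.-integrable D (EFin \o b) -> mu.-integrable D (EFin \o (fun s => a s + b s)).
Proof.
move=> ia ib; rewrite (_ : _ \o _ = fun s => ((EFin \o a) s + (EFin \o b) s)%E)//.
exact: integrableD.
Qed.

Lemma RintegrableZ (k : R) a : mu.-integrable D (EFin \o a) ->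
  mu.-integrable D (EFin \o (fun s => k * a s)).
Proof.
move=> ia; rewrite (_ : _ \o _ = fun s => (k%:E * (EFin \o a) s)%E)//.
exact: integrableZl.
Qed.

Lemma RintegrableB a b : mu.-integrable D (EFin \o a) ->
  mu.-integrable D (EFin \o b) -> mu.-integrable D (EFin \o (fun s => a s - b s)).
Proof.
move=> ia ib; rewrite (_ : _ \o _ = fun s => ((EFin \o a) s - (EFin \o b) s)%E)//.
exact: integrableB.
Qed.

Lemma Rle_integrable a b : measurable_fun D a -> (forall s, D s -> `|a s| <= b s) ->
  mu.-integrable D (EFin \o b) -> mu.-integrable D (EFin \o a).
Proof.
move=> ma ab ib; apply: le_integrable ib => //; first exact/measurable_EFinP.
move=> s Ds; rewrite /= lee_fin; apply: le_trans (ab s Ds) _; exact: ler_norm.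
Qed.

End real_integrable.

Lemma cvg_add_cst (R : realType) (a b : nat -> R) (la lb c : R) :
  a @ \oo --> la -> b @ \oo --> lb -> a k + b k + c @[k --> \oo] --> la + lb + c.
Proof. by move=> ha hb; apply: cvgD; [exact: cvgD|exact: cvg_cst]. Qed.

Section cost.
Context {R : realType} {d : nat} {T : R} (hT : 0 < T).
Local Notation mu := (@lebesgue_measure R).
Local Notation E := 'rV[R]_d.
Local Notation V := (@cpath R T d).
Local Notation I := (`[0, T]%classic : set R).
Local Notation PE := (Prob (@eucl_dist R d)).
Local Notation PV := (Prob (@supdist R T d)).
Local Notation acd := (@ac_derivative R d T).
Variables (L : E -> E -> R) (f g : E -> PE -> R).
Hypothesis Lstar : star_ii L.
Hypothesis fgstar : star_iii f g.
Implicit Types (x y : V) (q : R -> E) (eta : PV) (e : E).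

(** Makes t |-> f(x_t, law_at t eta) continuous, hence integrable. It may fail for a general
    measure on paths, whose marginals may have no first moment. *)
Definition law_continuous eta :=
  {within I, continuous (fun t => law_at t eta : PE)}.

Lemma path_bounded x : exists2 r : R, 0 < r & forall t, enorm (x t) <= r.
Proof.
exists (enorm (x 0) + supdist x (cst_cpath T (x 0)) + 1).
  by rewrite ltr_wpDl ?addr_ge0 ?enorm_ge0 ?supdist_ge0.
move=> t; have := supdist_ub x (cst_cpath T (x 0)) t.
rewrite /eucl_dist/= /cst => h.
have := enormD (x t - x 0) (x 0); rewrite subrK; lra.
Qed.

Lemma fg_grad_bound (r : R) : 0 < r -> exists2 C : R, 0 < C & forall (x : E) m,
  enorm x <= r -> enorm (grad (f^~ m) x) <= C /\ enorm (grad (g^~ m) x) <= C.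
Proof.
have [_ _ _ [C [b [C0 b0 h]]]] := fgstar; move=> r0.
exists (C * (r `^ b + 1)); first by rewrite mulr_gt0// ltr_wpDl// powR_ge0.
move=> x m xr; have := h x m; rewrite ge_max => /andP[h1 h2].
have : C * (enorm x `^ b + 1) <= C * (r `^ b + 1).
  by rewrite ler_pM2l// lerD2r ge0_ler_powR ?nnegrE ?enorm_ge0 ?(ltW b0) ?(ltW r0).
by move=> h3; split; [exact: le_trans h1 h3|exact: le_trans h2 h3].
Qed.

Lemma f_diff m (x : E) : differentiable (f^~ m) x.
Proof. by have [_ _ /(_ m)[[]]] := fgstar. Qed.

Lemma g_diff m (x : E) : differentiable (g^~ m) x.
Proof. by have [_ _ /(_ m)[_ []]] := fgstar. Qed.

(** Local Lipschitz bounds uniform in the measure, from the polynomial bound on the gradients. *)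
Lemma fg_lip (r : R) : 0 < r -> exists2 C : R, 0 < C & forall (x y : E) m,
  enorm x <= r -> enorm y <= r ->
  `|f y m - f x m| <= C * enorm (y - x) /\ `|g y m - g x m| <= C * enorm (y - x).
Proof.
move=> r0; have [C C0 hC] := fg_grad_bound r0; exists C => // x y m xr yr.
have h s (s01 : 0 <= s <= 1) := hC (x + s *: (y - x)) m (enorm_segment xr yr s01).
split.
  apply: (@grad_lipschitz _ _ (f^~ m)) => s s01; split; first exact: f_diff.
  by have [] := h s s01.
apply: (@grad_lipschitz _ _ (g^~ m)) => s s01; split; first exact: g_diff.
by have [] := h s s01.
Qed.

Lemma f_path_continuous x eta : law_continuous eta ->
  {within I, continuous (fun t => f (x t) (law_at t eta))}.
Proof.
move=> ceta t; have [cf _ _ _] := fgstar.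
have cx : {for t, continuous (x : subspace I -> E)}.
  by apply: continuous_subspaceT; exact: cpath_cts.
apply: (@continuous_comp (subspace I) (E * PE)%type R
  (fun t => (x t, law_at t eta : PE)) (fun p => f p.1 p.2)); last exact: cf.
move=> A [[P Q] /= [hP hQ] PQ].
have h1 : nbhs (t : subspace I) (x @^-1` P) := cx P hP.
have h2 : nbhs (t : subspace I) ((fun s => law_at s eta : PE) @^-1` Q) := ceta t Q hQ.
apply: (@filterS _ (nbhs (t : subspace I)) (nbhs_filter _) _ _ _ (filterI h1 h2)).
by move=> s [Ps Qs]; exact: (PQ (_, _)).
Qed.

Lemma f_path_integrable x eta : law_continuous eta ->
  mu.-integrable I (EFin \o (fun t => f (x t) (law_at t eta))).
Proof.
move=> ceta; apply: continuous_compact_integrable; first exact: segment_compact.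
exact: f_path_continuous.
Qed.

Lemma one_enorm2_integrable q : mu.-integrable I (EFin \o (fun t => enorm (q t) ^+ 2)) ->
  mu.-integrable I (EFin \o (fun t => 1 + enorm (q t) ^+ 2)).
Proof.
move=> iq.
have i1 : mu.-integrable I (EFin \o (fun=> 1 : R)).
  exact: integrable_cst_itv.
exact: RintegrableD.
Qed.

Lemma L_path_integrable x q : coord_measurable T q ->
  mu.-integrable I (EFin \o (fun t => enorm (q t) ^+ 2)) ->
  mu.-integrable I (EFin \o (fun t => L (x t) (q t))).
Proof.
move=> mq iq; have [c0 [C [c00 C0 h]]] := lag_bound Lstar.
have ib : mu.-integrable I (EFin \o (fun t => (c0 + C) * (1 + enorm (q t) ^+ 2))).
  by apply: RintegrableZ => //; exact: one_enorm2_integrable.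
apply: Rle_integrable ib => //.
- apply: (@measurable_comp_path _ _ _ (fun p => L p.1 p.2)).
  + exact: lag_continuous.
  + exact: path_coord_measurable.
  + exact: mq.
- move=> t _; have /andP[h1 h2] := h (x t) (q t).
  have q0 := sqr_ge0 (enorm (q t)).
  rewrite ler_norml; apply/andP; split; nra.
Qed.

Lemma sobolev_enorm2 x q : acd x q -> sobolev x ->
  mu.-integrable I (EFin \o (fun t => enorm (q t) ^+ 2)).
Proof. by move=> xq; move/(sobolevP xq). Qed.

Lemma integrand_integrable x q eta : acd x q -> sobolev x -> law_continuous eta ->
  mu.-integrable I (EFin \o (fun t => L (x t) (q t) + f (x t) (law_at t eta))).
Proof.
move=> xq sx ceta.
have iL := L_path_integrable x (ac_coord_measurable xq) (sobolev_enorm2 xq sx).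
have i_f := f_path_integrable x ceta.
exact: RintegrableD.
Qed.

(** The velocity chosen in [J] matters only up to a null set. *)
Lemma J_integralE x q eta : acd x q -> sobolev x -> law_continuous eta ->
  J L f g x eta = (\int[mu]_(t in I) (L (x t) (q t) + f (x t) (law_at t eta)) +
                   g (x T) (law_at T eta))%:E.
Proof.
move=> xq sx ceta; rewrite /J asboolT// EFinD; congr (_ + _)%E.
have xv := velocityP sx.
rewrite /Rintegral fineK; last first.
  by apply: integrable_fin_num; [exact: measurable_itv|exact: integrand_integrable].
apply: eq_integral_ae.
- exact: measurable_int (integrand_integrable xv sx ceta).
- exact: measurable_int (integrand_integrable xq sx ceta).
- apply: (aeS mu) (velocity_ae xq) => t h It.
  by rewrite h.
Qed.

Section bump.
Variables (x : V) (c : R -> R) (e : E).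
Hypothesis cc : continuous c.
Hypothesis cf : forall t, c t = c (clamp T t).

Lemma bump_continuous : continuous (fun t => x t + c t *: e).
Proof.
move=> t; apply: cvgD; first exact: cpath_cts.
by apply: cvgZr_tmp; exact: cc.
Qed.

Lemma bump_frozen t : x t + c t *: e = x (clamp T t) + c (clamp T t) *: e.
Proof. by rewrite -cf -cpath_frozen. Qed.

Definition bump : V := CPath bump_continuous bump_frozen.

Lemma bump_acd q (b : R -> R) : acd x q -> mu.-integrable I (EFin \o b) ->
  (forall t, 0 <= t <= T -> c t = c 0 + \int[mu]_(s in `[0, t]) b s) ->
  acd bump (fun t => q t + b t *: e).
Proof.
move=> xq ib cb i; have [iq xt] := xq i; split.
  rewrite (_ : (fun _ => _) = (fun t => (q t 0 i)%:E) \+ (fun t => (e 0 i)%:E * (b t)%:E))%E.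
    by apply: integrableD => //; exact: integrableZl.
  by apply/funext => t; rewrite !mxE EFinD EFinM muleC.
move=> t tT; rewrite /= !mxE (xt t tT) (cb t tT).
have [t0 tT'] := andP tT.
have iq' := integrable_sub_itv (lexx 0) tT' iq.
have ib' := integrable_sub_itv (lexx 0) tT' ib.
have ie : mu.-integrable `[0, t] (EFin \o (fun s => e 0 i * b s)).
  exact: RintegrableZ.
under [in RHS]eq_Rintegral do rewrite !mxE [b _ * _]mulrC.
rewrite RintegralD// RintegralZl// mulrDl addrACA; congr (_ + (_ + _)).
by rewrite mulrC.
Qed.

End bump.

(** * First variation of the cost *)

Let Lx x q t := grad (L^~ (q t)) (x t).
Let Lv x q t := grad (L (x t)) (q t).
Let fx x eta t := grad (f^~ (law_at t eta)) (x t).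

Section first_variation.
Variables (x : V) (q : R -> E) (eta : PV) (c b : R -> R) (e : E) (D : R).
Hypotheses (sx : sobolev x) (xq : acd x q) (ceta : law_continuous eta).
Hypothesis xmin : forall y, sobolev y -> y 0 = x 0 ->
  (J L f g x eta <= J L f g y eta)%E.
Hypotheses (cc : continuous c) (cf : forall t, c t = c (clamp T t)).
Hypotheses (c0 : c 0 = 0) (c1 : forall t, `|c t| <= 1).
Hypotheses (ib : mu.-integrable I (EFin \o b)) (bD : forall t, `|b t| <= D).
Hypothesis cb : forall t, 0 <= t <= T -> c t = c 0 + \int[mu]_(s in `[0, t]) b s.
Hypothesis e1 : enorm e = 1.

Let ck k t := k.+1%:R^-1 * c t.
Let bk k t := k.+1%:R^-1 * b t.

Let ck_cont k : continuous (ck k).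
Proof. by move=> t; apply: cvgMl_tmp; exact: cc. Qed.

Let ck_frozen k t : ck k t = ck k (clamp T t).
Proof. by rewrite /ck -cf. Qed.

Let xk k : V := @bump x (ck k) e (@ck_cont k) (@ck_frozen k).
Let qk k t := q t + bk k t *: e.

Let xk_acd k : acd (xk k) (qk k).
Proof.
apply: bump_acd => //; first exact: RintegrableZ.
move=> t tT; rewrite /ck (cb tT) c0 mulr0 !add0r /bk RintegralZl//.
have /andP[t0 tT'] := tT; exact: (integrable_sub_itv (lexx 0) tT' ib).
Qed.

Let k1 k : 0 <= (k.+1%:R^-1 : R) <= 1.
Proof. by rewrite invr_ge0 ler0n/= invf_le1// ler1n. Qed.

Let D0 : 0 <= D.
Proof. exact: le_trans (normr_ge0 _) (bD 0). Qed.

Let xkE k t : xk k t = x t + k.+1%:R^-1 *: (c t *: e).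
Proof. by rewrite /xk/= scalerA. Qed.

Let qkE k t : qk k t = q t + k.+1%:R^-1 *: (b t *: e).
Proof. by rewrite /qk scalerA. Qed.

Let ce t : enorm (c t *: e) <= 1.
Proof. by rewrite enormZ e1 mulr1. Qed.

Let be t : enorm (b t *: e) <= D.
Proof. by rewrite enormZ e1 mulr1. Qed.

Let be' k t : enorm (k.+1%:R^-1 *: (b t *: e)) <= k.+1%:R^-1 * D.
Proof.
have /andP[h0 h1] := k1 k.
by rewrite enormZ (ger0_norm h0) ler_wpM2l.
Qed.

Let ce' k t : enorm (k.+1%:R^-1 *: (c t *: e)) <= k.+1%:R^-1.
Proof.
have /andP[h0 h1] := k1 k.
by rewrite enormZ (ger0_norm h0) ler_piMr.
Qed.

Let xk_sobolev k : sobolev (xk k).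
Proof.
apply/(sobolevP (xk_acd k)).
have mqk := ac_coord_measurable (xk_acd k).
have iq := sobolev_enorm2 xq sx.
have ig : mu.-integrable I (EFin \o (fun t => (2 + 2 * D ^+ 2) * (1 + enorm (q t) ^+ 2))).
  by apply: RintegrableZ => //; exact: one_enorm2_integrable.
apply: Rle_integrable ig => //; first exact: measurable_enorm2.
move=> t _; rewrite ger0_norm ?sqr_ge0//.
have : enorm (qk k t) <= enorm (q t) + D.
  rewrite qkE; apply: le_trans (enormD _ _) _; rewrite lerD2l.
  have /andP[h0 h1] := k1 k.
  by apply: le_trans (be' k t) _; rewrite ler_piMl.
have q0 := enorm_ge0 (q t); have qk0 := enorm_ge0 (qk k t).
move: (enorm (q t)) (enorm (qk k t)) q0 qk0 => a a' a0 a'0 h.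
have h2 : a' ^+ 2 <= (a + D) ^+ 2 by rewrite ler_sqr// nnegrE addr_ge0.
have := sqr_ge0 (a - D); have := sqr_ge0 (a * D); have := D0; nra.
Qed.

(* the difference quotient of the integrand and its limit *)
Let u k t := k.+1%:R * (L (xk k t) (qk k t) - L (x t) (q t)) +
  k.+1%:R * (f (xk k t) (law_at t eta) - f (x t) (law_at t eta)).

Let l t := dot (Lx x q t) (c t *: e) + dot (Lv x q t) (b t *: e) +
  dot (fx x eta t) (c t *: e).

(* the margin 1 holds all perturbations, as the profile c has values in [-1, 1] *)
Let r := sval (cid2 (path_bounded x)) + 1.

Let r0 : 0 < r.
Proof. by rewrite /r addr_gt0//; case: cid2. Qed.

Let xr t : enorm (x t) <= r.
Proof. by rewrite /r; case: cid2 => //= s s0 h; apply: le_trans (h t) _; rewrite lerDl. Qed.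

Let xkr k t : enorm (xk k t) <= r.
Proof.
rewrite xkE; apply: le_trans (enormD _ _) _; rewrite /r; case: cid2 => //= s s0 h.
rewrite lerD//; have /andP[h0 h1] := k1 k.
exact: le_trans (ce' k t) _.
Qed.

Let u_int k : mu.-integrable I (EFin \o u k).
Proof.
have i1 := L_path_integrable (xk k) (ac_coord_measurable (xk_acd k))
  (sobolev_enorm2 (xk_acd k) (xk_sobolev k)).
have i2 := L_path_integrable x (ac_coord_measurable xq) (sobolev_enorm2 xq sx).
have i3 := f_path_integrable (xk k) ceta.
have i4 := f_path_integrable x ceta.
by apply: RintegrableD => //; apply: RintegrableZ => //; exact: RintegrableB.
Qed.

Let u_dom : exists2 K : R, 0 < K & forall k t, `|u k t| <= K * (1 + enorm (q t) ^+ 2).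
Proof.
have [C1 C10 h1] := lag_x_lip Lstar r0.
have [C2 C20 h2] := lag_v_lip Lstar D r0.
have [C3 C30 h3] := fg_lip r0.
exists (C1 + C2 * D + C3); first by rewrite addr_gt0// ltr_pwDl// mulr_ge0// ltW.
move=> k t; have /andP[h0 h4] := k1 k.
have k0 : 0 < k.+1%:R :> R by rewrite ltr0n.
have xx : enorm (xk k t - x t) <= k.+1%:R^-1 by rewrite xkE addrC addKr ce'.
have q1 : 0 <= 1 + enorm (q t) ^+ 2 by rewrite addr_ge0// sqr_ge0.
set A := 1 + _ in q1 *.
have kk (y z : R) : z <= y * k.+1%:R^-1 -> k.+1%:R * z <= y.
  by move=> ?; rewrite mulrC -ler_pdivlMr.
have l1 : k.+1%:R * `|L (xk k t) (q t) - L (x t) (q t)| <= C1 * A.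
  apply: kk; apply: le_trans (h1 _ _ _ (xr t) (xkr k t)) _.
  by rewrite ler_wpM2l// mulr_ge0// ltW.
have l2 : k.+1%:R * `|L (xk k t) (qk k t) - L (xk k t) (q t)| <= C2 * D * A.
  apply: kk; rewrite qkE; apply: le_trans (h2 _ _ _ (xkr k t) _) _.
    by apply: le_trans (be' k t) _; rewrite ler_piMl.
  have -> : C2 * D * A * k.+1%:R^-1 = C2 * A * (k.+1%:R^-1 * D) by ring.
  by rewrite ler_wpM2l// mulr_ge0// ltW.
have l3 : k.+1%:R * `|f (xk k t) (law_at t eta) - f (x t) (law_at t eta)| <= C3 * A.
  apply: kk; have [h _] := h3 _ _ (law_at t eta) (xr t) (xkr k t).
  apply: le_trans h _; rewrite -mulrA ler_wpM2l ?(ltW C30)//.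
  by apply: le_trans xx _; rewrite ler_peMl// /A lerDl sqr_ge0.
rewrite /u !mulrDl; apply: le_trans (ler_normD _ _) _; apply: lerD.
  rewrite -(subrKA (L (xk k t) (q t))) mulrDr; apply: le_trans (ler_normD _ _) _.
  by rewrite addrC lerD// normrM (gtr0_norm k0).
by rewrite normrM (gtr0_norm k0).
Qed.

Let u_cvg t : u^~ t @ \oo --> l t.
Proof.
rewrite /u /l; apply: cvgD.
  under eq_fun do rewrite xkE qkE.
  exact: lag_quot_cvg.
under eq_fun do rewrite xkE.
exact: cvg_diff_quot (f_diff _ _).
Qed.

(** The difference quotients of the cost at a minimizer are nonnegative; they converge by dominated
    convergence, the quadratic growth of L_x and L_v giving the integrable bound. *)
Lemma first_variation_ge0 :
  mu.-integrable I (EFin \o l) /\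
  0 <= \int[mu]_(t in I) l t + dot (grad (g^~ (law_at T eta)) (x T)) (c T *: e).
Proof.
have [K K0 hK] := u_dom.
have ig : mu.-integrable I (EFin \o (fun t => K * (1 + enorm (q t) ^+ 2))).
  by apply: RintegrableZ => //; exact: one_enorm2_integrable (sobolev_enorm2 xq sx).
have [il cv] : mu.-integrable I (EFin \o l) /\
    \int[mu]_(t in I) u k t @[k --> \oo] --> \int[mu]_(t in I) l t.
  apply: Rdominated_convergence ig _ => //.
  by move=> k; have /measurable_int/measurable_EFinP := u_int k.
split => //.
have cg : k.+1%:R * (g (xk k T) (law_at T eta) - g (x T) (law_at T eta)) @[k --> \oo]
   --> dot (grad (g^~ (law_at T eta)) (x T)) (c T *: e).
  under eq_fun do rewrite xkE.
  exact: cvg_diff_quot (g_diff _ _).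
have cv2 : \int[mu]_(t in I) u k t +
    k.+1%:R * (g (xk k T) (law_at T eta) - g (x T) (law_at T eta)) @[k --> \oo]
   --> \int[mu]_(t in I) l t + dot (grad (g^~ (law_at T eta)) (x T)) (c T *: e).
  by apply: cvgD.
rewrite leNgt; apply/negP => neg.
have /filter_ex[k] := cvg_near_lt cv2 neg.
apply/negP; rewrite -leNgt /=.
have k0 : 0 < k.+1%:R :> R by rewrite ltr0n.
have := xmin (xk_sobolev k); rewrite xkE c0 scale0r scaler0 addr0 => /(_ erefl).
rewrite (J_integralE xq sx ceta) (J_integralE (xk_acd k) (xk_sobolev k) ceta).
rewrite lee_fin => hJ.
have i1 := integrand_integrable xq sx ceta.
have i2 := integrand_integrable (xk_acd k) (xk_sobolev k) ceta.
have -> : \int[mu]_(t in I) u k t = k.+1%:R *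
   (\int[mu]_(t in I) (L (xk k t) (qk k t) + f (xk k t) (law_at t eta)) -
    \int[mu]_(t in I) (L (x t) (q t) + f (x t) (law_at t eta))).
  rewrite -RintegralB// -RintegralZl//; last exact: RintegrableB.
  apply: eq_Rintegral => t _; rewrite /u -mulrDr; congr (_ * _); ring.
by rewrite -mulrDr mulr_ge0 ?(ltW k0)// addrACA -opprD subr_ge0.
Qed.

End first_variation.

(** * The Euler-Lagrange system *)

Lemma integrable_restr_cst (a : R) (s t : R) :
  mu.-integrable I (EFin \o ((fun=> a) \_ `[s, t])).
Proof.
have i1 : mu.-integrable I (EFin \o (fun=> `|a|)).
  exact: integrable_cst_itv.
apply: Rle_integrable i1 => //; last first.
  by move=> r _; rewrite patchE; case: ifP => // _; rewrite normr0.
apply: measurable_funTS; apply/(measurable_restrictT _ _).1 => //.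
Qed.

(** Test profile: its derivative is (k+1) times the indicator of [t0, t0 + 1/(k+1)], so that testing
    against it averages L_v over a shrinking interval. *)
Definition ramp (t0 : R) (k : nat) (s : R) : R :=
  Num.max 0 (Num.min 1 (k.+1%:R * (s - t0))).

Definition dramp (t0 : R) (k : nat) : R -> R :=
  (fun=> k.+1%:R : R) \_ `[t0, t0 + k.+1%:R^-1].

Lemma ramp_continuous t0 k : continuous (ramp t0 k).
Proof.
move=> s; rewrite /continuous_at/ramp.
apply: (@continuous_max _ _ (cst 0) (fun s => Num.min 1 (k.+1%:R * (s - t0)))).
  exact: cst_continuous.
apply: (@continuous_min _ _ (cst 1) (fun s => k.+1%:R * (s - t0))).
  exact: cst_continuous.
by apply: cvgMl_tmp; apply: cvgB; [exact: cvg_id|exact: cvg_cst].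
Qed.

Lemma ramp_itv t0 k s : 0 <= ramp t0 k s <= 1.
Proof.
rewrite /ramp le_max lexx/= ge_max ler01/= ge_min lexx//.
Qed.

Lemma ramp_le t0 k s : s <= t0 -> ramp t0 k s = 0.
Proof.
move=> h; rewrite /ramp; apply/max_idPl; rewrite ge_min; apply/orP; right.
by rewrite mulr_ge0_le0// subr_le0.
Qed.

Lemma ramp_ge t0 k s : t0 + k.+1%:R^-1 <= s -> ramp t0 k s = 1.
Proof.
move=> h; rewrite /ramp (min_idPl _) ?(max_idPr _)//.
by rewrite -ler_pdivrMl// mulr1 lerBrDl.
Qed.

Lemma ramp_frozen t0 k : 0 <= t0 -> t0 + k.+1%:R^-1 <= T ->
  forall s, ramp t0 k s = ramp t0 k (clamp T s).
Proof.
move=> t00 h s; rewrite /clamp.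
have [sT|sT] := leP s T.
  have [s0|s0] := leP 0 s => //.
  by rewrite !ramp_le// (le_trans (ltW s0)).
rewrite (max_idPr (ltW hT)) ramp_ge ?ramp_ge// (le_trans h)// ltW//.
Qed.

Lemma ramp_int t0 k t : 0 <= t0 -> 0 <= t <= T ->
  ramp t0 k t = ramp t0 k 0 + \int[mu]_(s in `[0, t]) dramp t0 k s.
Proof.
move=> t00 /andP[t1 tT]; rewrite (ramp_le _ t00) add0r /dramp.
rewrite -Rintegral_mkcondr.
have -> : `[0, t]%classic `&` `[t0, t0 + k.+1%:R^-1] =
   `[t0, Num.min t (t0 + k.+1%:R^-1)]%classic.
  apply/seteqP; split => s /=; rewrite !in_itv/= le_min.
    by move=> [/andP[_ ->] /andP[-> ->]].
  by move=> /andP[t0s /andP[st ->]]; rewrite t0s st (le_trans t00).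
have k0 : 0 < k.+1%:R :> R by rewrite ltr0n.
rewrite Rintegral_cst//= lebesgue_measure_itv/= lte_fin.
case: ifPn => h; last first.
  rewrite mulr0 ramp_le//; move: h; rewrite -leNgt ge_min => /orP[//|].
  by rewrite gerDl leNgt invr_gt0 k0.
have t0t : t0 < t by move: h; rewrite lt_min => /andP[].
rewrite -EFinB/=; have [tk|tk] := leP t (t0 + k.+1%:R^-1).
  rewrite /ramp (min_idPr _) ?(max_idPr _)//.
    by rewrite mulr_ge0 ?(ltW k0)// subr_ge0 ltW.
  by rewrite -ler_pdivlMl// mulr1 lerBlDl.
by rewrite ramp_ge 1?ltW// addrC addKr mulfV ?gt_eqF.
Qed.

Lemma cst_frozen (a t : R) : cst a t = cst a (clamp T t).
Proof. by []. Qed.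

Section integrable_gradients.
Variables (x : V) (q : R -> E) (eta : PV).
Hypotheses (mq : coord_measurable T q)
  (iq : mu.-integrable I (EFin \o (fun t => enorm (q t) ^+ 2))).
Hypothesis ceta : law_continuous eta.
Variable j : 'I_d.
Let e : E := delta_mx 0 j.

Let xk (k : nat) : V := @bump x (cst (k.+1%:R^-1 : R)) e (@cst_continuous R R _) (@cst_frozen _).

(** A gradient is a limit of difference quotients, hence measurable along a path. *)
Lemma gradx_integrable :
  mu.-integrable I (EFin \o (fun t => grad (L^~ (q t)) (x t) 0 j)).
Proof.
have [r r0 xr] := path_bounded x.
have [C C0 hC] := lag_grad_bound Lstar r0.
have ig : mu.-integrable I (EFin \o (fun t => C * (1 + enorm (q t) ^+ 2))).
  by apply: RintegrableZ => //; exact: one_enorm2_integrable.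
apply: Rle_integrable ig => //; last first.
  move=> t _; have [h _] := hC (x t) (q t) (xr t).
  exact: le_trans (coord_le_enorm _ _) h.
apply: (@measurable_fun_cvg _ _ _ _
  (fun k t => k.+1%:R * (L (xk k t) (q t) - L (x t) (q t)))).
  move=> k; apply: measurable_funM => //; apply: measurable_funB.
    exact: (measurable_comp_path (lag_continuous Lstar) (path_coord_measurable (xk k)) mq).
  exact: (measurable_comp_path (lag_continuous Lstar) (path_coord_measurable x) mq).
move=> t _; rewrite -[X in _ --> X](dot_delta (grad (L^~ (q t)) (x t))).
exact: (@cvg_diff_quot _ _ _ _ e (lag_diff_x Lstar (q t) (x t))).
Qed.

Lemma gradv_integrable :
  mu.-integrable I (EFin \o (fun t => grad (L (x t)) (q t) 0 j)).
Proof.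
have [r r0 xr] := path_bounded x.
have [C C0 hC] := lag_grad_bound Lstar r0.
have ig : mu.-integrable I (EFin \o (fun t => C * (1 + enorm (q t) ^+ 2))).
  by apply: RintegrableZ => //; exact: one_enorm2_integrable.
apply: Rle_integrable ig => //; last first.
  move=> t _; have [_ h] := hC (x t) (q t) (xr t).
  exact: le_trans (coord_le_enorm _ _) h.
apply: (@measurable_fun_cvg _ _ _ _
  (fun k t => k.+1%:R * (L (x t) (q t + k.+1%:R^-1 *: e) - L (x t) (q t)))).
  move=> k; apply: measurable_funM => //; apply: measurable_funB.
    have mqk : coord_measurable T (fun t => q t + k.+1%:R^-1 *: e).
      move=> i; rewrite (_ : (fun _ => _) =
        (fun s => q s 0 i + (k.+1%:R^-1 *: e) 0 i)); last first.
        by apply/funext => s; rewrite mxE.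
      by apply: measurable_funD => //; exact: mq.
    exact: (measurable_comp_path (lag_continuous Lstar) (path_coord_measurable x) mqk).
  exact: (measurable_comp_path (lag_continuous Lstar) (path_coord_measurable x) mq).
move=> t _; rewrite -[X in _ --> X](dot_delta (grad (L (x t)) (q t))).
exact: (@cvg_diff_quot _ _ _ _ e (lag_diff_v Lstar (x t) (q t))).
Qed.

Lemma gradf_integrable :
  mu.-integrable I (EFin \o (fun t => grad (f^~ (law_at t eta)) (x t) 0 j)).
Proof.
have [r r0 xr] := path_bounded x.
have [C C0 hC] := fg_grad_bound r0.
have ig : mu.-integrable I (EFin \o (fun=> C)).
  exact: integrable_cst_itv.
apply: Rle_integrable ig => //; last first.
  move=> t _; have [h _] := hC (x t) (law_at t eta) (xr t).
  exact: le_trans (coord_le_enorm _ _) h.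
apply: (@measurable_fun_cvg _ _ _ _
  (fun k t => k.+1%:R * (f (xk k t) (law_at t eta) - f (x t) (law_at t eta)))).
  move=> k; apply: measurable_funM => //; apply: measurable_funB.
    by have /measurable_int/measurable_EFinP := f_path_integrable (xk k) ceta.
  by have /measurable_int/measurable_EFinP := f_path_integrable x ceta.
move=> t _; rewrite -[X in _ --> X](dot_delta (grad (f^~ (law_at t eta)) (x t))).
exact: (@cvg_diff_quot _ _ _ _ e (f_diff (law_at t eta) (x t))).
Qed.

End integrable_gradients.

Section minimizer.
Variables (x : V) (q : R -> E) (eta : PV).
Hypotheses (sx : sobolev x) (xq : acd x q) (ceta : law_continuous eta).
Hypothesis xmin : forall y, sobolev y -> y 0 = x 0 ->
  (J L f g x eta <= J L f g y eta)%E.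

Let H j t := grad (L^~ (q t)) (x t) 0 j + grad (f^~ (law_at t eta)) (x t) 0 j.
Let A j t := grad (L (x t)) (q t) 0 j.
Let G j := grad (g^~ (law_at T eta)) (x T) 0 j.

Let mq := ac_coord_measurable xq.
Let iq := sobolev_enorm2 xq sx.

Let iH j : mu.-integrable I (EFin \o H j).
Proof.
apply: RintegrableD => //.
  by apply: gradx_integrable; [exact: mq|exact: iq].
exact: gradf_integrable.
Qed.

Let iA j : mu.-integrable I (EFin \o A j).
Proof. by apply: gradv_integrable; [exact: mq|exact: iq]. Qed.

(* the first variation along the ramp and along its opposite *)
Let weak_eq j (t0 : R) k : 0 <= t0 -> t0 + k.+1%:R^-1 <= T ->
  \int[mu]_(t in I) (H j t * ramp t0 k t) +
  k.+1%:R * \int[mu]_(t in `[t0, Num.min T (t0 + k.+1%:R^-1)]) A j t + G j = 0.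
Proof.
move=> t00 tk.
have k0 : 0 < k.+1%:R :> R by rewrite ltr0n.
have iramp : mu.-integrable I (EFin \o (fun t => H j t * ramp t0 k t)).
  have /measurable_int/measurable_EFinP mH := iH j.
  apply: Rle_integrable (integrable_norm (iH j)) => //.
    apply: measurable_funM => //; apply: measurable_funTS.
    by apply: continuous_measurable_fun; exact: ramp_continuous.
  move=> t _ /=; have /andP[r0 r1] := ramp_itv t0 k t.
  by rewrite normrM (ger0_norm r0) ler_piMr.
have idramp : mu.-integrable I (EFin \o (fun t => A j t * dramp t0 k t)).
  have /measurable_int/measurable_EFinP mA := iA j.
  have ig : mu.-integrable I (EFin \o (fun t => k.+1%:R * `|A j t|)).
    by apply: RintegrableZ => //; exact: integrable_norm.
  apply: Rle_integrable ig => //.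
    apply: measurable_funM => //.
    by have /measurable_int/measurable_EFinP := integrable_restr_cst k.+1%:R t0 (t0 + k.+1%:R^-1).
  move=> t _ /=; rewrite normrM mulrC ler_wpM2r// /dramp patchE; case: ifP => _.
    by rewrite ger0_norm.
  by rewrite normr0.
have intl : \int[mu]_(t in I) (H j t * ramp t0 k t + A j t * dramp t0 k t) =
  \int[mu]_(t in I) (H j t * ramp t0 k t) +
  k.+1%:R * \int[mu]_(t in `[t0, Num.min T (t0 + k.+1%:R^-1)]) A j t.
  rewrite RintegralD//; congr (_ + _).
  have -> : `[t0, Num.min T (t0 + k.+1%:R^-1)]%classic =
     I `&` `[t0, t0 + k.+1%:R^-1]%classic.
    apply/seteqP; split => s /=; rewrite !in_itv/= le_min.
      by move=> /andP[h1 /andP[h2 h3]]; rewrite h1 h2 h3 (le_trans t00 h1).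
    by move=> [/andP[_ ->] /andP[-> ->]].
  rewrite Rintegral_mkcondr -RintegralZl//.
    apply: eq_Rintegral => t _; rewrite /dramp !patchE; case: ifP => _.
      by rewrite mulrC.
    by rewrite !mulr0.
  rewrite -restrict_EFin; apply/(integrable_restrict _ _ _ _).1 => //.
  apply: integrableS (iA j) => //; first exact: measurableI.
have fv (s : R) : `|s| = 1 -> 0 <= s * (\int[mu]_(t in I) (H j t * ramp t0 k t) +
  k.+1%:R * \int[mu]_(t in `[t0, Num.min T (t0 + k.+1%:R^-1)]) A j t + G j).
  move=> s1.
  have bD t : `|dramp t0 k t| <= k.+1%:R.
    by rewrite /dramp patchE; case: ifP => _; rewrite ?normr0 ?ger0_norm.
  have c1 t : `|ramp t0 k t| <= 1.
    by have /andP[r0 r1] := ramp_itv t0 k t; rewrite ger0_norm.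
  have e1 : enorm (s *: delta_mx 0 j : E) = 1 by rewrite enormZ enorm_delta mulr1.
  have [il] := @first_variation_ge0 x q eta (ramp t0 k) (dramp t0 k)
    (s *: delta_mx 0 j) k.+1%:R sx xq ceta xmin (@ramp_continuous t0 k)
    (ramp_frozen t00 tk) (ramp_le _ t00) c1 (integrable_restr_cst _ _ _) bD
    (fun t => ramp_int k t00) e1.
  rewrite [X in X + _](_ : _ = \int[mu]_(t in I)
      (s * (H j t * ramp t0 k t + A j t * dramp t0 k t))); last first.
    apply: eq_Rintegral => t _; rewrite !dotZr !dot_delta /H /A; ring.
  rewrite RintegralZl//; last exact: RintegrableD.
  by rewrite intl (ramp_ge tk) scale1r dotZr dot_delta -/(G j) -mulrDr.
have := fv 1 (normr1 _); have := fv (-1) (normrN1 _).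
rewrite mul1r mulN1r oppr_ge0 => h1 h2.
by apply/eqP; rewrite eq_le h1 h2.
Qed.

(* the momentum predicted by the transversality condition and the weak equation *)
Let P j t := - G j - (\int[mu]_(s in I) H j s - \int[mu]_(s in `[0, t]) H j s).

(* as the ramp shrinks to the indicator of ]t, T], its derivative picks L_v at almost every t *)
Let du_bois_reymond j : {ae mu, forall t, 0 <= t < T -> A j t = P j t}.
Proof.
have := right_lebesgue_pt (iA j).
apply: (aeS mu) => t h /andP[t0 tT].
have {}h := h ltac:(by rewrite t0 tT).
have tT' : 0 < T - t by rewrite subr_gt0.
have small : \forall k \near \oo, t + k.+1%:R^-1 <= T.
  have /cvgrPdist_lt/(_ _ tT') := @cvg_harmonic R.
  apply: filterS => k; rewrite sub0r normrN gtr0_norm ?invr_gt0// => hk.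
  by rewrite -lerBrDl ltW.
have cvH : \int[mu]_(s in I) (H j s * ramp t k s) @[k --> \oo] -->
    \int[mu]_(s in I) ((H j \_ `]t, T]) s).
  have /measurable_int/measurable_EFinP mH := iH j.
  apply: (Rdominated_convergence _ _ _ (integrable_norm (iH j)) _).2 => //.
  - move=> k; apply: measurable_funM => //; apply: measurable_funTS.
    by apply: continuous_measurable_fun; exact: ramp_continuous.
  - move=> s; rewrite /= in_itv/= => /andP[s0 sT]; rewrite patchE.
    case: ifPn; rewrite ?inE ?notin_setE/= in_itv/= sT andbT => ts.
      have st : 0 < s - t by rewrite subr_gt0.
      have r1 : \forall k \near \oo, ramp t k s = 1.
        have /cvgrPdist_lt/(_ _ st) := @cvg_harmonic R.
        apply: (@filterS _ \oo _) => k; rewrite sub0r normrN gtr0_norm ?invr_gt0// => hk.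
        by rewrite ramp_ge// -lerBrDl ltW.
      apply: cvg_near_cst; apply: (@filterS _ \oo _) r1 => k /= ->; exact: mulr1.
    apply: cvg_near_cst; apply: nearW => k /=.
    by rewrite ramp_le ?mulr0// leNgt; apply/negP.
  - move=> k s _ /=; have /andP[r0 r1] := ramp_itv t k s.
    by rewrite normrM (ger0_norm r0) ler_piMr.
have cv : \int[mu]_(s in I) (H j s * ramp t k s) +
    k.+1%:R * \int[mu]_(s in `[t, Num.min T (t + k.+1%:R^-1)]) A j s + G j @[k --> \oo]
   --> \int[mu]_(s in I) ((H j \_ `]t, T]) s) + A j t + G j.
  exact: cvg_add_cst cvH h.
have cv0 : \int[mu]_(s in I) (H j s * ramp t k s) +
    k.+1%:R * \int[mu]_(s in `[t, Num.min T (t + k.+1%:R^-1)]) A j s + G j @[k --> \oo]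
   --> (0 : R).
  by apply: cvg_near_cst; apply: filterS small => k tk; exact: weak_eq.
have : \int[mu]_(s in I) ((H j \_ `]t, T]) s) + A j t + G j = 0.
  by apply: (cvg_unique (@Rhausdorff R) cv cv0).
rewrite -Rintegral_mkcondr.
have -> : I `&` `]t, T]%classic = `]t, T]%classic.
  apply/seteqP; split => s /=; rewrite !in_itv/=; first by case.
  move=> /andP[ts sT].
  by rewrite ts sT (le_trans t0 (ltW ts)).
have HB : \int[mu]_(s in I) H j s - \int[mu]_(s in `[0, t]) H j s =
    \int[mu]_(s in `]t, T]) H j s.
  by apply: Rintegral_itvB; rewrite ?bnd_simp ?(ltW tT)//; exact: iH.
rewrite /P HB => /eqP; rewrite -addrA addr_eq0 => /eqP ->.
by rewrite opprK [_ + G j]addrC addKr.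
Qed.

(* frozen outside [0, T] to be continuous on the whole line *)
Let p t : E := \row_j P j (clamp T t).

Let pE j t : p t 0 j = P j (clamp T t).
Proof. by rewrite mxE. Qed.

Let clampI t : I (clamp T t).
Proof.
rewrite /= in_itv/= /clamp le_max lexx/= ge_max (ltW hT)/= ge_min lexx orbT//.
Qed.

Let clamp_id t : I t -> clamp T t = t.
Proof.
rewrite /= in_itv/= /clamp => /andP[t0 tT].
by rewrite (min_idPl tT) (max_idPr t0).
Qed.

Let clamp_continuous : continuous (clamp T).
Proof.
move=> s; apply: (@continuous_max _ _ (cst 0) (fun s => Num.min s T)).
  exact: cst_continuous.
by apply: (@continuous_min _ _ id (cst T)); [exact: cvg_id|exact: cst_continuous].
Qed.

Let p_continuous : continuous p.
Proof.
have cP j : continuous (fun t => P j (clamp T t)).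
  move=> t; apply: cvgB; first exact: cvg_cst.
  apply: cvgB; first exact: cvg_cst.
  have cH := parameterized_integral_continuous (ltW hT) (iH j).
  move=> B nB; have := cH (clamp T t) B nB.
  rewrite /nbhs/= -nbhs_subspace_in; last exact: clampI.
  move=> h; apply: (@filterS _ (nbhs t) (nbhs_filter _)) (clamp_continuous h) => s /=.
  by apply; exact: clampI.
move=> t A0 /nbhs_ballP[e /= e0 eA].
have : \forall s \near t, forall j, ball (P j (clamp T t)) e (P j (clamp T s)).
  apply: (@filter_forall _ _ (fun j s => ball (P j (clamp T t)) e (P j (clamp T s)))
    (nbhs t) (nbhs_filter _)) => j.
  by apply: (cP j t); exact: nbhsx_ballx.
apply: (@filterS _ (nbhs t) (nbhs_filter _)) => s h; apply: eA; split => // i j.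
by rewrite !mxE; exact: h.
Qed.

(** The velocity is changed on a null set into the continuous solution v of L_v(x, v) = p, where the
    momentum p is the absolutely continuous function found by du Bois-Reymond's argument. *)
Lemma minimizer_euler_lagrange : exists2 v, euler_lagrange L f g eta x v &
  {ae mu, forall t, I t -> q t = v t}.
Proof.
have [v vE] := choice (fun t => lag_grad_surj Lstar (x t) (p t)).
have cv : continuous v.
  exact: (lag_inv_continuous Lstar (@cpath_cts _ _ _ x) p_continuous vE).
have qv : {ae mu, forall t, I t -> q t = v t}.
  have hA : {ae mu, forall t, forall j, 0 <= t < T -> A j t = P j t}.
    exact: (@filter_forall _ _ (fun j t => 0 <= t < T -> A j t = P j t) _
      (ae_filter_ringOfSetsType mu) du_bois_reymond).
  have : {ae mu, forall t, t != T}.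
    exists [set T]; split => //; first exact: lebesgue_measure_set1.
    by move=> t/= /negP; rewrite negbK => /eqP.
  move: hA; apply: (aeS2 mu) => t h tT It.
  apply: (lag_grad_inj Lstar (x := x t)); rewrite vE; apply/rowP => j.
  rewrite pE clamp_id// -h//.
  by move: It; rewrite /= in_itv/= => /andP[-> tT']; rewrite lt_neqAle tT tT'.
exists v => //.
have mv : coord_measurable T v.
  move=> i; apply: measurable_funTS; apply: continuous_measurable_fun => t.
  by apply: (@continuous_comp _ _ _ v (fun z : E => z 0 i)); [exact: cv|exact: coord_continuous].
have xv : acd x v.
  exact: ac_derivative_ae xq mv qv.
pose Hv j s := (grad (L^~ (v s)) (x s) + grad (f^~ (law_at s eta)) (x s)) 0 j.
have iHv j : mu.-integrable I (EFin \o Hv j).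
  have i1 := gradx_integrable x mv (sobolev_enorm2 xv sx) j.
  have i2 := gradf_integrable x ceta j.
  rewrite (_ : Hv j = fun s => grad (L^~ (v s)) (x s) 0 j +
     grad (f^~ (law_at s eta)) (x s) 0 j).
    exact: RintegrableD.
  by apply/funext => s; rewrite /Hv mxE.
have HHv j : {ae mu, forall t, I t -> H j t = Hv j t}.
  apply: (aeS mu) qv => t h It.
  by rewrite /H /Hv [RHS]mxE h.
have HE j t : 0 <= t <= T -> \int[mu]_(s in `[0, t]) H j s =
   \int[mu]_(s in `[0, t]) Hv j s.
  move=> /andP[t0 tT].
  have tI : `[0, t]%classic `<=` I by apply: subset_itv; rewrite bnd_simp.
  have /measurable_int/measurable_EFinP mHv := iHv j.
  by have [] := Rintegral_ae (measurable_itv _) tI (iH j) mHv (HHv j).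
split => //.
  move=> j; split; first exact: iHv.
  move=> t tT; rewrite !vE !pE -HE// !clamp_id;
    [|by rewrite /= in_itv/= lexx ltW|by rewrite /= in_itv].
  rewrite /P set_itv1 Rintegral_set1 subr0; ring.
apply/rowP => j; rewrite vE pE [RHS]mxE clamp_id; last by rewrite /= in_itv/= lexx ltW.
by rewrite /P subrr subr0.
Qed.

End minimizer.

(** The link between the unconstrained minimization of the play and the action sets of the game: the
    a priori bound on the speed is stronger than the energy bound. *)
Lemma minimizer_in_actions (m0 : PE) (M : R) x eta :
  a_priori_bound T L f g m0 M -> law_continuous eta ->
  enorm (x 0) <= sup [set enorm i | i in Defs.support m0] -> sobolev x ->
  (forall y, sobolev y -> y 0 = x 0 -> (J L f g x eta <= J L f g y eta)%E) ->
  actions M (x 0) x.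
Proof.
move=> [M0 hM] ceta x0 sx xmin.
have [v [xv el1 el2] _] := minimizer_euler_lagrange sx (velocityP sx) ceta xmin.
have [_ vM] := hM eta x v x0 (And3 xv el1 el2).
apply/(actionsP hT (x 0) M0 xv); split => //.
have iM : mu.-integrable I (EFin \o (fun=> M ^+ 2)).
  exact: integrable_cst_itv.
apply: (@le_trans _ _ (\int[mu]_(t in I) (M ^+ 2)%:E)%E).
  apply: ae_ge0_le_integral => //.
  - by move=> t _; rewrite lee_fin sqr_ge0.
  - by apply/measurable_EFinP; apply: measurable_enorm2; exact: ac_coord_measurable xv.
  - by move=> t _; rewrite lee_fin sqr_ge0.
  - apply: (aeS mu) vM => t h.
    rewrite /= in_itv/= => /h vt.
    by rewrite lee_fin ler_sqr ?nnegrE ?enorm_ge0// ltW.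
rewrite integral_cst//= lebesgue_measure_itv/= lte_fin hT -EFinD subr0 -EFinM.
by rewrite lee_fin mulrC.
Qed.

End cost.

(** * Integrals for probability measures *)

Lemma ae_bounded_integrable dS (S : measurableType dS) (R : realType)
    (Q : probability S R) (B : R) (h : S -> R) :
  measurable_fun setT h -> {ae Q, forall x, `|h x| <= B} ->
  Q.-integrable setT (EFin \o h).
Proof.
move=> mh hB; apply/integrableP; split; first exact/measurable_EFinP.
apply: (@le_lt_trans _ _ (\int[Q]_x `|B|%:E)%E).
  apply: ae_ge0_le_integral => //.
  - by apply: measurableT_comp => //; exact/measurable_EFinP.
  - apply: (aeS Q) hB => x h1 _.
    by rewrite /= lee_fin (le_trans h1)// ler_norm.
by rewrite integral_cst//= probability_setT mule1 ltry.
Qed.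

Lemma integrable_prob_cst dS (S : measurableType dS) (R : realType)
    (Q : probability S R) (c : R) : Q.-integrable setT (EFin \o (fun=> c)).
Proof.
by apply: (@ae_bounded_integrable _ _ _ _ `|c|) => //; apply: aeW => x; rewrite lexx.
Qed.

Section ae_Rintegral.
Context dS (S : measurableType dS) (R : realType) (mu : {measure set S -> \bar R}).
Implicit Types a b : S -> R.
Local Notation integrable a := (mu.-integrable setT (EFin \o a)).

Lemma ae_eq_Rintegral a b : integrable a -> integrable b ->
  {ae mu, forall s, a s = b s} -> \int[mu]_s a s = \int[mu]_s b s.
Proof.
move=> /measurable_int ma /measurable_int mb ab; rewrite /Rintegral; congr fine.
apply: ae_eq_integral => //.
by apply: (aeS mu) ab => s h _; rewrite h.
Qed.

Lemma ae_Rintegral_ge0 a : integrable a -> {ae mu, forall s, 0 <= a s} ->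
  0 <= \int[mu]_s a s.
Proof.
move=> ia a0; have /measurable_int/measurable_EFinP ma := ia.
have E : {ae mu, forall s, a s = `|a s|}.
  by apply: (aeS mu) a0 => s h; rewrite ger0_norm.
rewrite (@ae_eq_Rintegral _ (fun s => `|a s|))//; first exact: Rintegral_ge0.
exact: integrable_norm.
Qed.

Lemma ae_le_Rintegral a b : integrable a -> integrable b ->
  {ae mu, forall s, a s <= b s} -> \int[mu]_s a s <= \int[mu]_s b s.
Proof.
move=> ia ib ab; rewrite -subr_ge0 -RintegralB//.
apply: ae_Rintegral_ge0; first exact: RintegrableB.
by apply: (aeS mu) ab => s h; rewrite subr_ge0.
Qed.

Lemma ae_Rintegral_eq0 a : integrable a -> {ae mu, forall s, 0 <= a s} ->
  \int[mu]_s a s <= 0 -> {ae mu, forall s, a s = 0}.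
Proof.
move=> ia a0 int0; have /measurable_int/measurable_EFinP ma := ia.
have i0 : \int[mu]_s a s = 0.
  by apply/eqP; rewrite eq_le int0 ae_Rintegral_ge0.
have E : {ae mu, forall s, a s = `|a s|}.
  by apply: (aeS mu) a0 => s h; rewrite ger0_norm.
have n0 : (\int[mu]_s `|(a s)%:E| = 0)%E.
  transitivity (\int[mu]_s `|a s|)%:E; last first.
    by rewrite -(ae_eq_Rintegral ia _ E) ?i0//; exact: integrable_norm.
  by rewrite /Rintegral fineK//; apply: integrable_fin_num => //; exact: integrable_norm.
have := (ae_eq_integral_abs mu measurableT (measurable_int mu ia)).1 n0.
by apply: (aeS mu) => s /(_ I)[].
Qed.

End ae_Rintegral.

(** * The Monge-Kantorovich distance on a metric space *)

Section metric_borel.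
Context {R : realType} {X : ptopologicalType} (dist : X -> X -> R).

(** Keeps the metric separate from the topology: the Euclidean distance of R^d is not the distance
    that its canonical uniform structure comes from. *)
Definition metrizes := [/\ forall x, dist x x = 0,
  forall x y, dist x y = dist y x,
  forall x y z, dist x z <= dist x y + dist y z &
  forall x (A : set X), nbhs x A <-> exists2 e, 0 < e & forall y, dist x y < e -> A y].

Hypothesis md : metrizes.
Local Notation P := (Prob dist).
Implicit Types (mu nu : P) (F U : set X).

Lemma distxx x : dist x x = 0. Proof. by have [] := md. Qed.
Lemma distC x y : dist x y = dist y x. Proof. by have [_ h] := md. Qed.
Lemma dist_tri y x z : dist x z <= dist x y + dist y z.
Proof. by have [_ _ h] := md. Qed.

Lemma dist_ge0 x y : 0 <= dist x y.
Proof. by have := dist_tri y x x; rewrite distxx (distC y x); lra. Qed.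

Lemma lip_continuous (C : R) (h : X -> R) :
  (forall x y, `|h x - h y| <= C * dist x y) -> continuous h.
Proof.
move=> lh x; apply/(@cvgrPdist_lt _ _ _ (nbhs x) (nbhs_filter _)) => e e0.
have [_ _ _ nb] := md; apply/nb.
have C0 : 0 < `|C| + 1 by rewrite ltr_wpDl.
exists (e / (`|C| + 1)); first by rewrite divr_gt0.
move=> y; rewrite ltr_pdivlMr// => xy; apply: le_lt_trans (lh x y) _.
apply: le_lt_trans xy; rewrite mulrC ler_wpM2l ?dist_ge0//.
by apply: le_trans (ler_norm _) _; rewrite lerDl.
Qed.

Lemma lip_measurable (C : R) (h : X -> R) :
  (forall x y, `|h x - h y| <= C * dist x y) ->
  measurable_fun setT (h : borel X -> R).
Proof. by move=> /lip_continuous; exact: continuous_borel_measurable. Qed.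

Lemma lip1_measurable (h : X -> R) : lipschitz1 dist h ->
  measurable_fun setT (h : borel X -> R).
Proof. by move=> lh; apply: (@lip_measurable 1) => x y; rewrite mul1r. Qed.

Definition setdist F x : R := inf [set dist x y | y in F].

Lemma setdist_has_inf F x : F !=set0 -> has_inf [set dist x y | y in F].
Proof.
move=> [z Fz]; split; first by exists (dist x z); exists z.
by exists 0 => _ [y _ <-]; exact: dist_ge0.
Qed.

Lemma setdist_le F x y : F y -> setdist F x <= dist x y.
Proof.
move=> Fy; apply: ge_inf; last by exists y.
by exists 0 => _ [z _ <-]; exact: dist_ge0.
Qed.

Lemma setdist_ge0 F x : F !=set0 -> 0 <= setdist F x.
Proof.
move=> F0; apply: lb_le_inf; first by have [] := setdist_has_inf x F0.
by move=> _ [y _ <-]; exact: dist_ge0.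
Qed.

Lemma setdist_lip F : F !=set0 -> lipschitz1 dist (setdist F).
Proof.
move=> F0; suff h x y : setdist F x - setdist F y <= dist x y.
  by move=> x y; rewrite ler_norml h andbT lerNl opprB distC.
rewrite lerBlDl -lerBlDr; apply: lb_le_inf; first by have [] := setdist_has_inf y F0.
move=> _ [z Fz <-]; rewrite lerBlDr; apply: le_trans (setdist_le _ Fz) _.
by rewrite addrC; exact: dist_tri.
Qed.

Lemma setdist_eq0 F x : F x -> setdist F x = 0.
Proof.
move=> Fx; apply/eqP; rewrite eq_le setdist_ge0 ?andbT; last by exists x.
by rewrite -(distxx x); exact: setdist_le.
Qed.

Lemma setdist_gt0 F x : F !=set0 -> closed F -> ~ F x -> 0 < setdist F x.
Proof.
move=> F0 cF Fx; have [_ _ _ nb] := md.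
have : nbhs x (~` F) by apply: open_nbhs_nbhs; split => //; exact: closed_openC.
move=> /nb[e e0 he]; apply: (lt_le_trans e0).
apply: lb_le_inf; first by have [] := setdist_has_inf x F0.
by move=> _ [y Fy <-]; rewrite leNgt; apply/negP => /he.
Qed.

(** The integrals of a bounded function are finite, so that an extended-valued d_1 compares them. *)
Lemma d1_le0_lip_le mu nu (C B : R) (h : X -> R) : (d1 mu nu <= 0)%E -> 0 < C ->
  (forall x y, `|h x - h y| <= C * dist x y) -> (forall x, `|h x| <= B) ->
  \int[mu]_x h x <= \int[nu]_x h x.
Proof.
move=> d0 C0 lh hB; pose h' x := C^-1 * h x.
have lh' : lipschitz1 dist h'.
  move=> x y; rewrite /h' -mulrBr normrM gtr0_norm ?invr_gt0//.
  by rewrite ler_pdivrMl.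
have ih (m : P) : m.-integrable setT (EFin \o h).
  apply: (@ae_bounded_integrable _ _ _ _ B); first exact: lip_measurable lh.
  exact: aeW.
have E (m : P) : (\int[m]_x (h' x)%:E = (C^-1 * \int[m]_x h x)%:E)%E.
  rewrite EFinM /Rintegral fineK; last by apply: integrable_fin_num => //; exact: ih.
  by rewrite -integralZl//; exact: ih.
have := le_trans (d1_ub mu nu lh') d0.
rewrite !E -EFinB lee_fin -mulrBr pmulr_rle0 ?invr_gt0// subr_le0//.
Qed.

(** The indicator of an open set is the increasing limit of the Lipschitz functions
    min(1, n dist(x, complement)), and open sets generate the Borel sets. *)
Lemma d1_eq0_measure_eq mu nu : (d1 mu nu <= 0)%E -> measure_eq mu nu.
Proof.
move=> d0.
have openE U : open U -> mu U = nu U.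
  move=> oU; have [F0|/set0P F0] := eqVneq (~` U) set0.
    by rewrite -(setCK U) F0 setC0 !probability_setT.
  pose h n x := Num.min 1 (n%:R * setdist (~` U) x).
  have h01 n x : 0 <= h n x <= 1.
    by rewrite le_min ler01 mulr_ge0 ?setdist_ge0//= ge_min lexx.
  have hB n x : `|h n x| <= 1 by have /andP[h0 h1] := h01 n x; rewrite ger0_norm.
  have lh n x y : `|h n x - h n y| <= n.+1%:R * dist x y.
    have : `|n%:R * setdist (~` U) x - n%:R * setdist (~` U) y| <= n.+1%:R * dist x y.
      rewrite -mulrBr normrM ger0_norm//; apply: ler_pM => //; first by rewrite ler_nat.
      exact: setdist_lip.
    rewrite /h; move: (n%:R * _) (n%:R * _) => a b.
    move: (n.+1%:R * _) => c; rewrite !ler_norml => /andP[h1 h2].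
    by rewrite /Num.min; case: ifP; case: ifP; lra.
  have hU x : h ^~ x @ \oo --> (\1_U x : R).
    apply: cvg_near_cst; rewrite indicE.
    have [Ux|Ux] := boolP (x \in U); last first.
      apply: nearW => n; rewrite /h setdist_eq0 ?mulr0 ?min_r//.
      by rewrite notin_setE in Ux.
    have s0 : 0 < setdist (~` U) x.
      apply: setdist_gt0 => //; first exact: open_closedC.
      by move=> /=; apply; rewrite inE in Ux.
    near=> n; rewrite /h min_l// -ler_pdivrMr// mul1r.
    by near: n; exact: nbhs_infty_ger.
  have int1 (m : P) : m.-integrable setT (EFin \o (fun=> 1 : R)).
    apply: (@ae_bounded_integrable _ _ _ _ 1) => //; apply: aeW => x /=.
    by rewrite normr1 lexx.
  have cvm (m : P) : \int[m]_x h n x @[n --> \oo] --> fine (m U).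
    have [_] := Rdominated_convergence measurableT
      (fun n => lip_measurable (lh n)) (fun x _ => hU x) (int1 m) (fun n x _ => hB n x).
    rewrite [X in _ --> X](_ : _ = fine (m U))//.
    rewrite /Rintegral integral_indic ?setIT//.
    exact: sub_sigma_algebra.
  have lim_eq : fine (mu U) = fine (nu U).
    apply: (cvg_unique (@Rhausdorff R) (cvm mu)).
    rewrite (_ : (fun n => \int[mu]_x h n x) = (fun n => \int[nu]_x h n x)).
      exact: cvm.
    apply/funext => n; apply/eqP; rewrite eq_le.
    rewrite (d1_le0_lip_le d0 _ (lh n) (hB n))//=.
    by rewrite d1_sym in d0; rewrite (d1_le0_lip_le d0 _ (lh n) (hB n)).
  rewrite -[LHS]fineK ?lim_eq ?fineK//; apply: fin_num_measure; exact: sub_sigma_algebra.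
move=> A mA.
apply: (@g_sigma_algebra_measure_unique _ _ (borel X) open _ (fun=> setT)) => //.
- exact: sub_sigma_algebra.
- by move=> _; exact: openT.
- by rewrite bigcup_const//; exists 0%N.
- by move=> B C oB oC; exact: openI.
- by move=> n; rewrite [ltLHS]probability_setT ltry.
Unshelve. all: by end_near. Qed.

Lemma measure_eq_d1 mu nu : measure_eq mu nu -> (d1 mu nu <= 0)%E.
Proof.
move=> mn; apply: ge_ereal_sup => _ [h lh <-].
rewrite (@eq_measure_integral _ _ _ _ nu).
  by case: (\int[nu]_x (h x)%:E)%E => [r| |]//=; rewrite ?leNye// lee_fin subrr.
by move=> A mA _; exact: mn.
Qed.

(** A coupling on a common space bounds d_1; the bound B makes Lipschitz functions integrable. *)
Lemma d1_coupling dS (S : measurableType dS) (Q : probability S R)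
    (Phi Phi' : {mfun S >-> borel X}) (w : S -> R) (x0 : X) (B : R) :
  {ae Q, forall s, dist (Phi s) x0 <= B} -> {ae Q, forall s, dist (Phi' s) x0 <= B} ->
  Q.-integrable setT (EFin \o w) ->
  {ae Q, forall s, dist (Phi s) (Phi' s) <= w s} ->
  (d1 (distribution Q Phi : P) (distribution Q Phi' : P) <= (\int[Q]_s w s)%:E)%E.
Proof.
move=> bP bP' iw Pw; apply: ge_ereal_sup => _ [h lh <-].
have mh := lip1_measurable lh.
have ih (F : {mfun S >-> borel X}) : {ae Q, forall s, dist (F s) x0 <= B} ->
    Q.-integrable setT (EFin \o (fun s => h (F s))).
  move=> bF; apply: (@ae_bounded_integrable _ _ _ _ (`|h x0| + B)).
    exact: (measurableT_comp mh).
  apply: (aeS Q) bF => s h1.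
  rewrite -lerBlDl; apply: le_trans h1; apply: le_trans (lh _ _).
  exact: lerB_dist.
have i1 := ih _ bP; have i2 := ih _ bP'.
rewrite !integral_distribution//; try exact/measurable_EFinP.
have i12 : Q.-integrable setT (EFin \o (fun s => h (Phi s) - h (Phi' s))).
  exact: RintegrableB.
have E (a : S -> R) : Q.-integrable setT (EFin \o a) ->
    (\int[Q]_s (a s)%:E)%E = (\int[Q]_s a s)%:E.
  by move=> ia; rewrite /Rintegral fineK//; apply: integrable_fin_num.
rewrite (E (h \o Phi))// (E (h \o Phi'))// -EFinB lee_fin -RintegralB//.
apply: ae_le_Rintegral => //.
apply: (aeS Q) Pw => s h1.
by apply: le_trans h1; apply: le_trans (lh _ _); exact: ler_norm.
Qed.

End metric_borel.

(** * Finite mixtures of measures *)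

Section mixture.
Context dS (S : measurableType dS) (R : realType) (n : nat).
Variables (w : 'I_n -> R) (nu : 'I_n -> probability S R) (eta : probability S R).
Hypothesis w0 : forall k, 0 <= w k.
Hypothesis etaE : forall A, measurable A -> eta A = (\sum_k (w k)%:E * nu k A)%E.

Lemma mixture_ge0_integral (F : S -> \bar R) : measurable_fun setT F ->
  (forall s, 0 <= F s)%E ->
  (\int[eta]_s F s = \sum_k (w k)%:E * \int[nu k]_s F s)%E.
Proof.
move=> mF F0.
pose m_ (k : nat) : {measure set S -> \bar R} := if insub k is Some i
  then mscale (NngNum (w0 i)) (nu i) else mzero.
have mE (i : 'I_n) : m_ i = mscale (NngNum (w0 i)) (nu i) by rewrite /m_ valK.
rewrite (@eq_measure_integral _ _ _ _ (msum m_ n)); last first.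
  move=> A mA _; rewrite /msum [LHS]etaE//; apply: eq_bigr => i _.
  by rewrite mE /mscale/=.
rewrite ge0_integral_measure_sum//; apply: eq_bigr => i _.
by rewrite mE ge0_integral_mscale.
Qed.

Lemma mixture_ae (Q : S -> Prop) : (forall k, {ae nu k, forall s, Q s}) ->
  {ae eta, forall s, Q s}.
Proof.
move=> hQ.
have /choice[N hN] : forall k, exists N,
    [/\ measurable N, nu k N = 0 & ~` [set s | Q s] `<=` N].
  by move=> k; have [N] := hQ k; exists N.
exists (\bigcap_(k in setT) N k); split.
- apply: fin_bigcap_measurable => // k _; have [] := hN k; done.
- rewrite etaE; last by apply: fin_bigcap_measurable => // k _; have [] := hN k.
  rewrite big1// => k _; have [mN N0 _] := hN k.
  suff -> : nu k (\bigcap_(k in setT) N k) = 0%E by rewrite mule0.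
  apply: subset_measure0 N0 => //.
    by apply: fin_bigcap_measurable => // j _; have [] := hN j.
  exact: bigcap_inf.
- by move=> s Qs k _; have [_ _] := hN k; exact.
Qed.

Lemma mixture_integrable (F : S -> R) : measurable_fun setT F ->
  (forall k, (nu k).-integrable setT (EFin \o F)) ->
  eta.-integrable setT (EFin \o F) /\
  \int[eta]_s F s = \sum_k w k * \int[nu k]_s F s.
Proof.
move=> mF iF.
have mabs : measurable_fun setT (fun s => `|(F s)%:E|)%E.
  by apply: measurableT_comp => //; exact/measurable_EFinP.
have ieta : eta.-integrable setT (EFin \o F).
  apply/integrableP; split; first exact/measurable_EFinP.
  rewrite mixture_ge0_integral//.
  apply: lte_sum_pinfty => k _.
  have /integrableP[_ fk] := iF k.
  by rewrite lte_mul_pinfty ?lee_fin.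
split => //.
have parts (m : probability S R) : m.-integrable setT (EFin \o F) ->
   \int[m]_s F s = \int[m]_s (Num.max (F s) 0) - \int[m]_s (Num.max (- F s) 0).
  move=> im; rewrite -RintegralB//; last 2 first.
  - exact: integrable_funrpos.
  - exact: integrable_funrneg.
  apply: eq_Rintegral => s _; rewrite /Num.max; case: ifP; case: ifP; lra.
have nng (m : probability S R) (G : S -> R) : m.-integrable setT (EFin \o G) ->
    (\int[m]_s (G s)%:E)%E = (\int[m]_s G s)%:E.
  by move=> im; rewrite /Rintegral fineK//; exact: integrable_fin_num.
have ge0 (G : S -> R) : measurable_fun setT G -> (forall s, 0 <= G s) ->
  eta.-integrable setT (EFin \o G) -> (forall k, (nu k).-integrable setT (EFin \o G)) ->
  \int[eta]_s G s = \sum_k w k * \int[nu k]_s G s.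
  move=> mG G0 ie ik; apply/EFin_inj; rewrite -nng// mixture_ge0_integral//.
  - by rewrite -sumEFin; apply: eq_bigr => k _; rewrite nng.
  - exact/measurable_EFinP.
rewrite parts// ge0//.
- rewrite ge0//.
  + rewrite -sumrB; apply: eq_bigr => k _; rewrite -mulrBr -parts//.
  + exact: measurable_funrneg.
  + by move=> s; rewrite le_max lexx orbT.
  + exact: integrable_funrneg.
  + by move=> k; exact: (integrable_funrneg measurableT (iF k)).
- exact: measurable_funrpos.
- by move=> s; rewrite le_max lexx orbT.
- exact: integrable_funrpos.
- by move=> k; exact: (integrable_funrpos measurableT (iF k)).
Qed.

End mixture.

(** * Limits of measurable maps and semicontinuity of integrals *)

Section metric_borel2.
Context {R : realType} {X : ptopologicalType} (dist : X -> X -> R).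
Hypothesis md : metrizes dist.
Local Notation P := (Prob dist).

(** The distance to a closed set is a real function, so that the theorem on pointwise limits of real
    measurable functions applies to it. *)
Lemma measurable_limit dS (S : measurableType dS) (G : set S) (Phi : nat -> S -> X)
    (B : S -> X) (x0 : X) : measurable G ->
  (forall k, measurable_fun setT (Phi k : S -> borel X)) ->
  (forall s, G s -> dist (Phi k s) (B s) @[k --> \oo] --> 0) ->
  (forall s, ~ G s -> B s = x0) -> measurable_fun setT (B : S -> borel X).
Proof.
move=> mG mPhi cv B0.
apply: (@measurability _ _ S (borel X) setT _ open _ _) => //.
move=> _ [U oU <-]; rewrite setTI.
have [F0|/set0P F0] := eqVneq (~` U) set0.
  by rewrite -(setCK U) F0 setC0 preimage_setT.
have cF : closed (~` U) by exact: open_closedC.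
have m1 : measurable_fun G (fun s => setdist dist (~` U) (B s)).
  apply: (@measurable_fun_cvg _ _ _ _ (fun k s => setdist dist (~` U) (Phi k s))).
    move=> k; apply: measurable_funTS.
    exact: (measurableT_comp (lip1_measurable md (setdist_lip md F0)) (mPhi k)).
  move=> s Gs; apply/cvgrPdist_lt => e e0.
  have /cvgrPdist_lt/(_ _ e0) := cv s Gs; apply: filterS => k.
  rewrite sub0r normrN ger0_norm ?(dist_ge0 md)//; apply: le_lt_trans.
  by rewrite distrC; exact: (setdist_lip md F0).
have := m1 mG `]0, +oo[%classic (measurable_itv _) => m2.
rewrite (_ : B @^-1` U = (G `&` (fun s => setdist dist (~` U) (B s)) @^-1` `]0, +oo[) `|`
   (~` G `&` (fun s => x0) @^-1` U)).
  apply: measurableU => //; apply: measurableI; first exact: measurableC.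
  have [Ux|Ux] := pselect (U x0).
    by rewrite (_ : _ @^-1` U = setT)//; apply/seteqP; split.
  by rewrite (_ : _ @^-1` U = set0)//; apply/seteqP; split.
apply/seteqP; split => s /=.
  move=> Us; have [Gs|nG] := pselect (G s); [left|right]; split => //.
    by rewrite in_itv/= andbT; apply: (setdist_gt0 md F0 cF); apply.
  by rewrite -(B0 s nG).
move=> [[Gs]|[nG]]; last by rewrite (B0 s nG).
rewrite in_itv/= andbT => d0; apply: contrapT => nU.
by move: d0; rewrite (setdist_eq0 md) ?ltxx.
Qed.

Section yosida.
Variables (F : X -> \bar R).
Hypotheses (F0 : forall x, (0 <= F x)%E) (lF : lower_semicontinuous F).

Let G (m : nat) y : R := fine (Order.min (F y) m%:R%:E).

Let GE m y : (G m y)%:E = Order.min (F y) m%:R%:E.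
Proof.
rewrite /G fineK// fin_real//; apply/andP; split.
  by rewrite lt_min ltNyr andbT; exact: lt_le_trans (ltNyr 0) (F0 y).
by rewrite gt_min ltry orbT.
Qed.

Let G0 m y : 0 <= G m y.
Proof. by rewrite -lee_fin GE le_min F0 lee_fin ler0n. Qed.

(** The largest m-Lipschitz function below min(F, m). These functions increase to a lower
    semicontinuous F >= 0. *)
Definition infconv (m : nat) x : R := inf [set G m y + m%:R * dist x y | y in setT].

Let lb m x : lbound [set G m y + m%:R * dist x y | y in setT] 0.
Proof. by move=> _ [y _ <-]; rewrite addr_ge0// mulr_ge0// (dist_ge0 md). Qed.

Let ne m x : [set G m y + m%:R * dist x y | y in setT] !=set0.
Proof. by exists (G m x + m%:R * dist x x); exists x. Qed.

Let infconv_le m x y : infconv m x <= G m y + m%:R * dist x y.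
Proof. by apply: ge_inf; [exists 0; exact: lb|exists y]. Qed.

Lemma infconv_ge0 m x : 0 <= infconv m x.
Proof. by apply: lb_le_inf; [exact: ne|exact: lb]. Qed.

Lemma infconv_leF m x : ((infconv m x)%:E <= F x)%E.
Proof.
apply: (@le_trans _ _ (G m x)%:E); last by rewrite GE ge_min lexx.
by rewrite lee_fin; have := infconv_le m x x; rewrite (distxx md) mulr0 addr0.
Qed.

Lemma infconv_bound m x : `|infconv m x| <= m%:R.
Proof.
rewrite ger0_norm ?infconv_ge0//.
have := infconv_le m x x; rewrite (distxx md) mulr0 addr0 => /le_trans; apply.
by rewrite -lee_fin GE ge_min lexx orbT.
Qed.

Lemma infconv_lip m x y : `|infconv m x - infconv m y| <= m%:R * dist x y.
Proof.
suff h x' y' : infconv m x' - infconv m y' <= m%:R * dist x' y'.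
  by rewrite ler_norml h andbT lerNl opprB (distC md).
rewrite lerBlDl -lerBlDr; apply: lb_le_inf => [|_ [z _ <-]]; first exact: ne.
rewrite lerBlDr; apply: le_trans (infconv_le m x' z) _.
rewrite -addrA lerD2l addrC -mulrDr ler_wpM2l//; exact: dist_tri.
Qed.

Lemma infconv_nd x m n : (m <= n)%N -> infconv m x <= infconv n x.
Proof.
move=> mn; apply: lb_le_inf => [|_ [z _ <-]]; first exact: ne.
apply: le_trans (infconv_le m x z) _; apply: lerD.
  rewrite -lee_fin !GE le_min ge_min lexx/= ge_min lee_fin ler_nat mn orbT//.
by rewrite ler_wpM2r ?(dist_ge0 md)// ler_nat.
Qed.

Lemma infconv_cvg x : (infconv m x)%:E @[m --> \oo] --> F x.
Proof.
have nd : {homo (fun m => (infconv m x)%:E) : m n / (m <= n)%N >-> (m <= n)%E}.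
  by move=> m n mn; rewrite lee_fin infconv_nd.
have := ereal_nondecreasing_cvgn nd.
suff -> : ereal_sup (range (fun m => (infconv m x)%:E)) = F x by [].
apply/eqP; rewrite eq_le; apply/andP; split.
  by apply: ge_ereal_sup => _ [m _ <-]; exact: infconv_leF.
rewrite leNgt; apply/negP => supF.
have sup0 : (0 <= ereal_sup (range (fun m => (infconv m x)%:E)))%E.
  apply: (@le_trans _ _ (infconv 0 x)%:E); first by rewrite lee_fin infconv_ge0.
  by apply: ereal_sup_ubound; exists 0%N.
have [c supc cF] : exists2 c : R,
    (ereal_sup (range (fun m => (infconv m x)%:E)) < c%:E)%E & (c%:E < F x)%E.
  have := F0 x; move: sup0 supF.
  case: (ereal_sup _) => [r| |]; case: (F x) => [v| |] //=.
    move=> _; rewrite lte_fin => rv _; exists ((r + v) / 2); rewrite lte_fin.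
      by rewrite ltr_pdivlMr//; lra.
    by rewrite ltr_pdivrMr//; lra.
  by move=> _ _ _; exists (r + 1); rewrite ?ltry// lte_fin ltrDl.
have [W nW hW] := lF cF.
have [_ _ _ nb] := md; have [e e0 he] := (nb x W).1 nW.
have c0 : 0 < c by move: (le_lt_trans sup0 supc); rewrite lte_fin.
(* m is at least c, and a point at distance e or more pays at least c *)
pose m := (Num.truncn (c + c / e)).+1.
have mce : c + c / e < m%:R by rewrite /m; exact: truncnS_gt.
have ce0 : 0 < c / e by rewrite divr_gt0.
have mc : c <= m%:R by lra.
have me : c <= m%:R * e by rewrite -ler_pdivrMr//; lra.
have : c <= infconv m x.
  apply: lb_le_inf => [|_ [y _ <-]]; first exact: ne.
  have [xy|xy] := ltP (dist x y) e.
    apply: ler_wpDr; first by rewrite mulr_ge0// (dist_ge0 md).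
    by rewrite -lee_fin GE le_min lee_fin mc andbT ltW// hW//; exact: he.
  apply: ler_wpDl; first exact: G0.
  by apply: le_trans me _; rewrite ler_wpM2l.
apply/negP; rewrite -ltNge -lte_fin; apply: le_lt_trans supc.
by apply: ereal_sup_ubound; exists m.
Qed.

(** The integral of F is the supremum of those of its bounded Lipschitz minorants [infconv m], which
    are d_1-continuous. *)
Lemma lsc_integral_le (nu : P) (nuk : nat -> P) (a : nat -> R) (l : R) :
  (forall e, 0 < e -> \forall k \near \oo, (d1 nu (nuk k) <= e%:E)%E) ->
  (forall k, (\int[nuk k]_x F x <= (a k)%:E)%E) -> a @ \oo --> l ->
  (\int[nu]_x F x <= l%:E)%E.
Proof.
move=> dk Fa al.
have mG m : measurable_fun setT (infconv m : borel X -> R).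
  exact: (lip_measurable md (infconv_lip m)).
have iG m (xi : P) : xi.-integrable setT (EFin \o infconv m).
  apply: (@ae_bounded_integrable _ _ _ _ m%:R); first exact: mG.
  apply: aeW => x /=; exact: infconv_bound.
have mF : measurable_fun setT (F : borel X -> \bar R) by exact: lsc_borel_measurable.
have E m (xi : P) : (\int[xi]_x (infconv m x)%:E)%E = (\int[xi]_x infconv m x)%:E.
  by rewrite /Rintegral fineK//; apply: integrable_fin_num => //; exact: iG.
have Gl m : (\int[nu]_x (infconv m x)%:E <= l%:E)%E.
  rewrite E lee_fin; apply/ler_addgt0Pr => e e0.
  have m0 : 0 < m.+1%:R :> R by rewrite ltr0n.
  have e2 : 0 < e / 2 by rewrite divr_gt0.
  have n1 := dk (e / 2 / m.+1%:R) (divr_gt0 e2 m0).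
  have : l < l + e / 2 by rewrite ltrDl.
  move=> /(cvg_near_lt al) n2.
  have [k [/= dke ake]] := @filter_ex _ \oo _ _ (filterI n1 n2).
  pose h x := m.+1%:R^-1 * infconv m x.
  have lh : lipschitz1 dist h.
    move=> x y; rewrite /h -mulrBr normrM gtr0_norm ?invr_gt0//.
    rewrite ler_pdivrMl//; apply: le_trans (infconv_lip m x y) _.
    by rewrite ler_wpM2r ?(dist_ge0 md)// ler_nat.
  have Eh (xi : P) : (\int[xi]_x (h x)%:E = (m.+1%:R^-1 * \int[xi]_x infconv m x)%:E)%E.
    by rewrite EFinM -E -integralZl//; exact: iG.
  have := le_trans (d1_ub nu (nuk k) lh) dke.
  rewrite !Eh -EFinB lee_fin -mulrBr ler_pdivrMl// mulrC divfK ?gt_eqF// => h1.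
  have h2 : \int[nuk k]_x infconv m x <= a k.
    rewrite -lee_fin -E; apply: le_trans (Fa k); apply: ge0_le_integral => //.
    - by move=> x _; rewrite lee_fin infconv_ge0.
    - exact/measurable_EFinP.
    - by move=> x _; exact: infconv_leF.
  by rewrite [e]splitr; lra.
have : (\int[nu]_x (infconv m x)%:E)%E @[m --> \oo] --> (\int[nu]_x F x)%E.
  have := @cvg_monotone_convergence _ _ R nu setT measurableT (fun m x => (infconv m x)%:E).
  rewrite (_ : (fun x => limn _) = F); last first.
    by apply/funext => x; apply/cvg_lim => //; exact: infconv_cvg.
  apply.
  - by move=> n; apply/measurable_EFinP.
  - by move=> n x _; rewrite lee_fin infconv_ge0.
  - by move=> x _ m n mn; rewrite lee_fin infconv_nd.
move=> cv; rewrite -(cvg_lim _ cv)//; apply: lime_le.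
  by apply/cvg_ex; eexists; exact: cv.
by apply: nearW => m; exact: Gl.
Qed.

End yosida.
End metric_borel2.

(** * The distances of R^d and of paths *)

Section concrete_metrics.
Context {R : realType} {d : nat} {T : R}.
Local Notation E := 'rV[R]_d.

Lemma metrizes_eucl : metrizes (@eucl_dist R d).
Proof.
split.
- by move=> x; rewrite /eucl_dist subrr enorm0.
- by move=> x y; rewrite /eucl_dist enormB.
- by move=> x y z; rewrite /eucl_dist -(subrKA y); exact: enormD.
- move=> x A; split.
    move=> /nbhs_ballP[e /= e0 eA]; exists e => // y xy; apply: eA.
    by rewrite -ball_normE /=; apply: le_lt_trans xy; exact: norm_le_enorm.
  move=> [e e0 eA]; apply: (@filterS _ (nbhs x) (nbhs_filter _)) (near_enorm_lt x e0) => y /= xy.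
  by apply: eA; rewrite /eucl_dist enormB.
Qed.

Lemma metrizes_sup : metrizes (@supdist R T d).
Proof.
split.
- exact: supdistxx.
- exact: supdist_sym.
- by move=> x y z; exact: supdist_triangle.
- move=> x A; split.
    by move=> /nbhs_ballP[e /= e0 eA]; exists e.
  by move=> [e e0 eA]; apply/nbhs_ballP; exists e.
Qed.

(** The complement of the support is covered by the countably many null rational balls. *)
Lemma ae_support (m : Prob (@eucl_dist R d)) : {ae m, forall x, Defs.support m x}.
Proof.
pose N j : set E := if `[< m (rat_ball j) = 0%E >] then rat_ball j else set0.
have mball j : measurable (rat_ball j : set (borel E)).
  by apply: sub_sigma_algebra; exact: ball_open.
have mN j : measurable (N j : set (borel E)).
  by rewrite /N; case: asboolP => // _; exact: measurable0.
pose F k := if unpickle k is Some j then N j else set0.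
have : m.-negligible (\bigcup_k F k).
  apply: negligible_bigcup => k; rewrite /F; case: unpickle => [j|].
    rewrite /N; case: asboolP => j0; last exact: negligible_set0.
    by exists (rat_ball j); split.
  exact: negligible_set0.
apply: negligibleS.
move=> x /= nx; apply: contrapT => xN; apply: nx => U oU Ux.
have [j [jx jU]] := rat_ball_base (open_nbhs_nbhs (conj oU Ux)).
have : (0 < m (rat_ball j))%E.
  rewrite lt0e measure_ge0 andbT; apply/eqP => j0; apply: xN; exists (pickle j) => //.
  by rewrite /F pickleK /N; case: asboolP.
move/lt_le_trans; apply; apply: le_measure => //; rewrite inE//.
exact: sub_sigma_algebra.
Qed.

End concrete_metrics.

(** * Measures in the closed convex hull *)

Lemma integral_distribution_measurable dS (S : measurableType dS) d' (S' : measurableType d')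
    (R : realType) (Q : probability S R) (Y : {mfun S >-> S'}) (h : S' -> \bar R) :
  measurable_fun setT h ->
  (\int[distribution Q Y]_y h y = \int[Q]_s h (Y s))%E.
Proof.
move=> mh; rewrite integralE [RHS]integralE.
congr (_ - _)%E.
  rewrite ge0_integral_distribution//; last exact: measurable_funepos.
  by apply: eq_integral => s _; rewrite /= !funeposE.
rewrite ge0_integral_distribution//; last exact: measurable_funeneg.
by apply: eq_integral => s _; rewrite /= !funenegE.
Qed.

Lemma ae_distribution dS (S : measurableType dS) d' (S' : measurableType d')
    (R : realType) (Q : probability S R) (Y : {mfun S >-> S'}) (A : set S') :
  measurable A -> {ae Q, forall s, A (Y s)} -> {ae distribution Q Y, forall y, A y}.
Proof.
move=> mA QA; exists (~` A); split => //; first exact: measurableC.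
have [N [mN N0 NA]] := QA.
apply: (subset_measure0 _ _ _ N0) => //.
rewrite -[X in measurable X]setTI; apply: measurable_funP => //.
exact: measurableC.
Qed.

Lemma ae_ex dS (S : measurableType dS) (R : realType) (Q : probability S R)
    (A : S -> Prop) : {ae Q, forall s, A s} -> exists s, A s.
Proof.
move=> [N [mN N0 NA]]; apply: contrapT => nA.
have NT : N = setT.
  by apply/seteqP; split => // s _; apply: NA => As; apply: nA; exists s.
by move: N0; rewrite NT probability_setT => /eqP; rewrite onee_eq0.
Qed.

Lemma Rintegral_prob_cst dS (S : measurableType dS) (R : realType)
    (Q : probability S R) (c : R) : \int[Q]_s c = c.
Proof. by rewrite /Rintegral integral_cst//= probability_setT mule1. Qed.

Lemma ae_measure_le dS (S : measurableType dS) (R : realType)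
    (Q : probability S R) (A B : set S) : measurable A -> measurable B ->
  {ae Q, forall s, A s -> B s} -> (Q A <= Q B)%E.
Proof.
move=> mA mB [N [mN N0 NAB]].
apply: (@le_trans _ _ (Q (B `|` N))).
  apply: le_measure; rewrite ?inE//; first exact: measurableU.
  move=> s As; have [Bs|nB] := pselect (B s); [by left|right].
  by apply: NAB => /(_ As).
apply: le_trans (measureU2 _ mB mN) _.
by rewrite -[leRHS]adde0 leeD// -[leRHS]N0.
Qed.

Lemma ae_measure_eq dS (S : measurableType dS) (R : realType)
    (Q : probability S R) (A B : set S) : measurable A -> measurable B ->
  {ae Q, forall s, A s <-> B s} -> Q A = Q B.
Proof.
move=> mA mB h; apply/eqP; rewrite eq_le; apply/andP; split; apply: ae_measure_le => //.
  by apply: (aeS Q) h => s [].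
by apply: (aeS Q) h => s [].
Qed.

Lemma measurable_preimage_mfun dS (S : measurableType dS) dS' (S' : measurableType dS')
  (Y : {mfun S >-> S'}) A : measurable A -> measurable (Y @^-1` A).
Proof. by move=> mA; rewrite -[X in measurable X]setTI; exact: measurable_funP. Qed.

Section laws.
Context {R : realType} {d : nat} {T : R} (hT : 0 < T).
Local Notation mu := (@lebesgue_measure R).
Local Notation E := 'rV[R]_d.
Local Notation V := (@cpath R T d).
Local Notation I := (`[0, T]%classic : set R).
Local Notation PE := (Prob (@eucl_dist R d)).
Local Notation PV := (Prob (@supdist R T d)).
Variables (m0 : PE) (M : R).
Hypotheses (M0 : 0 < M) (hstar_i : star_i m0) (h_i : cond_i d T M).
Implicit Types (x y : V) (eta xi : PV).
Local Notation profile := {mfun borel E >-> borel V}.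

(** Evaluation at t is 1-Lipschitz on paths. *)
Lemma law_at_lip t eta xi : (d1 (law_at t eta) (law_at t xi) <= d1 eta xi)%E.
Proof.
apply: ge_ereal_sup => _ [h lh <-].
have mh : measurable_fun setT (EFin \o h : borel E -> \bar R).
  by apply/measurable_EFinP; exact: (lip1_measurable metrizes_eucl).
rewrite /law_at !(integral_distribution_measurable _ _ mh).
apply: (@d1_ub _ _ _ eta xi (fun x : V => h (x t))) => x y.
by apply: le_trans (lh _ _) _; exact: supdist_ub.
Qed.

(** Carries all the distributions of the game. Unlike a single action set it does not depend on the
    player, and it is still closed and bounded. *)
Definition feasible : set V := [set x : V | Defs.support m0 (x 0) /\ actions M (x 0) x].

Lemma eval0_continuous : continuous (fun x : V => x 0 : E).
Proof. exact: continuous_eval_at. Qed.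

Lemma feasible_closed : closed feasible.
Proof.
have cS : closed (Defs.support m0 : set E).
  apply: compact_closed; [exact: norm_hausdorff|exact: hstar_i].
have [_ cA _] := h_i.
have c1 : closed [set x : V | Defs.support m0 (x 0)].
  by apply: (closed_comp _ cS) => x _; exact: eval0_continuous.
have c2 : closed [set x : V | actions M (x 0) x].
  apply: (@closed_comp _ _ (fun x : V => (x 0, x)) _ _ cA) => x _.
  move=> A [[P Q] /= [hP hQ] PQ].
  have h1 : nbhs x ((fun y : V => y 0 : E) @^-1` P) := eval0_continuous hP.
  apply: (@filterS _ (nbhs x) (nbhs_filter _) _ _ _ (filterI h1 hQ)) => y [Py Qy].
  by apply: (PQ (y 0, y)); split.
exact: closedI.
Qed.

Lemma feasible_measurable : measurable (feasible : set (borel V)).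
Proof.
rewrite -(setCK feasible); apply: measurableC; apply: sub_sigma_algebra.
exact: closed_openC feasible_closed.
Qed.

(** A Young inequality in place of the Cauchy-Schwarz bound sqrt(t - s): linear in t - s once rho
    is fixed, and small if rho is. *)
Lemma actions_modulus x i (rho s t : R) : actions M i x -> 0 < rho ->
  0 <= s -> s <= t -> t <= T ->
  enorm (x t - x s) <= d%:R * ((t - s) / (2 * rho) + rho / 2 * (T * M ^+ 2)).
Proof.
move=> [sx x0 hx] r0 s0 st tT.
have xq := velocityP sx; set q := velocity x in xq.
have iq := sobolev_enorm2 xq sx.
have [_ {}hx] := (actionsP hT i M0 xq).1 (And3 sx x0 hx).
apply: le_trans (enorm_le_sum _) _.
have -> : d%:R * ((t - s) / (2 * rho) + rho / 2 * (T * M ^+ 2)) =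
    \sum_(i < d) ((t - s) / (2 * rho) + rho / 2 * (T * M ^+ 2)).
  by rewrite sumr_const card_ord mulr_natl.
apply: ler_sum => j _; rewrite !mxE (ac_derivative_sub j xq s0 st tT).
have iqj : mu.-integrable I (EFin \o (fun r => q r 0 j)) by have [] := xq j.
have sub : `[s, t]%classic `<=` I by apply: subset_itv; rewrite bnd_simp.
have iqs := integrable_sub_itv s0 tT iqj.
have iqs2 := integrable_sub_itv s0 tT iq.
have i1 : mu.-integrable `[s, t] (EFin \o (fun=> 1 / (2 * rho))).
  exact: integrable_cst_itv.
have i2 : mu.-integrable `[s, t] (EFin \o (fun r => rho / 2 * enorm (q r) ^+ 2)).
  exact: RintegrableZ.
apply: le_trans (le_normr_Rintegral _ iqs) _ => //.
apply: (@le_trans _ _ (\int[mu]_(r in `[s, t]) (1 / (2 * rho) + rho / 2 * enorm (q r) ^+ 2))).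
  apply: le_Rintegral => //.
  - exact: integrable_norm.
  - exact: RintegrableD.
  - move=> r _; apply: le_trans (coord_le_enorm _ _) _.
    have := sqr_ge0 (rho * enorm (q r) - 1).
    rewrite -subr_ge0 => h; rewrite -subr_ge0.
    have -> : 1 / (2 * rho) + rho / 2 * enorm (q r) ^+ 2 - enorm (q r) =
       ((rho * enorm (q r) - 1) ^+ 2 - 0) / (2 * rho).
      by field; rewrite gt_eqF.
    by rewrite divr_ge0// mulr_ge0// ltW.
rewrite RintegralD// RintegralZl//; apply: lerD.
  rewrite Rintegral_cst//.
  have lst : mu `[s, t] = (t - s)%:E.
    rewrite (lebesgue_measure_itv `[s, t])/= lte_fin; case: ltP => // ts.
    by have -> : t = s; [apply/eqP; rewrite eq_le ts st|rewrite subrr].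
  set a := fine _; have -> : a = t - s by exact: (congr1 fine lst).
  by rewrite le_eqVlt; apply/orP; left; apply/eqP => /=; field; rewrite gt_eqF.
rewrite ler_wpM2l ?divr_ge0 ?(ltW r0)//.
rewrite -lee_fin /Rintegral fineK; last by apply: integrable_fin_num.
apply: le_trans hx; apply: ge0_subset_integral => //.
  by apply/measurable_EFinP; apply: measurable_enorm2; exact: ac_coord_measurable xq.
by move=> r _; rewrite lee_fin sqr_ge0.
Qed.

Lemma path_frozen_le x y (B : R) :
  (forall t, 0 <= t <= T -> eucl_dist (x t) (y t) <= B) -> supdist x y <= B.
Proof.
move=> h; apply: supdist_le => t; rewrite cpath_frozen (cpath_frozen y).
apply: h; rewrite /clamp le_max lexx/= ge_max (ltW hT)/= ge_min lexx orbT//.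
Qed.

Lemma support_bounded : exists B : R, forall i, Defs.support m0 i -> enorm i <= B.
Proof.
have /compact_bounded[B [_ /(_ (B + 1))]] := hstar_i.
rewrite ltrDl ltr01 => /(_ isT) hB; exists (d%:R * (B + 1)) => i /hB iB.
by apply: le_trans (enorm_le_norm _) _; rewrite ler_wpM2l.
Qed.

Lemma support_sup i : Defs.support m0 i -> enorm i <= sup [set enorm i | i in Defs.support m0].
Proof.
move=> si; apply: ub_le_sup; last by exists i.
by have [B hB] := support_bounded; exists B => _ [j /hB jB <-].
Qed.

Lemma feasible_bounded : exists2 B : R, 0 < B & forall x, feasible x ->
  supdist x (cst_cpath T 0) <= B.
Proof.
have [B hB] := support_bounded.
exists (`|B| + d%:R * (T / 2 + 1 / 2 * (T * M ^+ 2)) + 1).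
  rewrite ltr_wpDl// addr_ge0// mulr_ge0// addr_ge0 ?divr_ge0 ?(ltW hT)//.
  by rewrite !mulr_ge0 ?sqr_ge0// ltW.
move=> x [/hB x0 ax]; apply: path_frozen_le => t /andP[t0 tT].
rewrite /eucl_dist/= /cst subr0 -[x t](subrK (x 0)).
apply: le_trans (enormD _ _) _.
have h := actions_modulus ax ltr01 (lexx 0) t0 tT.
have h2 : d%:R * ((t - 0) / (2 * 1) + 1 / 2 * (T * M ^+ 2)) <=
   d%:R * (T / 2 + 1 / 2 * (T * M ^+ 2)).
  by rewrite ler_wpM2l// lerD2r subr0 mulr1 ler_pdivrMr// divfK.
have := ler_norm B; lra.
Qed.

Lemma law_PG (Psi : profile) : admissible m0 M Psi -> PG m0 M (law m0 Psi).
Proof. by exists Psi. Qed.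

Lemma hull_covPG xi : convex_hull (PG m0 M) xi -> covPG m0 M xi.
Proof. exact: subset_closure. Qed.

Lemma PG_covPG xi : PG m0 M xi -> covPG m0 M xi.
Proof.
move=> h; apply: hull_covPG; exists 1%N, (fun=> 1), (fun=> xi); split => //.
- by rewrite big_ord1.
- by move=> A mA; rewrite big_ord1 mul1e.
Qed.

Lemma covPG_approx eta (e : R) : covPG m0 M eta -> 0 < e ->
  exists2 xi, convex_hull (PG m0 M) xi & (d1 eta xi < e%:E)%E.
Proof.
move=> ceta e0; have [xi [hxi bxi]] := ceta _ (nbhsx_ballx eta e e0).
by exists xi.
Qed.

Lemma PG_feasible xi : PG m0 M xi -> {ae xi, forall x, feasible x}.
Proof.
move=> [Psi aPsi xiE].
have : {ae law m0 Psi, forall x, feasible x}.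
  apply: ae_distribution; first exact: feasible_measurable.
  have aS := ae_support m0.
  apply: (aeS2 m0) aPsi aS => i ai si.
  by have [_ i0 _] := ai; split; rewrite i0.
move=> [N [mN N0 NG]]; exists N; split => //.
by rewrite (xiE N mN).
Qed.

Lemma hull_feasible xi : convex_hull (PG m0 M) xi -> {ae xi, forall x, feasible x}.
Proof.
move=> [n [w [nu [w0 w1 Pnu xiE]]]].
by apply: (mixture_ae xiE) => k; exact: PG_feasible.
Qed.

(** The set of feasible paths is closed, so min(1, distance to it) vanishes exactly on it; this
    function is 1-Lipschitz and has zero integral on the hull, hence on its d_1-closure. *)
Lemma covPG_feasible eta : covPG m0 M eta -> {ae eta, forall x, feasible x}.
Proof.
move=> ceta.
have G0 : feasible !=set0.
  by have [xi /hull_feasible/ae_ex[x Gx] _] := covPG_approx ceta ltr01; exists x.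
have cG : closed feasible by exact: feasible_closed.
pose sd := setdist (@supdist R T d) feasible.
have sd0 x : 0 <= sd x := setdist_ge0 metrizes_sup x G0.
pose h x := Num.min 1 (sd x).
have lh : lipschitz1 (@supdist R T d) h.
  move=> x y; have := setdist_lip metrizes_sup G0 x y; rewrite -/(sd x) -/(sd y) /h.
  rewrite !ler_norml => /andP[h1 h2]; have := supdist_ge0 x y.
  by rewrite /Num.min; case: ifP; case: ifP; lra.
have h0 x : 0 <= h x by rewrite le_min ler01 sd0.
have mh := lip1_measurable metrizes_sup lh.
have ih (m : PV) : m.-integrable setT (EFin \o h).
  apply: (@ae_bounded_integrable _ _ _ _ 1) => //.
  by apply: aeW => x; rewrite ger0_norm// ge_min lexx.
have EI (m : PV) : (\int[m]_x (h x)%:E)%E = (\int[m]_x h x)%:E.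
  by rewrite /Rintegral fineK//; apply: integrable_fin_num => //; exact: ih.
have inth : \int[eta]_x h x <= 0.
  apply/ler_addgt0Pr => e e0.
  have [xi hxi dxi] := covPG_approx ceta e0.
  have := le_trans (d1_ub eta xi lh) (ltW dxi).
  rewrite !EI -EFinB lee_fin.
  suff -> : \int[xi]_x h x = 0 by lra.
  rewrite (@ae_eq_Rintegral _ _ _ xi _ (fun=> 0)) ?Rintegral_prob_cst//.
  - exact: ih.
  - exact: integrable_prob_cst.
  - apply: (aeS xi) (hull_feasible hxi) => x Gx.
    by rewrite /h /sd (setdist_eq0 metrizes_sup Gx) min_r.
have : {ae eta, forall x, h x = 0}.
  by apply: ae_Rintegral_eq0 inth; [exact: ih|exact: aeW].
apply: (aeS eta) => x hx0.
apply: contrapT => /(setdist_gt0 metrizes_sup G0 cG); rewrite -/(sd x) => sx.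
by move: hx0; rewrite /h /Num.min; case: ifP => _ h2; move: sx; rewrite -?h2; lra.
Qed.

Lemma PG_initial_law xi : PG m0 M xi -> measure_eq (law_at 0 xi) m0.
Proof.
move=> [Psi aPsi xiE] A mA.
have mA0 : measurable ((eval_at 0 : borel V -> borel E) @^-1` A).
  exact: measurable_preimage_mfun.
etransitivity; first exact: (xiE _ mA0).
apply: (ae_measure_eq (Q := m0)) => //; first exact: measurable_preimage_mfun.
apply: (aeS m0) aPsi => i [_ i0 _].
by rewrite /= /eval_at i0.
Qed.

Lemma hull_initial_law xi : convex_hull (PG m0 M) xi -> measure_eq (law_at 0 xi) m0.
Proof.
move=> [n [w [nu [w0 w1 Pnu xiE]]]] A mA.
have mA0 : measurable ((eval_at 0 : borel V -> borel E) @^-1` A).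
  exact: measurable_preimage_mfun.
transitivity (xi ((eval_at 0 : borel V -> borel E) @^-1` A)); first by [].
rewrite xiE//.
transitivity (\sum_k (w k)%:E * m0 A)%E.
  by apply: eq_bigr => k _; congr (_ * _)%E; exact: (PG_initial_law (Pnu k) mA).
by rewrite -ge0_sume_distrl ?sumEFin ?w1 ?mul1e// => k _; rewrite lee_fin.
Qed.

(** The first marginal is d_1-continuous and equal to m_0 on the hull. *)
Lemma covPG_initial_law eta : covPG m0 M eta -> measure_eq (law_at 0 eta) m0.
Proof.
move=> ceta; apply: (d1_eq0_measure_eq metrizes_eucl).
apply/lee_addgt0Pr => e e0; rewrite add0e.
have [xi hxi dxi] := covPG_approx ceta e0.
apply: le_trans (d1_triangle (law_at 0 xi) _ _) _.
rewrite -[e%:E]adde0; apply: leeD.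
  by apply: le_trans (law_at_lip _ _ _) _; exact: ltW.
by apply: measure_eq_d1; exact: hull_initial_law.
Qed.

Lemma covPG_ae_initial eta (Q : E -> Prop) : covPG m0 M eta ->
  {ae m0, forall i, Q i} -> {ae eta, forall x, Q (x 0)}.
Proof.
move=> ceta [N [mN N0 NQ]].
exists ((eval_at 0 : borel V -> borel E) @^-1` N); split.
- exact: measurable_preimage_mfun.
- by rewrite -N0 -(covPG_initial_law ceta mN).
- by move=> x /= nQ; apply: NQ.
Qed.

Lemma covPG_integral_initial eta (h : E -> \bar R) : covPG m0 M eta ->
  measurable_fun setT (h : borel E -> \bar R) ->
  (\int[eta]_x h ((x : V) 0%R) = \int[m0]_i h i)%E.
Proof.
move=> ceta mh.
rewrite -(@eq_measure_integral _ _ _ setT m0 (law_at 0 eta)).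
  by rewrite /law_at (integral_distribution_measurable _ _ mh).
by move=> A mA _; exact: (covPG_initial_law ceta mA).
Qed.

(** The carried paths are equicontinuous. *)
Lemma covPG_law_continuous eta : covPG m0 M eta -> law_continuous eta.
Proof.
move=> ceta; have aG := covPG_feasible ceta.
have [B B0 hB] := feasible_bounded.
have D0 : 0 <= d%:R * (1 / 2 * (T * M ^+ 2)).
  by rewrite !mulr_ge0 ?(ltW hT) ?(ltW M0).
have bnd t : {ae eta, forall x : V, eucl_dist (eval_at t x) 0 <= B}.
  apply: (aeS eta) aG => x Gx.
  apply: le_trans (hB x Gx).
  exact: (supdist_ub x (cst_cpath T 0) t).
(* rho makes the error term of the modulus at most e / 4, then r makes its linear term at most e
   / 2 *)
have key e : 0 < e -> exists2 r, 0 < r & forall s t, 0 <= s -> s <= t -> t <= T ->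
    t - s < r -> (d1 (law_at s eta) (law_at t eta) < e%:E)%E.
  move=> e0; pose rho := e / (4 * (d%:R * (1 / 2 * (T * M ^+ 2)) + 1)).
  have rho0 : 0 < rho by rewrite divr_gt0// mulr_gt0// ltr_wpDl.
  have rhoE : rho * (d%:R * (1 / 2 * (T * M ^+ 2))) <= e / 4.
    rewrite /rho; move: (d%:R * _) D0 => D D0.
    rewrite (_ : e / 4 = e / (4 * (D + 1)) * (D + 1)).
      by rewrite ler_wpM2l ?lerDl// divr_ge0 ?(ltW e0)// mulr_ge0// addr_ge0.
    by field; rewrite gt_eqF// ltr_wpDl.
  clearbody rho; have d10 : 0 < d%:R + 1 :> R by rewrite ltr_wpDl.
  exists (rho * e / (d%:R + 1)); first by rewrite divr_gt0// mulr_gt0.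
  move=> s t s0 st tT; rewrite ltr_pdivlMr// => str.
  apply: (@le_lt_trans _ _ (\int[eta]_(x in setT) (3 / 4 * e))%:E); last first.
    by rewrite Rintegral_prob_cst lte_fin; lra.
  apply: (d1_coupling metrizes_eucl (bnd s) (bnd t)).
    exact: integrable_prob_cst.
  apply: (aeS eta) aG => x [_ ax].
  rewrite /eucl_dist -opprB enormN.
  apply: le_trans (actions_modulus ax rho0 s0 st tT) _.
  rewrite mulrDr (_ : d%:R * (rho / 2 * _) = rho * (d%:R * (1 / 2 * (T * M ^+ 2)))); last by field.
  have h1 : d%:R * ((t - s) / (2 * rho)) <= e / 2.
    rewrite mulrA ler_pdivrMr ?mulr_gt0// mulrC.
    rewrite (_ : e / 2 * (2 * rho) = rho * e); last by field.
    apply: le_trans (ltW str); rewrite ler_wpM2l ?subr_ge0// lerDl//.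
  lra.
apply/subspace_continuousP => t; rewrite /= in_itv/= => /andP[t0 tT] W.
move=> /nbhs_ballP[e /= e0 eW]; have [r r0 hr] := key e e0.
apply: (@filterS _ (nbhs t) (nbhs_filter _) _ _ _ (nbhsx_ballx t r r0)) => s.
rewrite /ball/= => str; rewrite in_itv/= => /andP[s0 sT]; apply: eW.
rewrite /ball/= /d1_ball/=.
have [st|ts] := leP s t.
  by rewrite d1_sym; apply: hr => //; apply: le_lt_trans str; exact: ler_norm.
by apply: hr => //; [exact: ltW|rewrite distrC in str; apply: le_lt_trans str; exact: ler_norm].
Qed.

End laws.

(** * Dependence of the cost on the population *)

Section cost_lipschitz.
Context {R : realType} {d : nat} {T : R} (hT : 0 < T).
Local Notation mu := (@lebesgue_measure R).
Local Notation E := 'rV[R]_d.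
Local Notation V := (@cpath R T d).
Local Notation I := (`[0, T]%classic : set R).
Local Notation PE := (Prob (@eucl_dist R d)).
Local Notation PV := (Prob (@supdist R T d)).
Implicit Types (x y : V) (eta xi : PV).

Lemma lipschitz_C1_le (f : E -> PE -> R) : lipschitz_C1 f ->
  exists2 C : R, 0 < C & forall m m' (de : R), (d1 m m' <= de%:E)%E -> forall x : E,
    `|f x m - f x m'| <= C * de /\ enorm (grad (fun z => f z m - f z m') x) <= C * de.
Proof.
move=> [C C0 hC]; exists C => // m m' de hde x.
have {}hC : (C1norm (fun z => f z m - f z m')%R <= (C * de)%:E)%E.
  by apply: le_trans (hC m m') _; rewrite EFinM lee_pmul2l ?lte_fin.
have h1 : (`|f x m - f x m'|%:E <= ereal_sup (range (fun z => `|f z m - f z m'|%:E)))%E.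
  by apply: ereal_sup_ubound; exists x.
have h2 : ((enorm (grad (fun z => f z m - f z m')%R x))%:E <=
    ereal_sup (range (fun z => (enorm (grad (fun z => f z m - f z m')%R z))%:E)))%E.
  by apply: ereal_sup_ubound; exists x.
have p1 : (0 <= ereal_sup (range (fun z => `|f z m - f z m'|%:E)))%E.
  by apply: le_trans h1; rewrite lee_fin.
have p2 : (0 <= ereal_sup (range (fun z => (enorm (grad (fun z => f z m - f z m')%R z))%:E)))%E.
  by apply: le_trans h2; rewrite lee_fin enorm_ge0.
rewrite /C1norm in hC; split; rewrite -lee_fin.
  by apply: le_trans hC; apply: le_trans h1 _; rewrite leeDl.
by apply: le_trans hC; apply: le_trans h2 _; rewrite leeDr.
Qed.

Lemma Rintegral_bound (k : R -> R) (K : R) : mu.-integrable I (EFin \o k) ->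
  (forall t, 0 <= t <= T -> `|k t| <= K) -> `|\int[mu]_(t in I) k t| <= T * K.
Proof.
move=> ik hK.
have iK : mu.-integrable I (EFin \o (fun=> K)).
  exact: integrable_cst_itv.
apply: le_trans (le_normr_Rintegral _ ik) _ => //.
apply: (@le_trans _ _ (\int[mu]_(t in I) K)).
  apply: le_Rintegral => //; first exact: integrable_norm.
rewrite Rintegral_cst//.
have lst : mu `[0, T] = T%:E.
  by rewrite (lebesgue_measure_itv `[0, T])/= lte_fin hT sube0.
set a := fine _; have -> : a = T by exact: (congr1 fine lst).
by rewrite mulrC.
Qed.

Variables (L : E -> E -> R) (f g : E -> PE -> R).
Hypothesis Lstar : star_ii L.
Hypothesis fgstar : star_iii f g.
Hypotheses (f_lipschitz : lipschitz_C1 f) (g_lipschitz : lipschitz_C1 g).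

Lemma J_fin x eta : sobolev x -> law_continuous eta -> J L f g x eta \is a fin_num.
Proof. by move=> sx ceta; rewrite (J_integralE Lstar fgstar (velocityP sx) sx ceta). Qed.

(** The Lagrangian does not depend on the population and cancels. *)
Lemma fine_J_diff x eta xi : sobolev x -> law_continuous eta -> law_continuous xi ->
  fine (J L f g x eta) - fine (J L f g x xi) =
  \int[mu]_(t in I) (f (x t) (law_at t eta) - f (x t) (law_at t xi)) +
  (g (x T) (law_at T eta) - g (x T) (law_at T xi)).
Proof.
move=> sx ce cx; have xq := velocityP sx.
have i1 := integrand_integrable Lstar fgstar xq sx ce.
have i2 := integrand_integrable Lstar fgstar xq sx cx.
rewrite !(J_integralE Lstar fgstar xq sx)//= opprD addrACA -RintegralB//.
by congr (_ + _); apply: eq_Rintegral => t _; rewrite opprD addrACA subrr add0r.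
Qed.

(** The uniform part of the C^1 norm bounds the change of the integrand. *)
Lemma J_lip_measure : exists2 C : R, 0 < C & forall x eta xi (de : R),
  sobolev x -> law_continuous eta -> law_continuous xi -> (d1 eta xi <= de%:E)%E ->
  `|fine (J L f g x eta) - fine (J L f g x xi)| <= C * de.
Proof.
have [Cf Cf0 hf] := lipschitz_C1_le f_lipschitz.
have [Cg Cg0 hg] := lipschitz_C1_le g_lipschitz.
exists (T * Cf + Cg); first by rewrite addr_gt0 // mulr_gt0.
move=> x eta xi de sx ce cx hde; rewrite fine_J_diff//.
have hd t : (d1 (law_at t eta) (law_at t xi) <= de%:E)%E.
  by apply: le_trans hde; exact: law_at_lip.
rewrite mulrDl; apply: le_trans (ler_normD _ _) _; apply: lerD; last first.
  by have [] := hg _ _ _ (hd T) (x T).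
rewrite -mulrA; apply: Rintegral_bound.
  have i1 := f_path_integrable fgstar x ce.
  have i2 := f_path_integrable fgstar x cx.
  exact: RintegrableB.
by move=> t _; have [] := hf _ _ _ (hd t) (x t).
Qed.

(** A change of the population changes the cost by a function that is Lipschitz in the path, with a
    constant proportional to the change of the population: this is where the C^1 Lipschitz
    assumption on f and g enters through the gradients. *)
Lemma J_lip_path : exists2 C : R, 0 < C & forall x y eta xi (de : R),
  sobolev x -> sobolev y -> law_continuous eta -> law_continuous xi ->
  (d1 eta xi <= de%:E)%E ->
  `|(fine (J L f g x eta) - fine (J L f g x xi)) -
    (fine (J L f g y eta) - fine (J L f g y xi))| <= C * de * supdist x y.
Proof.
have [Cf Cf0 hf] := lipschitz_C1_le f_lipschitz.
have [Cg Cg0 hg] := lipschitz_C1_le g_lipschitz.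
exists (T * Cf + Cg); first by rewrite addr_gt0 // mulr_gt0.
move=> x y eta xi de sx sy ce cx hde; rewrite !fine_J_diff//.
have hd t : (d1 (law_at t eta) (law_at t xi) <= de%:E)%E.
  by apply: le_trans hde; exact: law_at_lip.
have ifd (z : V) : mu.-integrable I (EFin \o (fun t =>
    f (z t) (law_at t eta) - f (z t) (law_at t xi))).
  have i1 := f_path_integrable fgstar z ce.
  have i2 := f_path_integrable fgstar z cx.
  exact: RintegrableB.
have ifx := ifd x; have ify := ifd y.
rewrite opprD addrACA -RintegralB// !mulrDl; apply: le_trans (ler_normD _ _) _.
apply: lerD; last first.
  apply: (@le_trans _ _ (Cg * de * enorm (x T - y T))).
    apply: (@grad_lipschitz _ _ (fun z => g z (law_at T eta) - g z (law_at T xi))) => s _.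
    split; first by apply: differentiableB; exact: g_diff fgstar _ _.
    by have [] := hg _ _ _ (hd T) (y T + s *: (x T - y T)).
  rewrite ler_wpM2l//; last exact: supdist_ub.
  by apply: le_trans (hg _ _ _ (hd T) (x T)).1.
rewrite -!mulrA; apply: Rintegral_bound; first exact: RintegrableB.
move=> t _; rewrite mulrA.
apply: (@le_trans _ _ (Cf * de * enorm (x t - y t))).
  apply: (@grad_lipschitz _ _ (fun z => f z (law_at t eta) - f z (law_at t xi))) => s _.
  split; first by apply: differentiableB; exact: f_diff fgstar _ _.
  by have [] := hf _ _ _ (hd t) (y t + s *: (x t - y t)).
rewrite ler_wpM2l//; last exact: supdist_ub.
by apply: le_trans (hf _ _ _ (hd t) (x t)).1.
Qed.

End cost_lipschitz.

(** * Compactness, dominated convergence, distances of random paths *)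

Lemma eventually_or_frequently (P : set nat) :
  (exists N, forall k, (N <= k)%N -> ~ P k) \/ (forall N, exists2 k, (N <= k)%N & P k).
Proof.
have [h|h] := pselect (exists N, forall k, (N <= k)%N -> ~ P k); [by left|right => N].
by apply: contrapT => hN; apply: h; exists N => k Nk Pk; apply: hN; exists k.
Qed.

(** A cluster point of the sequence along the indices in P, in a form that needs no subsequence. *)
Lemma compact_frequently (X : topologicalType) (K : set X) (u : nat -> X) (P : set nat) :
  compact K -> (forall k, P k -> K (u k)) ->
  (forall N, exists2 k, (N <= k)%N & P k) ->
  exists2 x, K x & forall W (Q : set nat), nbhs x W -> (\forall k \near \oo, Q k) ->
    exists k, [/\ P k, Q k & W (u k)].
Proof.
move=> cK uK freq.
have PF : ProperFilter (u @ within P \oo).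
  apply: fmap_proper_filter; split; last exact: within_filter.
  by move=> [N _ hN]; have [k Nk Pk] := freq N; exact: (hN k Nk).
have KF : (u @ within P \oo) K by apply: nearW => k; exact: uK.
have [x [Kx cx]] := cK _ PF KF.
exists x => // W Q xW oQ.
have : (u @ within P \oo) [set u k | k in P `&` Q].
  by apply: filterS oQ => k Qk Pk; exists k.
by move=> /cx/(_ xW)[_ [[k [Pk Qk] <-] Wk]]; exists k.
Qed.

Lemma ae_Rdominated_cvg0 dS (S : measurableType dS) (R : realType)
    (Q : probability S R) (h : nat -> S -> R) (B : R) :
  (forall k, measurable_fun setT (h k)) ->
  {ae Q, forall s, h ^~ s @ \oo --> 0} ->
  (forall k, {ae Q, forall s, `|h k s| <= B}) ->
  \int[Q]_s h k s @[k --> \oo] --> 0.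
Proof.
move=> mh h0 hB.
have {}hB : {ae Q, forall s k, `|h k s| <= B}.
  by apply: ae_foralln.
have [] := @dominated_convergence _ _ _ Q setT measurableT
  (fun k s => (h k s)%:E) (fun=> 0%E) (fun=> B%:E).
- by move=> k; apply/measurable_EFinP.
- exact: measurable_cst.
- apply: (aeS Q) h0 => s hs _.
  by apply: cvg_EFin; [exact: nearW|exact: hs].
- exact: integrable_prob_cst.
- by apply: (aeS Q) hB => s hs k _; rewrite lee_fin.
move=> _ _; rewrite integral0 => cv.
by apply: (fine_cvg cv).
Qed.

Section measurable_distance.
Context {R : realType} {d : nat} {T : R}.
Local Notation E := 'rV[R]_d.
Local Notation V := (@cpath R T d).

Lemma eucl_dist_continuous : continuous (fun p : E * E => eucl_dist p.1 p.2).
Proof.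
move=> p; apply/(@cvgrPdist_lt _ _ _ (nbhs p) (nbhs_filter _)) => e e0.
have e2 : 0 < e / 2 by rewrite divr_gt0.
exists ([set y | enorm (y - p.1) < e / 2], [set y | enorm (y - p.2) < e / 2]).
  by split; exact: near_enorm_lt.
move=> [x y] [/= hx hy]; rewrite /eucl_dist.
apply: le_lt_trans (ler_dist_enorm _ _) _.
rewrite [e]splitr; apply: le_lt_trans (ltrD hx hy).
rewrite (_ : _ - _ - _ = (p.1 - x) + (y - p.2)); last first.
  by rewrite opprB addrACA [RHS]addrACA (addrC (- x)).
by apply: le_trans (enormD _ _) _; rewrite (enormB p.1).
Qed.

Lemma measurable_coord i : measurable_fun setT (fun x : borel E => (x : E) 0 i : R).
Proof. by apply: continuous_borel_measurable; exact: coord_continuous. Qed.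

(** By continuity of paths the supremum may be taken over the rational times. *)
Lemma measurable_supdist dS (S : measurableType dS) (Y Z : {mfun S >-> borel V}) :
  measurable_fun setT (fun s => supdist (Y s : V) (Z s)).
Proof.
apply: (measurability _ (RGenOInfty.measurableE R)).
move=> _ [_ [c ->] <-]; rewrite setTI.
rewrite (_ : _ @^-1` _ = \bigcup_(q : rat)
    [set s | c < eucl_dist ((Y s : V) (ratr q)) ((Z s : V) (ratr q))]).
  apply: countable_bigcupT_measurable => [|q]; first exact: countableP.
  have mc (F : {mfun S >-> borel V}) i : measurable_fun setT (fun s => (F s : V) (ratr q) 0 i).
    apply: (measurableT_comp (measurable_coord i)).
    by apply: (measurableT_comp (measurable_eval_at _)).
  have := measurable_comp_pair measurableT eucl_dist_continuous (mc Y) (mc Z).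
  move=> /(_ measurableT `]c, +oo[%classic (measurable_itv _)).
  by rewrite setTI; congr measurable; apply/seteqP; split => s /=; rewrite in_itv/= andbT.
apply/seteqP; split => s /=; rewrite in_itv/= andbT.
  move=> cs.
  have [_ [t _ <-] ct] := sup_gt (proj1 (supdist_has_sup (Y s : V) (Z s))) cs.
  pose h (t : R) := eucl_dist ((Y s : V) t) ((Z s : V) t).
  have ch : continuous h.
    move=> r; apply: (@continuous_comp R (E * E)%type R
      (fun t : R => ((Y s : V) t, (Z s : V) t)) (fun p => eucl_dist p.1 p.2)).
      move=> A [[P Q] /= [hP hQ] PQ].
      have h1 : nbhs r ((Y s : V) @^-1` P) := @cpath_cts _ _ _ (Y s : V) r P hP.
      have h2 : nbhs r ((Z s : V) @^-1` Q) := @cpath_cts _ _ _ (Z s : V) r Q hQ.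
      apply: (@filterS _ (nbhs r) (nbhs_filter _) _ _ _ (filterI h1 h2)) => t' [Pt Qt].
      by apply: (PQ (_, _)); split.
    exact: eucl_dist_continuous.
  have oh : open (h @^-1` [set x | c < x]).
    by apply: open_comp; [move=> r _; exact: ch|exact: open_gt].
  have := @dense_rat R _ (ex_intro _ t ct) oh.
  by move=> [x [hq [q _ qE]]]; exists q => //=; rewrite qE.
by move=> [q _ /lt_le_trans]; apply; exact: supdist_ub.
Qed.

End measurable_distance.

Lemma near_harmonic (R : realType) (D e : R) : 0 < e -> \forall k \near \oo, D / k.+1%:R <= e.
Proof.
move=> e0; near=> k; rewrite ler_pdivrMr// mulrC -ler_pdivrMr//.
near: k; have := nbhs_infty_ger (D / e : R); apply: filterS => k h.
by apply: le_trans h _; rewrite ler_nat.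
Unshelve. all: by end_near. Qed.

(** The mean of the increments tends to 0 by Cesaro's theorem. *)
Lemma cvg_sublinear (R : realType) (u b : nat -> R) :
  (forall n, 0 <= u n) -> (forall n, u n.+1 <= u n + b n) -> b @ \oo --> 0 ->
  u n / n.+1%:R @[n --> \oo] --> 0.
Proof.
move=> u0 ub b0.
have h n : u n <= u 0%N + \sum_(0 <= k < n) b k.
  elim: n => [|n IH]; first by rewrite big_nil addr0.
  rewrite big_nat_recr//= addrA; apply: le_trans (ub n) _; by rewrite lerD2r.
have cb := cesaro b0.
have c1 : u 0%N * n.+1%:R^-1 @[n --> \oo] --> 0.
  by have := cvgM (cvg_cst (u 0%N)) (@cvg_harmonic R); rewrite mulr0; apply.
have c2 : - b n * n.+1%:R^-1 @[n --> \oo] --> 0.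
  by have h' := cvgM (cvgN b0) (@cvg_harmonic R); rewrite mulr0 in h'; exact: h'.
have := cvgD (cvgD c1 cb) c2; rewrite !addr0 => c3.
apply: (@squeeze_cvgr _ _ _ _ (fun=> 0)
  (fun n => u 0%N * n.+1%:R^-1 + arithmetic_mean b n + - b n * n.+1%:R^-1));
  [apply: nearW => n /=|exact: cvg_cst|exact: c3].
rewrite divr_ge0//=.
rewrite [leRHS](_ : _ = (u 0%N + \sum_(0 <= k < n) b k) / n.+1%:R); last first.
  rewrite /arithmetic_mean/= /series/= big_nat_recr//=.
  by rewrite [n.+1%:R^-1 * _]mulrC -!mulrDl; congr (_ * _); rewrite -!addrA addrN addr0.
by rewrite ler_wpM2r.
Qed.

Lemma mfun_exists dS (S : measurableType dS) dS' (S' : measurableType dS') (b : S -> S') :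
  measurable_fun setT b -> exists B : {mfun S >-> S'}, forall s, B s = b s.
Proof.
move=> mb; pose B : {mfun S >-> S'} := HB.pack b (isMeasurableFun.Build _ _ _ _ b mb).
by exists B.
Qed.

(** * Stability of best replies *)

Section game.
Context {R : realType} {d : nat} {T : R} (hT : 0 < T).
Local Notation mu := (@lebesgue_measure R).
Local Notation E := 'rV[R]_d.
Local Notation V := (@cpath R T d).
Local Notation I := (`[0, T]%classic : set R).
Local Notation PE := (Prob (@eucl_dist R d)).
Local Notation PV := (Prob (@supdist R T d)).
Variables (L : E -> E -> R) (f g : E -> PE -> R) (m0 : PE) (M : R).
Hypotheses (hstar_i : star_i m0) (Lstar : star_ii L) (fgstar : star_iii f g).
Hypothesis hM : a_priori_bound T L f g m0 M.
Hypotheses (h_i : cond_i d T M) (h_ii : cond_ii T L f g m0 M).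
Hypotheses (h_iv : cond_iv T m0 M) (h_v : cond_v T L f g m0 M).
Hypothesis J_monotone : monotone_cost T L f g m0 M.
Hypotheses (f_lipschitz : lipschitz_C1 f) (g_lipschitz : lipschitz_C1 g).
Implicit Types (x y : V) (eta xi : PV).
Local Notation profile := {mfun borel E >-> borel V}.
Local Notation covPG := (@covPG R d T m0 M).
Local Notation J := (J L f g).
Local Notation feasible := (@feasible R d T m0 M).
Local Notation admissible := (@admissible R d T m0 M).
Let M0 : 0 < M := hM.1.
Local Notation lawc := (covPG_law_continuous hT M0 hstar_i h_i).
Local Notation carried := (covPG_feasible hstar_i h_i).

Definition d1_cvg eta (xi : nat -> PV) :=
  forall e, 0 < e -> \forall k \near \oo, (d1 eta (xi k) <= e%:E)%E.

Lemma J_lsc eta : covPG eta -> lower_semicontinuous (fun x => J x eta).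
Proof.
move=> ceta x a ax; have [W nW hW] := h_ii (x := (x, eta)) ax.
have : nbhs (x, eta) [set p : V * PV | covPG p.2 -> W p].
  by move: nW; rewrite {1}/nbhs/= /nbhs_subspace mem_set.
move=> [[P Q] /= [nP nQ] PQ]; exists P => // y Py; apply: (hW (y, eta)).
by apply: (PQ (y, eta)) => //; split => //; exact: nbhs_singleton.
Qed.

Lemma J_measurable eta : covPG eta -> measurable_fun setT (fun x : borel V => J x eta).
Proof. by move=> ceta; apply: lsc_borel_measurable; exact: J_lsc. Qed.

Lemma fine_J_measurable eta : covPG eta ->
  measurable_fun setT (fun x : borel V => fine (J x eta)).
Proof. by move=> /J_measurable; apply: measurableT_comp. Qed.

Lemma actions_sobolev i x : actions M i x -> sobolev x. Proof. by case. Qed.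

Lemma J_fineK i x eta : covPG eta -> actions M i x -> (fine (J x eta))%:E = J x eta.
Proof.
by move=> /lawc ceta [sx _ _]; rewrite fineK//; exact: J_fin.
Qed.

(** L is bounded below, and the feasible paths are uniformly bounded, hence f and g along them. *)
Lemma J_lower_bound eta : covPG eta -> exists c : R, forall x, feasible x -> (c%:E <= J x eta)%E.
Proof.
move=> /lawc ceta; have [B B0 hB] := feasible_bounded hT M0 hstar_i.
have [C C0 hC] := fg_lip fgstar B0.
have [c0 [C' [c00 C'0 hL]]] := lag_bound Lstar.
pose k t := f 0 (law_at t eta) - (c0 + C * B).
have ik : mu.-integrable I (EFin \o k).
  have i1 := f_path_integrable fgstar (cst_cpath T 0) ceta.
  have i2 : mu.-integrable I (EFin \o (fun=> c0 + C * B)).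
    exact: integrable_cst_itv.
  exact: RintegrableB.
exists (\int[mu]_(t in I) k t + (g 0 (law_at T eta) - C * B)) => x Gx.
have [_ [sx _ _]] := Gx; have xq := velocityP sx.
have xB t : enorm (x t) <= B.
  by have := le_trans (supdist_ub x (cst_cpath T 0) t) (hB _ Gx); rewrite /eucl_dist/= /cst subr0.
have hfg t m : f 0 m - C * B <= f (x t) m /\ g 0 m - C * B <= g (x t) m.
  have e0 : enorm (0 : E) <= B by rewrite enorm0 ltW.
  have [] := hC _ _ m e0 (xB t); rewrite subr0 => h1 h2.
  have h3 : C * enorm (x t) <= C * B by rewrite ler_pM2l.
  move: h1 h2; rewrite !ler_norml => /andP[h1 _] /andP[h2 _].
  by move: (C * _) (C * _) h1 h2 h3 => a b h1 h2 h3; split; lra.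
rewrite (J_integralE Lstar fgstar xq sx ceta) lee_fin.
apply: lerD; last by have [] := hfg T (law_at T eta).
have ii := integrand_integrable Lstar fgstar xq sx ceta.
apply: le_Rintegral => // t _; rewrite /k.
have /andP[h1 _] := hL (x t) (velocity x t).
have [h2 _] := hfg t (law_at t eta).
by move: h1 h2; move: (L _ _) (f _ _) (f _ _) (C * B) => a b r e; lra.
Qed.

(** The costs J(., xi k) converge uniformly to J(., eta), which is lower semicontinuous; thus every
    cluster point of the minimizers in the compact action set minimizes J(., eta), and there is only
    one such path. *)
Lemma argmin_stability i x eta (xi : nat -> PV) (y : nat -> V) :
  covPG eta -> (forall k, covPG (xi k)) -> d1_cvg eta xi ->
  (exists! z, argmin (actions M i) (J^~ eta) z) ->
  (forall k, argmin (actions M i) (J^~ (xi k)) (y k)) ->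
  argmin (actions M i) (J^~ eta) x ->
  supdist (y k) x @[k --> \oo] --> 0.
Proof.
move=> ceta cxi exi [z0 [_ uniq]] miny minx.
have [C C0 hC] := J_lip_measure hT Lstar fgstar f_lipschitz g_lipschitz.
apply/cvgrPdist_lt => r r0.
pose P := [set k | r <= supdist (y k) x].
have [[N hN]|freq] := eventually_or_frequently P.
  exists N => // k /hN /= nP; rewrite sub0r normrN ger0_norm ?supdist_ge0//.
  by rewrite ltNge; apply/negP.
exfalso.
have [cA _ _] := h_i.
have [z Az hz] := compact_frequently (cA i) (fun k (_ : P k) => (miny k).1) freq.
suff zx : z = x.
  have nx : nbhs z [set w | supdist w x < r].
    rewrite zx; have [_ _ _ nb] := @metrizes_sup R d T; apply/nb.
    by exists r => // w /=; rewrite supdist_sym.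
  have [k [Pk _ /= kr]] := hz _ setT nx filterT.
  by move: kr; rewrite ltNge => /negP; apply; exact: Pk.
suff minz : argmin (actions M i) (J^~ eta) z.
  by rewrite -(uniq z minz) -(uniq x minx).
split=> // w Aw; rewrite -(J_fineK ceta Az) -(J_fineK ceta Aw) lee_fin.
apply/ler_addgt0Pr => e e0.
have az : ((fine (J z eta) - e / 2)%:E < J z eta)%E.
  by rewrite -[ltRHS](J_fineK ceta Az) lte_fin gtrBl divr_gt0.
have [W nW hW] := J_lsc ceta az.
have e4 : 0 < e / 4 / C by rewrite !divr_gt0.
have [k [_ dk Wk]] := hz W _ nW (exi _ e4).
have {}hW := hW _ Wk.
have Ak := (miny k).1.
have h1 := hC (y k) eta (xi k) _ (actions_sobolev Ak) (lawc ceta) (lawc (cxi k)) dk.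
have h2 := hC w eta (xi k) _ (actions_sobolev Aw) (lawc ceta) (lawc (cxi k)) dk.
have h3 := (miny k).2 w Aw.
rewrite -(J_fineK (cxi k) Ak) -(J_fineK (cxi k) Aw) lee_fin in h3.
rewrite -(J_fineK ceta Ak) lte_fin in hW.
have CE : C * (e / 4 / C) = e / 4 by rewrite mulrC divfK// gt_eqF.
move: h1 h2; rewrite CE !ler_norml => /andP[_ h1] /andP[h2 _].
by move: hW h1 h2 h3; move: (fine _) (fine _) (fine _) (fine _) (fine _) => a1 a2 a3 a4 a5; lra.
Qed.

Lemma subseq_compact (xi : nat -> PV) (P : set nat) :
  (forall k, P k -> covPG (xi k)) -> (forall N, exists2 k, (N <= k)%N & P k) ->
  exists eta n, [/\ covPG eta, forall k, (k <= n k)%N, forall k, P (n k) &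
    d1_cvg eta (xi \o n)].
Proof.
move=> cxi freq; have [eta ceta heta] := compact_frequently h_iv cxi freq.
have /choice[n hn] : forall k, exists j,
    [/\ P j, (k <= j)%N & (d1 eta (xi j) < k.+1%:R^-1%:E)%E].
  move=> k.
  have nb : nbhs eta [set nu : PV | (d1 eta nu < k.+1%:R^-1%:E)%E].
    by apply: (nbhsx_ballx eta); rewrite invr_gt0.
  by apply: (heta _ _ nb); exists k.
exists eta, n; split => //; try by move=> k; have [] := hn k.
move=> e e0; have := near_infty_natSinv_lt (PosNum e0).
apply: filterS => k ke; have [_ _ /ltW h] := hn k.
by apply: le_trans h _; rewrite lee_fin ltW.
Qed.

(** * Fictitious play: admissibility and step size *)

Lemma law_covPG (Phi : profile) : admissible Phi -> covPG (law m0 Phi).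
Proof. by move=> h; apply: PG_covPG; exact: law_PG. Qed.

(** The integrability half of the monotonicity assumption. *)
Lemma cost_integrable eta xi : covPG eta -> covPG xi ->
  xi.-integrable setT (EFin \o (fun x : borel V => fine (J x eta))).
Proof.
move=> ceta cxi; apply/integrableP; split.
  by apply/measurable_EFinP; exact: fine_J_measurable _ ceta.
have [fin _] := J_monotone ceta cxi; apply: le_lt_trans fin.
apply: ge0_le_integral => //.
- by apply: measurableT_comp => //; apply/measurable_EFinP; exact: fine_J_measurable _ ceta.
- by apply: measurableT_comp => //; exact: J_measurable _ ceta.
- by move=> x _ /=; case: (J x eta) => [r| |]//=; rewrite normr0 ?leey.
Qed.

Lemma profile_cost_integrable (Phi : profile) eta : admissible Phi -> covPG eta ->
  m0.-integrable setT (EFin \o (fun i : borel E => fine (J (Phi i) eta))) /\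
  \int[law m0 Phi]_x fine (J x eta) = \int[m0]_i fine (J (Phi i) eta).
Proof.
move=> aPhi ceta; have cPhi := law_covPG aPhi.
have mJ : measurable_fun setT (EFin \o (fun x : borel V => fine (J x eta))).
  by apply/measurable_EFinP; exact: fine_J_measurable _ ceta.
have /integrableP[_ fin] := cost_integrable ceta cPhi.
split; last first.
  by rewrite /Rintegral /law (integral_distribution_measurable _ _ mJ).
apply/integrableP; split; first exact: (measurableT_comp mJ).
by move: fin; rewrite /law integral_distribution_measurable//; apply: measurableT_comp.
Qed.

Lemma monotone_real eta xi : covPG eta -> covPG xi ->
  \int[xi]_x (fine (J x eta) - fine (J x xi)) <=
  \int[eta]_x (fine (J x eta) - fine (J x xi)).
Proof.
move=> ceta cxi; have [_] := J_monotone ceta cxi.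
have EI nu : covPG nu -> (\int[nu]_x (J x eta - J x xi) =
    (\int[nu]_x (fine (J x eta) - fine (J x xi)))%:E)%E.
  move=> cnu; have i1 := cost_integrable ceta cnu; have i2 := cost_integrable cxi cnu.
  rewrite /Rintegral fineK; last first.
    by apply: integrable_fin_num => //; exact: (RintegrableB measurableT i1 i2).
  apply: ae_eq_integral => //.
  - by apply: emeasurable_funB; exact: J_measurable _ _.
  - exact: measurable_int (RintegrableB measurableT i1 i2).
  - have aG := covPG_feasible hstar_i h_i cnu.
    apply: (aeS nu) aG => x [_ ax] _ /=.
    by rewrite EFinB (J_fineK ceta ax)
      (J_fineK cxi ax).
by rewrite !EI// -EFinB lee_fin subr_ge0.
Qed.

Variables (Psi : nat -> profile) (etabar : nat -> PV).
Hypothesis fp : fictitious_play L f g m0 M Psi etabar.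

Lemma etabar_mixture n : (0 < n)%N -> forall A : set (borel V), measurable A ->
  etabar n A = (\sum_(k < n) (n%:R^-1)%:E * law m0 (Psi k.+1) A)%E.
Proof.
move=> n0 A mA; have [_ _ /(_ n n0 A mA) ->] := fp.
by rewrite ge0_sume_distrr// big_add1/= big_mkord.
Qed.

Lemma etabar_hull n : (0 < n)%N -> (forall j, (0 < j <= n)%N -> admissible (Psi j)) ->
  covPG (etabar n).
Proof.
move=> n0 aPsi; apply: hull_covPG.
exists n, (fun=> n%:R^-1), (fun k => law m0 (Psi k.+1)); split.
- by move=> _; rewrite invr_ge0.
- by rewrite sumr_const card_ord -[_ *+ _]mulr_natl mulfV// pnatr_eq0 -lt0n.
- by move=> k; apply: law_PG; apply: aPsi; rewrite /= ltn_ord.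
- exact: etabar_mixture.
Qed.

(** By induction: once the first n profiles are admissible, the mean of their distributions has
    continuous marginals, and the next minimizers satisfy the a priori bound. *)
Lemma Psi_admissible n : (0 < n)%N -> admissible (Psi n).
Proof.
elim/ltn_ind: n => -[//|[|n]] IH _; first by have [] := fp.
have ce : covPG (etabar n.+1) by apply: etabar_hull => // j /andP[j0 jn]; exact: IH.
have [_ /(_ n.+1 isT) hmin _] := fp.
have aS := ae_support m0.
apply: (aeS2 m0) hmin aS => i [[si ii] mini] Si.
rewrite -{1}ii; apply: (minimizer_in_actions hT Lstar fgstar hM (lawc ce)) => //.
  by rewrite ii; exact: support_sup.
by move=> y sy yi; apply: mini; split => //; rewrite yi.
Qed.

Lemma etabar_covPG n : (0 < n)%N -> covPG (etabar n).
Proof. by move=> n0; apply: etabar_hull => // j /andP[j0 _]; exact: Psi_admissible. Qed.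

Lemma Psi_argmin n : (0 < n)%N ->
  {ae m0, forall i, argmin (actions M i) (J^~ (etabar n)) (Psi n.+1 i)}.
Proof.
move=> n0; have [_ /(_ n n0) hmin _] := fp.
have aS := Psi_admissible (ltn0Sn n).
apply: (aeS2 m0) hmin aS => i [_ mini] ai.
by split => // y [sy yi _]; exact: mini.
Qed.

(** Averaging one more distribution moves the mean by the difference of the new one and the mean,
    divided by the number of terms; all distributions live on a bounded set of paths. *)
Lemma etabar_step : exists2 D : R, 0 < D & forall n, (0 < n)%N ->
  (d1 (etabar n.+1) (etabar n) <= (D / n.+1%:R)%:E)%E.
Proof.
have [B B0 hB] := feasible_bounded hT M0 hstar_i.
exists (2 * B); first by rewrite mulr_gt0.
move=> n n0; apply: ge_ereal_sup => _ [h lh <-].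
have mh := lip1_measurable metrizes_sup lh.
pose z := cst_cpath T (0 : E).
have bh nu : covPG nu -> {ae nu, forall x, `|h x - h z| <= B}.
  move=> cnu; have aG := covPG_feasible hstar_i h_i cnu.
  apply: (aeS nu) aG => x Gx.
  by apply: le_trans (lh _ _) _; exact: hB.
have ih nu : covPG nu -> nu.-integrable setT (EFin \o h).
  move=> cnu; apply: (@ae_bounded_integrable _ _ _ _ (`|h z| + B)) => //.
  apply: (aeS nu) (bh nu cnu) => x hx.
  rewrite -lerBlDl; apply: le_trans hx; exact: lerB_dist.
pose a k := \int[law m0 (Psi k.+1)]_x h x.
have cP k : covPG (law m0 (Psi k.+1)) by apply: law_covPG; exact: Psi_admissible.
have aB k : `|a k - h z| <= B.
  have iz : (law m0 (Psi k.+1)).-integrable setT (EFin \o (fun=> h z)).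
    exact: integrable_prob_cst.
  have ihk := ih _ (cP k).
  have iB : (law m0 (Psi k.+1)).-integrable setT (EFin \o (fun=> B)).
    exact: integrable_prob_cst.
  rewrite -[h z](Rintegral_prob_cst (law m0 (Psi k.+1))) /a -RintegralB//.
  have ihz := RintegrableB measurableT ihk iz.
  apply: le_trans (le_normr_Rintegral _ ihz) _ => //.
  rewrite -[leRHS](Rintegral_prob_cst (law m0 (Psi k.+1))).
  apply: ae_le_Rintegral => //; first exact: integrable_norm.
  exact: bh.
have EI m : (0 < m)%N -> (\int[etabar m]_x (h x)%:E)%E = (m%:R^-1 * \sum_(k < m) a k)%:E.
  have w0 : forall k : 'I_m, 0 <= m%:R^-1 :> R by move=> _; rewrite invr_ge0.
  move=> m0'; have [im] := mixture_integrable w0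
    (etabar_mixture m0') mh (fun k => ih _ (cP k)).
  rewrite -mulr_sumr => <-.
  by rewrite /Rintegral fineK//; exact: integrable_fin_num.
rewrite !EI// -EFinB lee_fin big_ord_recr/=.
have n1 : 0 < n.+1%:R :> R by rewrite ltr0n.
have n2 : 0 < n%:R :> R by rewrite ltr0n.
rewrite ler_pdivlMr//.
(* all integrals of h are within B of its value at the zero path *)
have hs : `|n%:R^-1 * \sum_(k < n) a k - h z| <= B.
  have -> : n%:R^-1 * \sum_(k < n) a k - h z = n%:R^-1 * \sum_(k < n) (a k - h z).
    by rewrite sumrB mulrBr sumr_const card_ord -[h z *+ n]mulr_natl mulKf// gt_eqF.
  rewrite normrM gtr0_norm ?invr_gt0// ler_pdivrMl//.
  apply: le_trans (ler_norm_sum _ _ _) _.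
  rewrite mulr_natl -[X in _ *+ X](card_ord n) -sumr_const; exact: ler_sum.
have -> : (n.+1%:R^-1 * (\sum_(k < n) a k + a n) - n%:R^-1 * \sum_(k < n) a k) * n.+1%:R =
  (a n - h z) - (n%:R^-1 * \sum_(k < n) a k - h z).
  by rewrite -natr1; field; rewrite natr1 !gt_eqF.
move: hs (aB n); rewrite !ler_norml => /andP[h1 _] /andP[_ h2].
by move: h1 h2; move: (_^-1 * _) (a n) (h z) => p q r; lra.
Qed.

Lemma d1_cvg_step eta (n : nat -> nat) : (forall k, (k <= n k)%N) ->
  (forall k, (0 < n k)%N) ->
  d1_cvg eta (etabar \o n) -> d1_cvg eta (fun k => etabar (n k).+1).
Proof.
move=> nk n0 cv e e0.
have [D D0 hD] := etabar_step.
have e2 : 0 < e / 2 by rewrite divr_gt0.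
have := near_harmonic D e2; have := cv _ e2; apply: filterS2 => k h1 h2.
apply: le_trans (d1_triangle (etabar (n k)) _ _) _.
rewrite [e]splitr EFinD; apply: leeD => //.
rewrite d1_sym; apply: le_trans (hD _ (n0 k)) _; rewrite lee_fin.
by apply: le_trans h2; rewrite ler_wpM2l ?(ltW D0)// lef_pV2 ?posrE// ler_nat ltnS.
Qed.

Lemma admissible_feasible (Phi : profile) : admissible Phi -> {ae m0, forall i, feasible (Phi i)}.
Proof.
move=> aPhi; have aS := ae_support m0.
apply: (aeS2 m0) aPhi aS => i ai Si.
by have [_ ii _] := ai; rewrite /feasible/= ii.
Qed.

Lemma admissible_supdist_bounded : exists2 B : R, 0 < B & forall Phi Phi' : profile,
  admissible Phi -> admissible Phi' -> {ae m0, forall i, `|supdist (Phi i : V) (Phi' i)| <= B}.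
Proof.
have [B B0 hB] := feasible_bounded hT M0 hstar_i.
exists (B + B) => [|Phi Phi']; first exact: addr_gt0.
move=> /admissible_feasible g1 /admissible_feasible g2.
apply: (aeS2 m0) g1 g2 => i G1 G2.
rewrite ger0_norm ?supdist_ge0//.
apply: le_trans (supdist_triangle (cst_cpath T 0) _ _) _.
by apply: lerD; [exact: hB|rewrite supdist_sym; exact: hB].
Qed.

Lemma argmin_stability_ae eta (xi : nat -> PV) (Phi : nat -> profile) : covPG eta ->
  (forall k, covPG (xi k)) -> d1_cvg eta xi ->
  (forall k, {ae m0, forall i, argmin (actions M i) (J^~ (xi k)) (Phi k i)}) ->
  {ae m0, forall i, forall x, argmin (actions M i) (J^~ eta) x ->
    supdist (Phi k i) x @[k --> \oo] --> 0}.
Proof.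
move=> ceta cxi cv /ae_foralln hPhi; have hv := h_v ceta.
apply: (aeS2 m0) hPhi hv => i mini ui x minx.
exact: (argmin_stability ceta cxi cv ui mini minx).
Qed.

(** Otherwise some subsequence stays away from 0. By compactness the means converge along a further
    one, and so do the next means, to the same limit; the two families of best replies then have the
    same limit. *)
Lemma successive_cvg0 :
  \int[m0]_i supdist (Psi n.+1 i : V) (Psi n.+2 i) @[n --> \oo] --> 0.
Proof.
set s := fun n => _.
have s0 n : 0 <= s n by apply: Rintegral_ge0 => i _; exact: supdist_ge0.
apply/cvgrPdist_lt => e e0; pose P := [set n | (0 < n)%N /\ e <= s n].
have [[N hN]|freq] := eventually_or_frequently P.
  exists N.+1 => // k /= Nk; rewrite sub0r normrN ger0_norm// ltNge; apply/negP => ek.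
  by apply: (hN k (ltnW Nk)); split => //; apply: leq_trans Nk.
exfalso.
have [eta [n [ceta nk Pn cv]]] := subseq_compact (fun k Pk => etabar_covPG (proj1 Pk)) freq.
have n0 k : (0 < n k)%N by have [] := Pn k.
have cv' := d1_cvg_step nk n0 cv.
have h1 := argmin_stability_ae ceta (fun k => etabar_covPG (n0 k)) cv (fun k => Psi_argmin (n0 k)).
have h2 := argmin_stability_ae ceta (fun k => etabar_covPG (ltn0Sn (n k))) cv'
  (fun k => Psi_argmin (ltn0Sn (n k))).
have [B _ hB] := admissible_supdist_bounded.
have : \int[m0]_i supdist (Psi (n k).+1 i : V) (Psi (n k).+2 i) @[k --> \oo] --> 0.
  apply: (@ae_Rdominated_cvg0 _ _ _ _ _ B).
  - by move=> k; exact: measurable_supdist.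
  - have hv := h_v ceta.
    have h12 := (aeI m0 h1 h2).
    apply: (aeS2 m0) h12 hv => i [c1 c2] [x [minx _]].
    have := cvgD (c1 x minx) (c2 x minx); rewrite addr0 => c12.
    apply: (@squeeze_cvgr _ _ _ _ (fun=> 0) (fun k =>
      supdist (Psi (n k).+1 i : V) x + supdist (Psi (n k).+2 i : V) x));
      [apply: nearW => k|exact: cvg_cst|exact: c12].
    rewrite supdist_ge0/=; apply: le_trans (supdist_triangle x _ _) _.
    by rewrite lerD2l supdist_sym.
  - by move=> k; apply: hB; exact: Psi_admissible.
move=> /cvgrPdist_lt/(_ e e0)[N _ /(_ N (leqnn N))].
rewrite /= sub0r normrN ger0_norm ?s0// ltNge => /negP; apply.
by have [] := Pn N.
Qed.

(** * The average regret *)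

Section gap.

Let c j eta : R := \int[m0]_i fine (J (Psi j i) eta).

(** The cost that the players would save on average, against the current mean, by replacing a past
    profile drawn at random with the best reply: the integral of J(., etabar n) against
    etabar n - eta (n+1). *)
Definition gap n : R := n%:R^-1 * (\sum_(k < n) c k.+1 (etabar n)) - c n.+1 (etabar n).

Let ic j eta : (0 < j)%N -> covPG eta ->
  m0.-integrable setT (EFin \o (fun i : borel E => fine (J (Psi j i) eta))).
Proof. by move=> j0 ceta; have [] := profile_cost_integrable (Psi_admissible j0) ceta. Qed.

Lemma cost_min n j : (0 < n)%N -> (0 < j)%N -> c n.+1 (etabar n) <= c j (etabar n).
Proof.
move=> n0 j0; have ce := etabar_covPG n0.
apply: ae_le_Rintegral; [exact: (ic _ ce)|exact: (ic _ ce)|].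
apply: (aeS2 m0) (Psi_argmin n0) (Psi_admissible j0) => i [a1 mini] a2.
by rewrite -lee_fin (J_fineK (etabar_covPG n0) a1) (J_fineK (etabar_covPG n0) a2); exact: mini.
Qed.

Lemma gap_ge0 n : (0 < n)%N -> 0 <= gap n.
Proof.
move=> n0; rewrite subr_ge0 ler_pdivlMl ?ltr0n// mulr_natl.
rewrite -[X in _ *+ X](card_ord n) -sumr_const; apply: ler_sum => k _; exact: cost_min.
Qed.

Let D n j := c j (etabar n.+1) - c j (etabar n).

Lemma etabar_integral m eta : (0 < m)%N -> covPG eta ->
  \int[etabar m]_x fine (J x eta) = m%:R^-1 * \sum_(k < m) c k.+1 eta.
Proof.
move=> m1 ceta.
have w0 : forall k : 'I_m, 0 <= m%:R^-1 :> R by move=> _; rewrite invr_ge0.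
have mJ := fine_J_measurable ceta.
have [_ ->] := mixture_integrable w0 (etabar_mixture m1) mJ
  (fun k => cost_integrable ceta (law_covPG (Psi_admissible (ltn0Sn k)))).
rewrite mulr_sumr; apply: eq_bigr => k _; congr (_ * _).
by have [_ ->] := profile_cost_integrable (Psi_admissible (ltn0Sn k)) ceta.
Qed.

(** Monotonicity between etabar (n+1) and etabar n: the profile added at step n+1 loses from the
    update of the cost at least as much as the average past profile. *)
Lemma monotone_step n : (0 < n)%N -> \sum_(k < n) D n k.+1 <= n%:R * D n n.+1.
Proof.
move=> n0; have c0 := etabar_covPG n0; have c1 := etabar_covPG (ltn0Sn n).
have := monotone_real c1 c0.
have EI m : (0 < m)%N ->
    \int[etabar m]_x (fine (J x (etabar n.+1)) - fine (J x (etabar n))) =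
    m%:R^-1 * \sum_(k < m) D n k.+1.
  move=> m1; have i1 := cost_integrable c1 (etabar_covPG m1).
  have i0 := cost_integrable c0 (etabar_covPG m1).
  by rewrite RintegralB// !etabar_integral// -mulrBr -sumrB.
rewrite !EI// big_ord_recr/=.
have n1 : 0 < n.+1%:R :> R by rewrite ltr0n.
have n2 : 0 < n%:R :> R by rewrite ltr0n.
rewrite ler_pdivrMl// mulrCA ler_pdivlMl// mulrDr -natr1 mulrDl mul1r.
by rewrite lerD2l.
Qed.

(** The update of the cost adds to the total regret the updates of the n + 1 past profiles, at most
    n + 1 times that of the best reply n+1 by [monotone_step], and subtracts n + 1 times the update
    of the best reply n+2. The difference of the two updates is O(1/n) times the distance of the two
    replies. *)
Lemma gap_step : exists2 K : R, 0 < K & forall n, (0 < n)%N ->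
  n.+1%:R * gap n.+1 <= n%:R * gap n +
    K * \int[m0]_i supdist (Psi n.+1 i : V) (Psi n.+2 i).
Proof.
have [C C0 hC] := J_lip_path hT Lstar fgstar f_lipschitz g_lipschitz.
have [B B0 hB] := etabar_step.
exists (C * B) => [|n n0]; first exact: mulr_gt0.
have c0 := etabar_covPG n0; have c1 := etabar_covPG (ltn0Sn n).
have n1 : 0 < n.+1%:R :> R by rewrite ltr0n.
have n2 : 0 < n%:R :> R by rewrite ltr0n.
set s := \int[m0]_i _.
have iS : m0.-integrable setT (EFin \o (fun i : borel E => supdist (Psi n.+1 i : V) (Psi n.+2 i))).
  have [B' _ hB'] := admissible_supdist_bounded.
  apply: (@ae_bounded_integrable _ _ _ _ B'); first exact: measurable_supdist.
  by apply: hB'; exact: Psi_admissible.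
have DD : n.+1%:R * (D n n.+1 - D n n.+2) <= C * B * s.
  have j1 := ic (ltn0Sn n) c1; have j2 := ic (ltn0Sn n) c0.
  have j3 := ic (ltn0Sn n.+1) c1; have j4 := ic (ltn0Sn n.+1) c0.
  have j12 := RintegrableB measurableT j1 j2; have j34 := RintegrableB measurableT j3 j4.
  have jS : m0.-integrable setT (EFin \o (fun i : borel E =>
      C * (B / n.+1%:R) * supdist (Psi n.+1 i : V) (Psi n.+2 i))).
    exact: RintegrableZ.
  have j := RintegrableB measurableT j12 j34.
  rewrite /D /c -!RintegralB// -ler_pdivlMl//.
  rewrite (_ : _^-1 * _ = C * (B / n.+1%:R) * s); last by field; rewrite gt_eqF.
  rewrite -RintegralZl//; apply: ae_le_Rintegral => //.
  have a1 := Psi_admissible (ltn0Sn n); have a2 := Psi_admissible (ltn0Sn n.+1).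
  apply: (aeS2 m0) a1 a2 => i [s1 _ _] [s2 _ _].
  apply: le_trans (ler_norm _) _; apply: hC => //; [exact: lawc|exact: lawc|exact: hB].
have mono := monotone_step n0.
have min2 := cost_min n0 (ltn0Sn n.+1).
rewrite /gap !mulrBr !mulVKf ?gt_eqF// big_ord_recr/=.
have -> : \sum_(k < n) c k.+1 (etabar n.+1) =
    \sum_(k < n) c k.+1 (etabar n) + \sum_(k < n) D n k.+1.
  by rewrite -big_split/=; apply: eq_bigr => k _; rewrite /D addrC subrK.
have -> : c n.+1 (etabar n.+1) = c n.+1 (etabar n) + D n n.+1 by rewrite /D addrC subrK.
have -> : c n.+2 (etabar n.+1) = c n.+2 (etabar n) + D n n.+2 by rewrite /D addrC subrK.
have min3 : n.+1%:R * c n.+1 (etabar n) <= n.+1%:R * c n.+2 (etabar n) by rewrite ler_pM2l.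
move: mono min3 DD.
move: (\sum_(k < n) D n k.+1) (\sum_(k < n) _) (D n n.+1) (D n n.+2) => S c' p q.
move: (c n.+1 (etabar n)) (c n.+2 (etabar n)) (C * B * s) => x y r.
rewrite !mulrBr !mulrDr -!natr1 !mulrDl !mul1r.
by move: (n%:R * p) (n%:R * q) (n%:R * x) (n%:R * y) => p1 p2 p3 p4; lra.
Qed.

(** The total regret n gap n has vanishing increments. *)
Lemma gap_cvg0 : gap n.+1 @[n --> \oo] --> 0.
Proof.
have [K K0 hK] := gap_step.
have := @cvg_sublinear R (fun n => n.+1%:R * gap n.+1)
  (fun n => K * \int[m0]_i supdist (Psi n.+2 i : V) (Psi n.+3 i)).
rewrite (_ : (fun n => _ / _) = (fun n => gap n.+1)); last first.
  by apply/funext => n; rewrite mulrAC divff ?mul1r// pnatr_eq0.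
apply.
- by move=> n; rewrite mulr_ge0// gap_ge0.
- by move=> n; exact: hK.
- have h := successive_cvg0.
  have h' := h.
  rewrite -(cvg_shiftS (fun n => \int[m0]_i supdist (Psi n.+1 i : V) (Psi n.+2 i))) in h'.
  by have h2 := cvgM (cvg_cst K) h'; rewrite mulr0 in h2; exact: h2.
Qed.

End gap.

(** * Uniqueness of the equilibrium *)

Lemma J_measure_eq x eta xi : covPG eta -> covPG xi -> measure_eq eta xi -> sobolev x ->
  J x eta = J x xi.
Proof.
move=> ce cx exi sx.
have [C C0 hC] := J_lip_measure hT Lstar fgstar f_lipschitz g_lipschitz.
have d0 : (d1 eta xi <= 0%:E)%E by exact: measure_eq_d1.
have := hC x eta xi 0 sx (lawc ce) (lawc cx) d0; rewrite mulr0 normr_le0 subr_eq0 => /eqP h.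
rewrite -(fineK (J_fin Lstar fgstar sx (lawc ce))) h fineK//.
exact: (J_fin Lstar fgstar sx (lawc cx)).
Qed.

Lemma carried_by_graph eta (Phi : profile) : covPG eta ->
  {ae eta, forall x, x = Phi (x 0)} -> measure_eq eta (law m0 Phi).
Proof.
move=> ceta hx A mA.
have mPA : measurable ((Phi : borel E -> borel V) @^-1` A) by exact: measurable_preimage_mfun.
transitivity (eta ((eval_at 0 : borel V -> borel E) @^-1` ((Phi : borel E -> borel V) @^-1` A))).
  apply: (ae_measure_eq (Q := eta)) => //; first exact: measurable_preimage_mfun.
  apply: (aeS eta) hx => x hx /=.
  by rewrite /eval_at -hx.
exact: (covPG_initial_law ceta mPA).
Qed.

Lemma law_ae_eq (Phi Phi' : profile) : {ae m0, forall i, Phi i = Phi' i} ->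
  measure_eq (law m0 Phi) (law m0 Phi').
Proof.
move=> h A mA; apply: (ae_measure_eq (Q := m0)); try exact: measurable_preimage_mfun.
by apply: (aeS m0) h => i /= ->.
Qed.

(** Against the law of each equilibrium, the other profile causes a loss that is nonnegative by the
    equilibrium property; monotonicity makes the two losses add up to at most 0. So both vanish,
    each profile is a best reply to the other law, and best replies are unique. *)
Lemma nash_unique (P Q : profile) : nash L f g m0 M P -> nash L f g m0 M Q ->
  {ae m0, forall i, P i = Q i}.
Proof.
move=> [aP mP] [aQ mQ]; have cP := law_covPG aP; have cQ := law_covPG aQ.
have [iPP EPP] := profile_cost_integrable aP cP; have [iPQ EPQ] := profile_cost_integrable aP cQ.
have [iQP EQP] := profile_cost_integrable aQ cP; have [iQQ EQQ] := profile_cost_integrable aQ cQ.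
have := monotone_real cP cQ.
have i1 := cost_integrable cP cP; have i2 := cost_integrable cP cQ.
have i3 := cost_integrable cQ cP; have i4 := cost_integrable cQ cQ.
rewrite !RintegralB// EPP EPQ EQP EQQ => mono.
have minQ : \int[m0]_i fine (J (Q i) (law m0 Q)) <= \int[m0]_i fine (J (P i) (law m0 Q)).
  apply: ae_le_Rintegral => //.
  apply: (aeS2 m0) mQ aP => i [a1 mini] a2.
  by rewrite -lee_fin (J_fineK cQ a1) (J_fineK cQ a2); exact: mini.
have i12 := RintegrableB measurableT iQP iPP.
have ae0 : {ae m0, forall i, fine (J (Q i) (law m0 P)) - fine (J (P i) (law m0 P)) = 0}.
  apply: ae_Rintegral_eq0 => //.
    apply: (aeS2 m0) mP aQ => i [a1 mini] a2.
    by rewrite subr_ge0 -lee_fin (J_fineK cP a1) (J_fineK cP a2); exact: mini.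
  rewrite RintegralB//; move: mono minQ.
  by move: (\int[m0]_i _) (\int[m0]_i _) (\int[m0]_i _) (\int[m0]_i _) => a b c e; lra.
have aeQ := aeI m0 ae0 aQ.
have aeP := aeI m0 mP (h_v cP).
apply: (aeS2 m0) aeQ aeP => i [/eqP Ji Qi] [minP [z [_ uz]]].
rewrite -(uz _ minP); apply: uz; split => // y ay.
rewrite subr_eq0 in Ji.
rewrite -(J_fineK cP Qi) (eqP Ji) (J_fineK cP minP.1).
exact: minP.2.
Qed.

(** * Cluster points are equilibria *)

Section cluster.
Variables (eta : PV) (n : nat -> nat).
Hypotheses (ceta : covPG eta) (nk : forall k, (k <= n k)%N) (n0 : forall k, (0 < n k)%N).
Hypothesis cv : d1_cvg eta (etabar \o n).

(** The best reply to a cluster point is measurable as an almost everywhere limit of the profiles of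
    the play. *)
Lemma best_response : exists B : profile, admissible B /\
  {ae m0, forall i, argmin (actions M i) (J^~ eta) (B i)}.
Proof.
have h1 := argmin_stability_ae
  ceta (fun k => etabar_covPG (n0 k)) cv (fun k => Psi_argmin (n0 k)).
have [N [mN N0 NP]] := aeI m0 h1 (h_v ceta).
pose z := cst_cpath T (0 : E).
pose b i := if `[< N i >] then z else xget z [set x | argmin (actions M i) (J^~ eta) x].
have hG i : ~ N i -> argmin (actions M i) (J^~ eta) (b i) /\
    supdist (Psi (n k).+1 i) (b i) @[k --> \oo] --> 0.
  move=> Ni; rewrite /b asboolF//.
  have [h [x [minx _]]] : (forall x, argmin (actions M i) (J^~ eta) x ->
      supdist (Psi (n k).+1 i) x @[k --> \oo] --> 0) /\
      exists ! x, argmin (actions M i) (J^~ eta) x.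
    by apply: contrapT => h; apply: Ni; exact: NP.
  have gx : argmin (actions M i) (J^~ eta) (xget z [set x | argmin (actions M i) (J^~ eta) x]).
    by apply: (@xgetPex _ z [set x | argmin (actions M i) (J^~ eta) x]); exists x.
  by split => //; exact: h.
have mb : measurable_fun setT (b : borel E -> borel V).
  apply: (@measurable_limit _ _ _ metrizes_sup _ _ (~` N) (fun k => Psi (n k).+1) b z).
  - exact: measurableC.
  - by move=> k; exact: measurable_funP.
  - by move=> i /hG[].
  - by move=> i /contrapT Ni; rewrite /b asboolT.
have [B BE] := mfun_exists mb.
have hB : {ae m0, forall i, argmin (actions M i) (J^~ eta) (B i)}.
  exists N; split => // i /= hi; apply: contrapT => Ni; apply: hi.
  by rewrite BE; have [] := hG i Ni.
exists B; split => //.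
by apply: (aeS m0) hB => i [].
Qed.

Variable B : profile.
Hypotheses (aB : admissible B).
Hypothesis minB : {ae m0, forall i, argmin (actions M i) (J^~ eta) (B i)}.

(** Up to the uniform distance of the costs, the integral of J(., eta) against etabar (n k) is the
    regret plus the cost of the best reply to etabar (n k), and the latter is at most the cost of B.
    The regret vanishes, and lower semicontinuity passes to the limit. *)
Lemma cluster_cost_le : \int[eta]_x fine (J x eta) <= \int[m0]_i fine (J (B i) eta).
Proof.
have [c hc] := J_lower_bound ceta.
set u := \int[m0]_i _.
(* J is bounded below on the feasible paths only; F is nonnegative everywhere and equal to J - c
   there *)
pose F x := maxe (J x eta - c%:E)%E 0%E.
have F0 x : (0 <= F x)%E by rewrite /F le_max lexx orbT.
have lF : lower_semicontinuous F.
  move=> x a; rewrite /F lt_max => /orP[ax|a0]; last first.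
    by exists setT => [|y _]; [exact: filterT|exact: (lt_le_trans a0 (F0 y))].
  have ac : ((a + c)%:E < J x eta)%E by rewrite EFinD -lteBrDr.
  have [W nW hW] := J_lsc ceta ac; exists W => // y /hW.
  by rewrite EFinD -lteBrDr// lt_max => ->.
have EF nu : covPG nu -> (\int[nu]_x F x = (\int[nu]_x fine (J x eta) - c)%:E)%E.
  move=> cnu; have i1 := cost_integrable ceta cnu.
  have i2 : nu.-integrable setT (EFin \o (fun=> c)).
    exact: integrable_prob_cst.
  have i12 := RintegrableB measurableT i1 i2.
  rewrite -[X in (_ - X)%:E](Rintegral_prob_cst nu) -RintegralB// /Rintegral fineK; last first.
    by apply: integrable_fin_num.
  apply: ae_eq_integral => //.
  - by apply: lsc_borel_measurable.
  - exact: measurable_int i12.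
  - apply: (aeS nu) (carried cnu) => x Gx _ /=.
    have [_ ax] := Gx; rewrite /F max_l; last by rewrite sube_ge0//; exact: hc.
    by rewrite EFinB (J_fineK ceta ax).
have [C C0 hC] := J_lip_measure hT Lstar fgstar f_lipschitz g_lipschitz.
apply/ler_addgt0Pr => e e0.
have e3 : 0 < e / 3 / C by rewrite !divr_gt0.
have cg : gap (n k).-1.+1 @[k --> \oo] --> 0.
  have g0 := gap_cvg0.
  apply/cvgrPdist_lt => r r0; have /cvgrPdist_lt/(_ r r0)[N _ hN] := g0.
  exists N.+1 => // k /= Nk; apply: hN => /=.
  by rewrite -ltnS prednK//; apply: leq_trans (nk k).
have e30 : 0 < e / 3 by rewrite divr_gt0.
have ev := filterI (cvg_near_lt cg e30) (cv e3).
have [N _ hN] := ev.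
have key k : (N <= k)%N -> (\int[etabar (n k)]_x F x <= (u + e - c)%:E)%E.
  move=> /hN[/=]; rewrite (prednK (n0 k)) => gk dk.
  have ck := etabar_covPG (n0 k); rewrite EF// lee_fin lerD2r.
  have CE : C * (e / 3 / C) = e / 3 by rewrite mulrC divfK// gt_eqF.
  have close x : sobolev x -> `|fine (J x eta) - fine (J x (etabar (n k)))| <= e / 3.
    by move=> sx; rewrite -CE; apply: hC => //; exact: lawc.
  have cstI dS (S : measurableType dS) (Q : probability S R) :
      Q.-integrable setT (EFin \o (fun=> e / 3)).
    exact: integrable_prob_cst.
  have s1 : \int[etabar (n k)]_x fine (J x eta) <=
      \int[etabar (n k)]_x fine (J x (etabar (n k))) + e / 3.
    rewrite -[X in _ + X](Rintegral_prob_cst (etabar (n k))).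
    have j1 := cost_integrable ceta ck; have j2 := cost_integrable ck ck.
    have j3 := cstI _ _ (etabar (n k)).
    have j23 := RintegrableD measurableT j2 j3.
    rewrite -RintegralD//; apply: ae_le_Rintegral => //.
    apply: (aeS (etabar (n k))) (carried ck) => x [_ [sx _ _]].
    by have := close x sx; rewrite ler_norml => /andP[_]; rewrite lerBlDl.
  have s2 : \int[etabar (n k)]_x fine (J x (etabar (n k))) =
      gap (n k) + \int[m0]_i fine (J (Psi (n k).+1 i) (etabar (n k))).
    by rewrite (etabar_integral)// /gap subrK.
  have s3 : \int[m0]_i fine (J (Psi (n k).+1 i) (etabar (n k))) <= u + e / 3.
    rewrite -[X in _ + X](Rintegral_prob_cst m0).
    have [j1 _] := profile_cost_integrable aB ceta.
    have j2 := cstI _ _ m0.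
    have [j3 _] := profile_cost_integrable (Psi_admissible (ltn0Sn (n k))) ck.
    have j23 := RintegrableD measurableT j1 j2.
    rewrite /u -RintegralD//; apply: ae_le_Rintegral => //.
    apply: (aeS2 m0) (Psi_argmin (n0 k)) aB => i [a1 mini] a2.
    have h1 : fine (J (Psi (n k).+1 i) (etabar (n k))) <= fine (J (B i) (etabar (n k))).
      by rewrite -lee_fin (J_fineK ck a1) (J_fineK ck a2); exact: mini.
    apply: le_trans h1 _; have := close (B i) (actions_sobolev a2).
    by rewrite ler_norml => /andP[+ _]; rewrite lerNl opprB lerBlDl.
  move: s1 s3 gk; rewrite s2.
  by move: (\int[_]_x _) (\int[_]_i _) u (gap _) => p q r s; lra.
have := lsc_integral_le metrizes_sup F0 lF (nu := eta) (nuk := fun k => etabar (n (k + N)%N))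
  (a := fun=> u + e - c) (l := u + e - c).
rewrite EF// lee_fin lerD2r; apply.
- move=> r r0; have [N' _ hN'] := cv r0; exists N' => // k /= kN'.
  by apply: hN' => /=; apply: leq_trans kN' (leq_addr _ _).
- by move=> k; apply: key; exact: leq_addl.
- exact: cvg_cst.
Qed.

(** Almost every path under eta is a choice open to the player at its starting point, so costs that
    player at least the best reply; as the integral is no larger, it is the best reply. *)
Lemma cluster_law : measure_eq eta (law m0 B).
Proof.
have [iu _] := profile_cost_integrable aB ceta.
pose u i := fine (J (B i) eta).
have mu_ : measurable_fun setT (EFin \o u : borel E -> \bar R) by exact: measurable_int iu.
have iu0 : eta.-integrable setT (EFin \o (fun x : borel V => u ((x : V) 0))).
  apply/integrableP; split.
    exact: (measurableT_comp mu_ (measurable_eval_at 0)).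
  have /integrableP[_] := iu.
  have mau : measurable_fun setT (fun i : borel E => `|(u i)%:E|%E).
    exact: measurableT_comp.
  by have -> := covPG_integral_initial ceta mau.
have Eu : \int[eta]_x u ((x : V) 0) = \int[m0]_i u i.
  by rewrite /Rintegral; congr fine; exact: (covPG_integral_initial ceta mu_).
have iJ := cost_integrable ceta ceta.
have ih := RintegrableB measurableT iJ iu0.
have min0 := covPG_ae_initial ceta (aeI m0 minB (h_v ceta)).
have ae0 : {ae eta, forall x, fine (J x eta) - u (x 0) = 0}.
  apply: (@ae_Rintegral_eq0 _ _ _ eta (fun x : borel V => fine (J x eta) - u ((x : V) 0))) => //.
    apply: (aeS2 eta) min0 (carried ceta) => x [[a1 mini] _] [_ a2].
    by rewrite subr_ge0 -lee_fin (J_fineK ceta a1) (J_fineK ceta a2); exact: mini.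
  by rewrite RintegralB// Eu subr_le0; exact: cluster_cost_le.
apply: carried_by_graph => //.
have ae1 := aeI eta ae0 (carried ceta).
apply: (aeS2 eta) ae1 min0 => x [/eqP Jx [_ ax]] [min1 [z [_ uz]]].
rewrite -(uz _ min1); apply/esym; apply: uz; split => // y ay.
rewrite subr_eq0 in Jx.
rewrite -(J_fineK ceta ax) (eqP Jx) (J_fineK ceta min1.1).
exact: min1.2.
Qed.

Lemma cluster_nash : nash L f g m0 M B.
Proof.
split => //; have cB := law_covPG aB.
apply: (aeS m0) minB => i [ai mini]; split => // y ay.
rewrite -(J_measure_eq ceta cB cluster_law (actions_sobolev ai)).
by rewrite -(J_measure_eq ceta cB cluster_law (actions_sobolev ay)); exact: mini.
Qed.

End cluster.

(** * Convergence of the play *)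

Lemma cluster_point (P : set nat) : (forall k, P k -> (0 < k)%N) ->
  (forall N, exists2 k, (N <= k)%N & P k) ->
  exists eta n B, [/\ covPG eta, forall k, P (n k), d1_cvg eta (etabar \o n),
    nash L f g m0 M B & measure_eq eta (law m0 B)].
Proof.
move=> P0 freq.
have [eta [n [ceta nk Pn cv]]] := subseq_compact (fun k Pk => etabar_covPG (P0 k Pk)) freq.
have n0 k : (0 < n k)%N := P0 _ (Pn k).
have [B [aB minB]] := best_response ceta n0 cv.
exists eta, n, B; split => //.
  exact: (cluster_nash ceta nk n0 cv aB minB).
exact: (cluster_law ceta nk n0 cv aB minB).
Qed.

(** A subsequence of the means that stays away from eta would have a cluster point; that is an
    equilibrium, hence equal to eta. *)
Lemma d1_cvg_nash (B : profile) eta : covPG eta -> nash L f g m0 M B ->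
  measure_eq eta (law m0 B) -> d1_cvg eta etabar.
Proof.
move=> ceta nB etaB e e0.
pose P := [set k | (0 < k)%N /\ ~ (d1 eta (etabar k) <= e%:E)%E].
have [[N hN]|freq] := eventually_or_frequently P.
  exists N.+1 => // k /= Nk; apply: contrapT => ek.
  by apply: (hN k (ltnW Nk)); split => //; apply: leq_trans Nk.
exfalso.
have [xi [n [B' [cxi Pn cv nB' xiB']]]] := cluster_point (fun k (Pk : P k) => proj1 Pk) freq.
have [N _ /(_ N (leqnn N)) /= hN] := cv e e0.
have [_] := Pn N; apply; apply: le_trans (d1_triangle xi _ _) _.
rewrite -[e%:E]add0e; apply: leeD => //; apply: measure_eq_d1 => A mA.
rewrite (etaB A mA) (xiB' A mA).
apply: law_ae_eq => //; exact: (nash_unique).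
Qed.

(** The profile n+1 is the best reply to the mean n, so it converges pointwise to the best reply to
    eta. *)
Lemma d1_cvg_law (B : profile) eta : covPG eta -> nash L f g m0 M B ->
  measure_eq eta (law m0 B) -> d1_cvg eta etabar ->
  d1_cvg eta (fun n => law m0 (Psi n.+2)).
Proof.
move=> ceta nB etaB cv e e0.
have cv1 : d1_cvg eta (fun n => etabar n.+1).
  move=> r r0; have [N _ hN] := cv r r0; exists N => // k /= Nk.
  by apply: hN => /=; apply: leq_trans Nk (leqnSn k).
have st := argmin_stability_ae
  ceta (fun k => etabar_covPG (ltn0Sn k)) cv1 (fun k => Psi_argmin (ltn0Sn k)).
have [aB minB] := nB; have cB := law_covPG aB.
have minB' : {ae m0, forall i, argmin (actions M i) (J^~ eta) (B i)}.
  apply: (aeS m0) minB => i [ai mini]; split => // y ay.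
  have eqJ := J_measure_eq ceta cB etaB.
  by rewrite (eqJ _ (actions_sobolev ai)) (eqJ _ (actions_sobolev ay)); exact: mini.
have [D D0 hD] := feasible_bounded hT M0 hstar_i.
have gB := admissible_feasible aB.
have gP k := admissible_feasible (Psi_admissible (ltn0Sn k)).
have [D' _ hD'] := admissible_supdist_bounded.
have bd k := hD' _ _ (Psi_admissible (ltn0Sn k)) aB.
have w0 : \int[m0]_i supdist (Psi n.+2 i : V) (B i) @[n --> \oo] --> 0.
  apply: (@ae_Rdominated_cvg0 _ _ _ _ _ D').
  - by move=> k; exact: measurable_supdist.
  - apply: (aeS2 m0) st minB' => i h minBi.
    exact: h.
  - by move=> k; exact: bd.
have := cvg_near_lt w0 e0; apply: filterS => k we.
apply: le_trans (d1_triangle (law m0 B) _ _) _.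
rewrite -[e%:E]add0e; apply: leeD; first exact: measure_eq_d1.
rewrite d1_sym; apply: (@le_trans _ _ (\int[m0]_i supdist (Psi k.+2 i : V) (B i))%:E).
  apply: (d1_coupling metrizes_sup (x0 := cst_cpath T 0) (B := D)).
  - by apply: (aeS m0) (gP k.+1) => i; exact: hD.
  - by apply: (aeS m0) gB => i; exact: hD.
  - by apply: (@ae_bounded_integrable _ _ _ _ D'); [exact: measurable_supdist|exact: bd].
  - by apply: aeW => i; exact: lexx.
by rewrite lee_fin ltW// -[e]add0r.
Qed.

Lemma d1_cvgE eta (xi : nat -> PV) : d1_cvg eta xi -> d1 (xi n) eta @[n --> \oo] --> 0%E.
Proof.
move=> cv.
have d0 k : (0 <= d1 (xi k) eta)%E.
  by apply: (@d1_ge0 _ _ _ _ _ (fun=> 0)) => x y; rewrite subrr normr0 supdist_ge0.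
apply/fine_cvgP; split.
  have := cv 1 ltr01; apply: filterS => k; rewrite d1_sym => h.
  by rewrite ge0_fin_numE// (le_lt_trans h) ?ltry.
apply/cvgrPdist_le => e e0; have := cv e e0; apply: filterS => k.
rewrite d1_sym sub0r normrN => h /=.
rewrite ger0_norm ?fine_ge0// -lee_fin fineK//.
by rewrite ge0_fin_numE// (le_lt_trans h) ?ltry.
Qed.

End game.

Theorem corollary5p3 (R : realType) (d : nat) (T : R) (hT : 0 < T)
    (L : 'rV[R]_d -> 'rV[R]_d -> R)
    (f g : 'rV[R]_d -> Prob (@eucl_dist R d) -> R)
    (m0 : Prob (@eucl_dist R d)) (M : R)
    (m0_non_atomic : non_atomic m0)
    (hstar_i : star_i m0) (hstar_ii : star_ii L) (hstar_iii : star_iii f g)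
    (hM : a_priori_bound T L f g m0 M)
    (h_i : cond_i d T M) (h_ii : cond_ii T L f g m0 M)
    (h_iii : cond_iii T L f g m0 M) (h_iv : cond_iv T m0 M)
    (h_v : cond_v T L f g m0 M)
    (J_monotone : monotone_cost T L f g m0 M)
    (f_lipschitz : lipschitz_C1 f) (g_lipschitz : lipschitz_C1 g)
    (Psi : nat -> {mfun borel 'rV[R]_d >-> borel (cpath T d)})
    (etabar : nat -> Prob (@supdist R T d))
    (fp : fictitious_play L f g m0 M Psi etabar) :
  exists eta : Prob (@supdist R T d),
    [/\ PG m0 M eta,
        nash_distribution L f g m0 M eta,
        forall eta', nash_distribution L f g m0 M eta' -> measure_eq eta' eta,
        d1 (law m0 (Psi n)) eta @[n --> \oo] --> 0%E &
        d1 (etabar n) eta @[n --> \oo] --> 0%E].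
Proof.
have [eta [n [B [ceta _ _ nB etaB]]]] := cluster_point hT hstar_i hstar_ii hstar_iii hM h_i h_ii
  h_iv h_v J_monotone f_lipschitz g_lipschitz fp (P := [set k | (0 < k)%N])
  (fun k hk => hk) (fun N => ex_intro2 _ _ N.+1 (leqnSn N) (ltn0Sn N)).
have cv := d1_cvg_nash hT hstar_i hstar_ii hstar_iii hM h_i h_ii
  h_iv h_v J_monotone f_lipschitz g_lipschitz fp ceta nB etaB.
have cvl := d1_cvg_law hT hstar_i hstar_ii hstar_iii hM h_i h_ii
  h_v f_lipschitz g_lipschitz fp ceta nB etaB cv.
exists eta; split.
- by exists B => //; have [] := nB.
- by exists B.
- move=> eta' [B' nB' etaB'] A mA; rewrite (etaB' A mA) (etaB A mA).
  apply: law_ae_eq => //.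
  exact: (nash_unique hT hstar_i hstar_ii hstar_iii hM h_i h_ii h_v J_monotone).
- rewrite -(cvg_shiftS (fun n => d1 (law m0 (Psi n)) eta)).
  rewrite -(cvg_shiftS (fun n => d1 (law m0 (Psi n.+1)) eta)).
  exact: d1_cvgE cvl.
- exact: d1_cvgE.
Qed.
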